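(* Let a finite group $G$ be the mutually permutable product of its subgroups $A$ and $B$. Then: (1) $\max\{h^*(A), h^*(B)\}\leq h^*(G)\leq \max\{h^*(A), h^*(B)\}+1$. (2) $\max\{\lambda_p(A), \lambda_p(B)\}= \lambda_p(G)$ for any prime $p$. In particular, $\max\{\lambda(A), \lambda(B)\}= \lambda(G)$.
   Context: All groups are finite. A group $G$ is a mutually permutable product of its subgroups $A$ and $B$ if $G=AB$, $A$ permutes with every subgroup of $B$ (i.e. $AX=XA$ for all $X\le B$), and $B$ permutes with every subgroup of $A$. Generalized Fitting height: let $\mathrm{F}^*(G)$ denote the generalized Fitting subgroup of $G$. Put $\mathrm{F}^*_{(0)}(G)=1$ and let $\mathrm{F}^*_{(i+1)}(G)$ be the inverse image in $G$ of $\mathrm{F}^*(G/\mathrm{F}^*_{(i)}(G))$. Then $h^*(G)$ is the least number $h\ge 0$ such that $\mathrm{F}^*_{(h)}(G)=G$. Non-$p$-soluble length: let $p$ be a prime. A group is $p$-soluble if each of its chief factors is either a $p$-group or a $p'$-group. Let $1=G_0\leq G_1\leq\dots\leq G_{2h+1}=G$ be a shortest series of normal subgroups of $G$ in which for $i$ even the factor $G_{i+1}/G_i$ is $p$-soluble (possibly trivial), and for $i$ odd the factor $G_{i+1}/G_i$ is a (non-empty) direct product of nonabelian simple groups. Then $\lambda_p(G)=h$ (so $\lambda_p(G)=0$ exactly when $G$ is $p$-soluble). The nonsoluble length is $\lambda(G)=\lambda_2(G)$. *)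

(* Defs.v *)
From HB Require Import structures.
From mathcomp Require Import all_boot all_order all_fingroup all_solvable.

Set Implicit Arguments.
Unset Strict Implicit.
Unset Printing Implicit Defensive.

Local Open Scope group_scope.

Definition permutes_with_subgroups (gT : finGroupType) (A B : {group gT}) :
    Prop :=
  forall X : {group gT}, X \subset B -> A * X = X * A.

Definition mutually_permutable_product (gT : finGroupType)
    (G A B : {group gT}) : Prop :=
  [/\ G :=: A * B, permutes_with_subgroups A B & permutes_with_subgroups B A].

(* The simple quotient is automatically nonabelian, since K is perfect. *)
Definition quasisimple (gT : finGroupType) (K : {group gT}) : bool :=
  (K^`(1) == K :> {set gT}) && simple (K / 'Z(K)).

Definition component (gT : finGroupType) (K G : {group gT}) : bool :=
  (K <|<| G) && quasisimple K.

Definition layer (gT : finGroupType) (G : {group gT}) : {group gT} :=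
  <<\bigcup_(K : {group gT} | component K G) K>>%G.

Definition genFitting (gT : finGroupType) (G : {group gT}) : {group gT} :=
  ('F(G) <*> layer G)%G.

(* [f @*^-1 R] is the preimage within the domain of [f], here 'N(F*_(j)(G));
   as F*_(j)(G) <= G, the preimage of a subgroup of G / F*_(j)(G) lies in G. *)
Fixpoint genFitting_series (gT : finGroupType) (i : nat) (G : {group gT}) :
    {group gT} :=
  if i is j.+1 then
    let F := genFitting_series j G in (coset F @*^-1 genFitting (G / F))%G
  else 1%G.

Definition p_soluble (gT : finGroupType) (p : nat) (G : {group gT}) : bool :=
  [forall U : {group gT}, forall V : {group gT},
     chief_factor G V U ==> p.-group (U / V) || p^'.-group (U / V)].

(* Direct product as an internal one; its factors are nontrivial, hence
   pairwise distinct, so that indexing by a set of subgroups loses nothing. *)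
Definition nonabelian_simple_product (gT : finGroupType) (G : {group gT}) :
    bool :=
  [exists S : {set {group gT}},
     [&& S != set0,
         [forall H in S, simple (H : {group gT}) && ~~ abelian H] &
         \big[dprod/1]_(H in S) H == G]].

Definition lambda_series (gT : finGroupType) (p : nat) (G : {group gT})
    (h : nat) (s : h.*2.+2.-tuple {group gT}) : bool :=
  let G_ := nth 1%G s in
  [&& G_ 0 == 1%G, G_ h.*2.+1 == G,
      [forall i : 'I_h.*2.+2, G_ i <| G] &
      [forall i : 'I_h.*2.+1,
         (G_ i \subset G_ i.+1) &&
         (if odd i then nonabelian_simple_product (G_ i.+1 / G_ i)
          else p_soluble p (G_ i.+1 / G_ i))]].

Definition has_lambda_series (gT : finGroupType) (p : nat) (G : {group gT})
    (h : nat) : bool :=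
  [exists s : h.*2.+2.-tuple {group gT}, lambda_series p G s].

Section Existence.

Variable gT : finGroupType.
Implicit Types G H K M N U V : {group gT}.

Lemma bigdprod_inj (I : finType) (A : {set I}) (F : I -> {group gT}) G :
  \big[dprod/1]_(i in A) F i = G -> (forall i, i \in A -> F i :!=: 1) ->
  {in A &, injective F}.
Proof.
move=> defG ntF i j Ai Aj eqF; apply/eqP/idPn => ne_ij.
move: defG; rewrite (bigD1 i) //= (bigD1 j) /=; last by rewrite Aj eq_sym.
case/dprodP=> [[K1 K2 _ defK2]] _ _.
rewrite defK2; case/dprodP: defK2 => [[K3 K4 _ defK4]] defK2 _ _ tiK.
have /eqP[] := ntF i Ai; apply/trivgP; rewrite -tiK subsetI subxx eqF /=.
by rewrite defK4 in defK2 *; rewrite -defK2 mulG_subl.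
Qed.

Lemma minnormal_nonsol_product M G :
  minnormal M G -> ~~ solvable M -> nonabelian_simple_product M.
Proof.
move=> minM nsolM; have chM := minnormal_charsimple minM.
have ntM : M :!=: 1 by case/charsimpleP: chM.
have [H [sHM simH [I Aut_I defM]]] := charsimple_dprod chM.
pose F (f : {perm gT}) := <<[set f x | x in H]>>%G.
have FE f : f \in I -> F f = f @: H :> {set gT}.
  move=> If; have Af := subsetP Aut_I f If.
  by rewrite /F /= -(autmE Af) -morphimEsub // genGid.
have isoF f : f \in I -> H \isog F f.
  move=> If; have Af := subsetP Aut_I f If.
  rewrite FE // -(autmE Af) -morphimEsub //.
  by rewrite sub_isog ?injm_autm.
have defMF : \big[dprod/1]_(f in I) F f = M.
  by rewrite -defM; apply: eq_bigr => f If; rewrite FE.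
have ntH : H :!=: 1 by case/simpleP: simH.
have injF : {in I &, injective F}.
  apply: (bigdprod_inj defMF) => f If.
  by rewrite -(isog_eq1 (isoF f If)).
have nabH : ~~ abelian H.
  apply: contra nsolM => abH.
  apply: nilpotent_sol; apply: (bigdprod_nil defMF) => f If.
  by rewrite abelian_nil // -(isog_abelian (isoF f If)).
apply/existsP; exists [set F f | f in I]; apply/and3P; split.
- apply: contraNneq ntM => I0; rewrite -defM big1 // => f If.
  by have := imset_f F If; rewrite I0 inE.
- apply/forall_inP=> _ /imsetP[f If ->].
  by rewrite -(isog_simple (isoF f If)) simH -(isog_abelian (isoF f If)).
- by rewrite big_imset //= defMF.
Qed.


Lemma nonabelian_simple_product_component M G :
  M <| G -> nonabelian_simple_product M ->
  exists2 K : {group gT}, component K G & K :!=: 1.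
Proof.
move=> nsMG /existsP[S /and3P[/set0Pn[K SK] /forall_inP simS /eqP defM]].
have /andP[simK nabK] := simS K SK; have /simpleP[ntK maxK] := simK.
exists K => //; apply/andP; split.
  apply: subnormal_trans (normal_subnormal nsMG); apply: normal_subnormal.
  move: defM; rewrite (bigD1 K) //= => /dprodP[[K1 K2 -> defK2]] defM cK _.
  rewrite defK2 in defM cK.
  by rewrite /normal -defM mulG_subl mul_subG ?normG // cents_norm.
have Z1 : 'Z(K) = 1.
  have [|//|ZK] := maxK 'Z(K)%G; first exact: center_normal.
  by case/negP: nabK; rewrite /abelian -{1}ZK subsetIr.
rewrite /quasisimple /= Z1 -(isog_simple (quotient1_isog K)) simK andbT.
have [|/commG1P abK|->] := maxK (K^`(1))%G; first exact: der_normal.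
  by case/negP: nabK.
by [].
Qed.

Lemma genFitting_neq1 G : G :!=: 1 -> genFitting G :!=: 1.
Proof.
move=> ntG; have [M minM sMG] := minnormal_exists ntG (normG G).
have [/andP[ntM nMG] _] := mingroupP minM.
have nsMG : M <| G by apply/andP.
suffices [K sK ntK] : exists2 K : {group gT}, K \subset genFitting G & K :!=: 1.
  by apply: contra ntK => /eqP F1; rewrite -subG1 -F1.
have [solM | nsolM] := boolP (solvable M).
  exists M => //; apply: subset_trans (joing_subl _ _).
  have [_ _ /is_abelemP[p _ abM]] := minnormal_solvable minM (subxx _) solM.
  by rewrite Fitting_max // abelian_nil // (abelem_abelian abM).
have [K cK ntK] := nonabelian_simple_product_component nsMG
  (minnormal_nonsol_product minM nsolM).
exists K => //; apply: subset_trans (joing_subr _ _).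
by rewrite sub_gen // (bigcup_max K).
Qed.

Lemma quasisimpleJ K x : quasisimple K -> quasisimple (K :^ x).
Proof.
case/andP=> /eqP perfK simK; apply/andP; split; first by rewrite derJ perfK.
suffices isoKx : K / 'Z(K) \isog K :^ x / 'Z(K :^ x) by rewrite -(isog_simple isoKx).
have injf : 'injm (conjgm K x) by apply: injm_conj.
have imK : conjgm K x @* K = K :^ x by rewrite morphim_conj setIid.
have imZ : conjgm K x @* 'Z(K) = 'Z(K :^ x) by rewrite injm_center ?imK.
have nsZ := center_normal K.
have isoq : K / 'Z(K) \isog conjgm K x @* K / (conjgm K x @* 'Z(K)).
  apply/isogP; exists (quotm_morphism (conjgm_morphism K x) nsZ).
    exact: injm_quotm.
  exact: morphim_quotm.
by rewrite imK imZ in isoq.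
Qed.

Lemma componentJ K G x : x \in G -> component K G -> component (K :^ x) G.
Proof.
move=> Gx /andP[snKG qsK]; rewrite /component quasisimpleJ // andbT.
have := morphim_subnormal (conjgm_morphism G x) snKG.
by rewrite !morphim_conj setIid conjGid // (setIidPr (subnormal_sub snKG)).
Qed.

Lemma genFitting_normal G : genFitting G <| G.
Proof.
rewrite /genFitting /= normalY ?Fitting_normal //.
apply/andP; split.
  by rewrite gen_subG; apply/bigcupsP=> K /andP[/subnormal_sub].
apply: norms_gen; apply/subsetP=> x Gx; rewrite inE.
apply/subsetP=> _ /imsetP[z /bigcupP[K cK Kz] ->].
by apply/bigcupP; exists (K :^ x)%G; rewrite ?componentJ // memJ_conjg.
Qed.

End Existence.

Section ExistenceQuotients.

Variable gT : finGroupType.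
Implicit Types G H K M N U V : {group gT}.

Lemma genFitting_series_normal i G : genFitting_series i G <| G.
Proof.
elim: i => [|i IHi] /=; first exact: normal1.
by rewrite -{2}(quotientGK IHi) cosetpre_normal genFitting_normal.
Qed.

Lemma genFitting_series_stop G : exists h, genFitting_series h G == G.
Proof.
have ltF i : i < #|genFitting_series i G| \/ genFitting_series i G == G.
  elim: i => [|i IHi] /=; first by left; rewrite cards1.
  have nsF := genFitting_series_normal i G.
  have [defG | neqF] := boolP (genFitting_series i G == G).
    right; rewrite -val_eqE /= eqEsubset.
    rewrite (normal_sub (genFitting_series_normal i.+1 G)) /=.
    by rewrite -{1}(eqP defG) sub_cosetpre.
  left; case: IHi => [lt_i | /idPn//]; apply: leq_ltn_trans lt_i _.
  rewrite card_cosetpre ltn_Pmulr ?cardG_gt0 // cardG_gt1.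
  apply: genFitting_neq1; rewrite -subG1 quotient_sub1 ?normal_norm //.
  by apply: contra neqF => sGF; rewrite -val_eqE /= eqEsubset sGF normal_sub.
exists #|G|; have [|//] := ltF #|G|.
by rewrite ltnNge subset_leq_card // normal_sub ?genFitting_series_normal.
Qed.

Lemma solvable_p_soluble (rT : finGroupType) p (G : {group rT}) : solvable G -> p_soluble p G.
Proof.
move=> solG; apply/forallP=> U; apply/forallP=> V; apply/implyP=> chUV.
have [/maxgroupP[/andP[/andP[sVU _] _] _] nsUG] := andP chUV.
have minUV := chief_factor_minnormal chUV.
have [_ _ /is_abelemP[q _ /abelem_pgroup qUV]] :=
  minnormal_solvable minUV (quotientS _ (normal_sub nsUG)) (quotient_sol _ solG).
have [eqp | neqp] := eqVneq q p; first by rewrite -eqp qUV.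
by apply/orP; right; apply: pi_pgroup qUV _; rewrite !inE.
Qed.

Lemma lambda_series_above p G U : U <| G ->
  exists h, exists f : nat -> {group gT},
    [/\ f 0 = U, f h.*2.+1 = G, forall i, i < h.*2.+2 -> f i <| G
      & forall i, i < h.*2.+1 -> f i \subset f i.+1 /\
         if odd i then nonabelian_simple_product (f i.+1 / f i)
         else p_soluble p (f i.+1 / f i)].
Proof.
have [m] := ubnP (#|G| - #|U|); elim: m U => // m IHm U leUm nsUG.
have [N maxN _] : {N : {group gT} |
    [max N | [&& N <| G, U \subset N & solvable (N / U)]] & U \subset N}.
  by apply: maxgroup_exists; rewrite nsUG subxx trivg_quotient solvable1.
have [/and3P[nsNG sUN solNU] maxN'] := maxgroupP maxN.
have psolNU := solvable_p_soluble p solNU.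
have [eqNG | neqNG] := eqVneq N G.
  exists 0, (fun i => if i is 0 then U else G); split=> //.
    by case=> [|i] _.
  by case=> // _ /=; rewrite -eqNG.
have ntGN : (G / N) != 1.
  rewrite -subG1 quotient_sub1 ?normal_norm //.
  by apply: contra neqNG => sGN; rewrite -val_eqE /= eqEsubset sGN normal_sub.
have [Mb minM sMG] := minnormal_exists ntGN (normG _).
have [/andP[ntM nMG] _] := mingroupP minM.
have nsMb : Mb <| G / N by rewrite /normal sMG.
have [M defM sNM nsMG] := inv_quotientN nsNG nsMb.
have ltNM : #|N| < #|M|.
  apply: proper_card; rewrite properE sNM /=; apply: contra ntM => sMN.
  rewrite defM -subG1 quotient_sub1 //.
  exact: subset_trans (normal_sub nsMG) (normal_norm nsNG).
have nsolMN : ~~ solvable Mb.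
  rewrite defM; apply/negP=> solMN.
  have sMG0 := normal_sub nsMG.
  have nsUM : U <| M by apply: normalS nsUG => //; apply: subset_trans sNM.
  have nsNM : N <| M by apply: normalS nsNG.
  have eqMN : M :=: N.
    apply: maxN' => //; rewrite nsMG (subset_trans sUN) //=.
    rewrite (series_sol (quotient_normal U nsNM)) solNU /=.
    by rewrite (isog_sol (third_isog sUN nsUM nsNM)).
  by rewrite eqMN ltnn in ltNM.
have prodMN := minnormal_nonsol_product minM nsolMN.
have [|h [f [f0 fG nf sf]]] := IHm M _ nsMG.
  have ltUM := leq_ltn_trans (subset_leq_card sUN) ltNM.
  have leMG := subset_leq_card (normal_sub nsMG).
  exact: leq_trans (ltn_sub2l (leq_trans ltUM leMG) ltUM) leUm.
exists h.+1, (fun i => if i is j.+1 then if j is k.+1 then f k else N else U).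
split=> //.
  by case=> [|[|i]] //; rewrite doubleS; apply: nf.
case=> [|[|i]]; rewrite ?doubleS ?ltnS => lti //=; last first.
  by have := sf i lti; rewrite /= negbK.
rewrite f0; split=> //.
by have -> : (M / N)%G = Mb by apply: val_inj; rewrite /= defM.
Qed.

Lemma has_lambda_series_exists p G : exists h, has_lambda_series p G h.
Proof.
have [h [f [f0 fG nf sf]]] := lambda_series_above p (normal1 G).
pose t := [tuple of mkseq f h.*2.+2].
have tE i : i < h.*2.+2 -> nth 1%G t i = f i by apply: nth_mkseq.
exists h; apply/existsP; exists t.
apply/and4P; split.
- by rewrite tE ?f0.
- by rewrite tE ?fG.
- by apply/forallP=> i; rewrite tE ?nf.
apply/forallP=> i; have [si fi] := sf i (ltn_ord i).
rewrite (tE i (leqW (ltn_ord i))) (tE i.+1 (ltn_ord i)).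
by apply/andP; split; [exact: si | exact: fi].
Qed.

End ExistenceQuotients.

Definition generalized_fitting_height (gT : finGroupType) (G : {group gT}) :
    nat :=
  ex_minn (genFitting_series_stop G).

Definition nonsoluble_p_length (gT : finGroupType) (p : nat) (G : {group gT}) :
    nat :=
  ex_minn (has_lambda_series_exists p G).

Definition nonsoluble_length (gT : finGroupType) (G : {group gT}) : nat :=
  nonsoluble_p_length 2 G.

(* Main.v *)
Require Import Defs.
From mathcomp Require Import all_boot all_order all_fingroup all_solvable.

Set Implicit Arguments.
Unset Strict Implicit.
Unset Printing Implicit Defensive.

Local Open Scope group_scope.

(** Both invariants are lengths of one kind of series.  Fix a class of chief
    factors (all of them for h*, those that are neither p- nor p'-groups for
    lambda_p) and let R(G, W) consist of the elements of G inducing inner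
    automorphisms on every chief factor of the class above W.  Iterating R
    from W = 1 gives the series F*_(i)(G) in the first case; in the second case
    lambda_p(G) is the number of steps after which the quotient is p-soluble.

    Let N be a minimal normal subgroup of a mutually permutable product G = AB.
    If A and B both avoid N, then |N| is prime; otherwise N = (A \cap N)(B \cap N).
    - If N is nonabelian, Kegel's argument shows that A \cap N and B \cap N are
      normal in N and that A centralises the complement of A \cap N in N, so
      that R(A) and R(B) induce inner automorphisms on N.
    - If N is abelian, only [R(A), A] is seen to centralise N, using that A' is
      subnormal in G.  Enlarging W by a section central in G / W does not change
      R(G, W), so the induction still closes as long as a further step remains.
      Otherwise R(A) = A and R(B) = B, which only forces G / C_G(N) to be
      nilpotent: this is the extra unit in the bound for h*.  For lambda_p the
      abelian case does not occur. *)

(** * Chief factors *)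

(** The induction treats one chief factor at a time. Having length at most n passes from G / W1 and
    G / W2 to [G / (W1 :&: W2)], and the radical is an intersection of groups [inner_on G U V], so
    it is enough to bound the length above each of these. Modulo V the factor U / V becomes a
    minimal normal subgroup of a mutually permutable product. For the bounds on A and B, a chief
    factor of A is realised as a section of a chief factor of G. This is why the class is described
    by orders: both classes used are closed under multiples. The obstacle in the abelian case is
    that the radical of A is known to act trivially only on the A-chief factors inside [A :&: N],
    which says nothing about [N / (A :&: N)]. That quotient is covered by cyclic subgroups
    normalised by A, and since a cyclic group has an abelian automorphism group, the derived
    subgroup A' acts trivially on it. *)

Section ChiefFactors.

Variable gT : finGroupType.
Implicit Types G H K M N U V W X Y E : {group gT}.

Lemma chief_factorP G V U :
  reflect [/\ V <| G, U <| G, V \proper U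
            & forall X, X <| G -> V \subset X -> X \subset U ->
                X :=: V \/ X :=: U]
          (chief_factor G V U).
Proof.
apply: (iffP andP) => [[/maxgroupP[/andP[prVU nVG] maxV] nsUG]|[nsVG nsUG prVU minU]].
  have nsVG: V <| G.
    by rewrite /normal nVG (subset_trans (proper_sub prVU)) ?normal_sub.
  split=> // X nsXG sVX sXU; have [eqXU | neqXU] := eqVneq (X : {set gT}) U.
    by right.
  left; apply: maxV => //; rewrite (normal_norm nsXG) andbT.
  by rewrite properEneq neqXU.
split=> //; apply/maxgroupP; rewrite prVU (normal_norm nsVG); split=> // X.
case/andP=> prXU nXG sVX.
have nsXG: X <| G.
  by rewrite /normal nXG (subset_trans (proper_sub prXU)) ?normal_sub.
have [//|eqXU] := minU X nsXG sVX (proper_sub prXU).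
by rewrite eqXU properxx in prXU.
Qed.

Lemma chief_factor_between G Y X : Y <| G -> X <| G -> Y \proper X ->
  exists2 U : {group gT}, chief_factor G Y U & U \subset X.
Proof.
move=> nsYG nsXG prYX.
have nYX := subset_trans (normal_sub nsXG) (normal_norm nsYG).
have ntXY: X / Y != 1.
  by rewrite -subG1 quotient_sub1 // proper_subn.
have [M minM sMX] := minnormal_exists ntXY (quotient_norms Y (normal_norm nsXG)).
have [/andP[ntM nMG] minM'] := mingroupP minM.
have nsM: M <| G / Y.
  by rewrite /normal nMG (subset_trans sMX) ?quotientS ?normal_sub.
have [U defM sYU nsUG] := inv_quotientN nsYG nsM.
have nYU := subset_trans (normal_sub nsUG) (normal_norm nsYG).
have sUX: U \subset X.
  by rewrite -(quotientSGK nYU (proper_sub prYX)) -defM.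
exists U => //; apply/chief_factorP; split=> //.
  rewrite properE sYU; apply: contra ntM => sUY.
  by rewrite defM -subG1 quotient_sub1.
move=> Z nsZG sYZ sZU.
have nYZ := subset_trans (normal_sub nsZG) (normal_norm nsYG).
have [ZY1 | ntZY] := eqVneq (Z / Y) 1.
  left; apply/eqP; rewrite eqEsubset sYZ andbT -quotient_sub1 //.
  by rewrite ZY1 subxx.
right; apply/eqP; rewrite eqEsubset sZU /= -(quotientSGK nYU sYZ) -defM.
rewrite -(minM' (Z / Y)%G) ?subxx //=; last by rewrite defM quotientS.
by rewrite ntZY quotient_norms ?normal_norm.
Qed.

(* The elements of G inducing inner automorphisms on U / V. *)
Definition inner_on G U V := (U <*> 'C_G(U / V | 'Q))%G.

Lemma sub_factor_cent G U V (A : {set gT}) : V <| G -> U <| G -> A \subset G ->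
  (A \subset 'C_G(U / V | 'Q)) = ([~: A, U] \subset V).
Proof.
move=> nsVG nsUG sAG; rewrite subsetI sAG sub_astabQR //.
  exact: subset_trans sAG (normal_norm nsVG).
exact: subset_trans (normal_sub nsUG) (normal_norm nsVG).
Qed.

Lemma factor_cent_normal G U V : V <| G -> U <| G -> 'C_G(U / V | 'Q) <| G.
Proof.
move=> nsVG nsUG; rewrite /normal subsetIl /=.
rewrite astabQ normsI ?normG //.
apply: subset_trans (morphpre_norm _ _).
rewrite -sub_quotient_pre; last exact: normal_norm.
by rewrite norms_cent // quotient_norms ?normal_norm.
Qed.

Lemma inner_on_normal G U V : V <| G -> U <| G -> inner_on G U V <| G.
Proof. by move=> nsVG nsUG; rewrite normalY ?factor_cent_normal. Qed.

Lemma inner_onE G U V : V <| G -> U <| G ->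
  inner_on G U V = U * 'C_G(U / V | 'Q) :> {set gT}.
Proof.
move=> nsVG nsUG; rewrite /= norm_joinEr //.
exact: subset_trans (subsetIl _ _) (normal_norm nsUG).
Qed.

Lemma sub_inner_on G U V : U \subset inner_on G U V.
Proof. exact: joing_subl. Qed.

Lemma sub_cent_inner_on G U V (A : {set gT}) : V <| G -> U <| G -> A \subset G ->
  [~: A, U] \subset V -> A \subset inner_on G U V.
Proof.
move=> nsVG nsUG sAG sAUV; apply: subset_trans (joing_subr _ _).
by rewrite sub_factor_cent.
Qed.

(** Here E avoids U / V: by minimality [U :&: (V <*> E) = V]. Multiplying by E gives a G-isomorphic
    factor above E, and E itself centralises U / V, so being inner on the new factor implies being
    inner on the old one. *)
Lemma chief_factor_join G U V E :
    chief_factor G V U -> E <| G -> ~~ (U \subset V * E) ->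
  [/\ chief_factor G (V <*> E) (U <*> E),
      inner_on G (U <*> E)%G (V <*> E)%G \subset inner_on G U V
    & #|U <*> E : V <*> E| = #|U : V|].
Proof.
case/chief_factorP=> nsVG nsUG prVU minU nsEG nsUVE.
have sVU := proper_sub prVU.
have nsVEG : V <*> E <| G by rewrite normalY.
have nsUEG : U <*> E <| G by rewrite normalY.
have nEU : E \subset 'N(U).
  exact: subset_trans (normal_sub nsEG) (normal_norm nsUG).
have nEV : E \subset 'N(V).
  exact: subset_trans (normal_sub nsEG) (normal_norm nsVG).
have tiU : U :&: (V <*> E) = V.
  have [||| //|eqU] := minU (U :&: (V <*> E))%G.
  - exact: normalI.
  - by rewrite subsetI sVU joing_subl.
  - exact: subsetIl.
  case/negP: nsUVE; rewrite -norm_joinEr //.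
  by apply/setIidPl; exact: eqU.
split.
- apply/chief_factorP; split=> //.
    rewrite properE genS ?setSU //=; apply: contra nsUVE => sUE.
    by rewrite -norm_joinEr // (subset_trans _ sUE) ?joing_subl.
  move=> X nsXG sVEX sXUE; have [sVX sEX]: V \subset X /\ E \subset X.
    by apply/andP; rewrite -join_subG.
  have defX : X :=: (X :&: U) * E.
    by rewrite group_modr // -norm_joinEr //; apply/esym/setIidPl.
  have [|||eqV|eqU] := minU (X :&: U)%G; first exact: normalI.
  - by rewrite subsetI sVX.
  - exact: subsetIr.
  - by left; rewrite defX eqV /= norm_joinEr.
  by right; rewrite defX eqU /= norm_joinEr.
- have sEC : E \subset 'C_G(U / V | 'Q).
    rewrite sub_factor_cent ?(normal_sub nsEG) //.
    apply: subset_trans (_ : _ \subset U :&: (V <*> E)) _; last by rewrite tiU.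
    rewrite subsetI commg_subr nEU /= (subset_trans _ (joing_subr _ _)) // commg_subl.
    exact: subset_trans (normal_sub nsUG) (normal_norm nsEG).
  rewrite join_subG join_subG joing_subl (subset_trans sEC) ?joing_subr //=.
  set C := 'C_G(_ | _); have sCG : C \subset G := subsetIl _ _.
  apply: sub_cent_inner_on => //.
  apply: subset_trans (_ : _ \subset U :&: (V <*> E)) _; last by rewrite tiU.
  rewrite subsetI commg_subr (subset_trans sCG (normal_norm nsUG)) /=.
  apply: subset_trans (commgS _ (joing_subl U E)) _.
  by rewrite -(sub_factor_cent nsVEG nsUEG).
have -> : U <*> E = (V <*> E) * U.
  rewrite normC; last first.
    exact: subset_trans (normal_sub nsVEG) (normal_norm nsUG).
  by rewrite !norm_joinEr // mulgA (mulGSid sVU).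
by rewrite indexMg -indexgI tiU.
Qed.

(** The complementary case, where E covers U / V: then [U = V * (U :&: E)] and the factor can be
    moved inside E. *)
Lemma chief_factor_meet G U V E :
    chief_factor G V U -> E <| G -> U \subset V * E ->
  [/\ chief_factor G (V :&: E) (U :&: E),
      inner_on G (U :&: E)%G (V :&: E)%G \subset inner_on G U V
    & #|U :&: E : V :&: E| = #|U : V|].
Proof.
case/chief_factorP=> nsVG nsUG prVU minU nsEG sUVE.
have sVU := proper_sub prVU.
have nsUEG : U :&: E <| G by apply: normalI.
have nsVEG : V :&: E <| G by apply: normalI.
have defU : U :=: V * (U :&: E).
  by rewrite setIC group_modl // setIC; apply/esym/setIidPl.
split.
- apply/chief_factorP; split=> //.
    rewrite properE setSI //=; apply: contra (proper_subn prVU) => sUEV.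
    by rewrite defU mul_subG // (subset_trans sUEV) ?subsetIl.
  move=> X nsXG sVEX; rewrite subsetI => /andP[sXU sXE].
  have nXV : X \subset 'N(V).
    exact: subset_trans (normal_sub nsXG) (normal_norm nsVG).
  have [|||eqV|eqU] := minU (V <*> X)%G; first exact: normalY.
  - exact: joing_subl.
  - by rewrite join_subG sVU.
  - left; apply/eqP; rewrite eqEsubset sVEX andbT subsetI sXE andbT.
    by rewrite -eqV joing_subr.
  right; rewrite /= -eqU /= norm_joinEr // setIC -group_modr // setIC.
  by apply/esym/mulSGid.
- rewrite join_subG (subset_trans (subsetIl _ _)) ?sub_inner_on //=.
  rewrite sub_cent_inner_on ?subsetIl // {2}defU.
  set C := 'C_G(_ | _).
  have sCG : C \subset G := subsetIl _ _.
  have nCV : C \subset 'N(V) := subset_trans sCG (normal_norm nsVG).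
  rewrite commGC commMG; last first.
    apply: normsR.
      exact: subset_trans (subsetIl _ _)
               (subset_trans (normal_sub nsUG) (normal_norm nsVG)).
    apply: subset_trans (normal_norm (factor_cent_normal nsVEG nsUEG)).
    exact: normal_sub.
  rewrite mul_subG //; first by rewrite commg_subl.
  rewrite commGC (subset_trans _ (subsetIl V E)) //.
  by rewrite -(sub_factor_cent nsVEG nsUEG).
rewrite {2}defU indexMg -(indexgI _ V); congr (#|_ : _|).
by rewrite setIAC (setIidPr sVU).
Qed.

(** If W1 avoids U / V, the factor moves above W1. Otherwise it moves inside W1, where W2 cannot
    cover it because [W1 :&: W2 \subset V], and it then moves above W2. *)
Lemma chief_factor_above G U V W1 W2 :
    chief_factor G V U -> W1 <| G -> W2 <| G -> W1 :&: W2 \subset V ->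
  exists V' U', [/\ chief_factor G V' U', W1 \subset V' \/ W2 \subset V',
                   inner_on G U' V' \subset inner_on G U V
                 & #|U' : V'| = #|U : V|].
Proof.
move=> chUV nsW1 nsW2 sWV.
have [sUVW | nsUVW] := boolP (U \subset V * W1); last first.
  have [ch1 sI1 eqi1] := chief_factor_join chUV nsW1 nsUVW.
  by exists (V <*> W1)%G, (U <*> W1)%G; rewrite joing_subr; split; auto.
have [ch1 sI1 eqi1] := chief_factor_meet chUV nsW1 sUVW.
have [_ _ prVU1 _] := chief_factorP _ _ _ ch1.
have [sUVW2 | nsUVW2] := boolP (U :&: W1 \subset (V :&: W1) * W2); last first.
  have [ch2 sI2 eqi2] := chief_factor_join ch1 nsW2 nsUVW2.
  exists ((V :&: W1) <*> W2)%G, ((U :&: W1) <*> W2)%G; split=> //.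
  - by right; apply: joing_subr.
  - exact: subset_trans sI2 sI1.
  by rewrite eqi2.
case/negP: (proper_subn prVU1).
have defU1: (V :&: W1) * (W2 :&: (U :&: W1)) = U :&: W1.
  rewrite (group_modl W2 (proper_sub prVU1)) setIC.
  exact/setIidPl.
rewrite /= -{1}defU1 mul_subG // subsetI (subset_trans _ sWV) /=.
  by rewrite setIA subsetIr.
by rewrite setICA [W2 :&: _]setIC subsetIr.
Qed.

End ChiefFactors.

(** * Inner radicals and the length they define *)

Section Radical.

Variables (phi : pred nat) (gT : finGroupType).
Implicit Types G H K M N U V W X Y E : {group gT}.

(* The class of chief factors is given by a predicate [phi] on their orders.
   Everything is relative to a normal subgroup [W] of [G] rather than to the
   quotient [G / W], so that the induction on the length stays in one group. *)
Definition inner_radical G W :=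
  (G :&: \bigcap_(P : {group gT} * {group gT}
                  | [&& chief_factor G P.1 P.2, W \subset P.1
                      & phi #|P.2 : P.1|]) inner_on G P.2 P.1)%G.

Definition no_phi_factor G W :=
  forall V U, chief_factor G V U -> W \subset V -> ~~ phi #|U : V|.

(** The end condition serves both invariants: for [predT] it forces the last radical to be G, for
    orders that are neither p- nor p'-numbers it says that the remaining quotient is p-soluble. *)
Fixpoint phi_length_le n G W : Prop :=
  if n is m.+1 then phi_length_le m G (inner_radical G W)
  else no_phi_factor G W.

Lemma sub_inner_radicalP G W (A : {set gT}) : A \subset G ->
  (forall V U, chief_factor G V U -> W \subset V -> phi #|U : V| ->
     A \subset inner_on G U V) <-> A \subset inner_radical G W.
Proof.
move=> sAG; split=> [sAI | ].
  rewrite subsetI sAG; apply/bigcapsP=> [[V U]] /= /and3P[chUV sWV phiUV].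
  exact: sAI.
rewrite subsetI => /andP[_ /bigcapsP sAI] V U chUV sWV phiUV.
by apply: (sAI (V, U)); apply/and3P.
Qed.

Lemma inner_radical_sub G W : inner_radical G W \subset G.
Proof. exact: subsetIl. Qed.

Lemma inner_radical_inner G W V U :
  chief_factor G V U -> W \subset V -> phi #|U : V| ->
  inner_radical G W \subset inner_on G U V.
Proof. exact: (sub_inner_radicalP W (inner_radical_sub G W)).2. Qed.

Lemma inner_radical_normal G W : inner_radical G W <| G.
Proof.
rewrite /normal inner_radical_sub normsI ?normG //.
apply: norms_bigcap; apply/bigcapsP=> [[V U]] /= /and3P[chUV _ _].
have [nsVG nsUG _ _] := chief_factorP _ _ _ chUV.
exact: normal_norm (inner_on_normal nsVG nsUG).
Qed.

Lemma sub_inner_radical G W : W \subset G -> W \subset inner_radical G W.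
Proof.
move=> sWG; apply/sub_inner_radicalP=> // V U chUV sWV _.
have [_ _ /proper_sub sVU _] := chief_factorP _ _ _ chUV.
exact: subset_trans sWV (subset_trans sVU (sub_inner_on G U V)).
Qed.

Lemma inner_radicalS G W W' :
  W \subset W' -> inner_radical G W \subset inner_radical G W'.
Proof.
move=> sWW'; apply/sub_inner_radicalP=> [|V U chUV sWV phiUV].
  exact: inner_radical_sub.
by apply: inner_radical_inner => //; apply: subset_trans sWV.
Qed.

Lemma inner_radicalI G W1 W2 : W1 <| G -> W2 <| G ->
  inner_radical G W1 :&: inner_radical G W2
    \subset inner_radical G (W1 :&: W2)%G.
Proof.
move=> nsW1 nsW2; apply/sub_inner_radicalP=> [|V U chUV sWV phiUV].
  by rewrite subIset // inner_radical_sub.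
have [V' [U' [ch' sW' sI' eqi']]] := chief_factor_above chUV nsW1 nsW2 sWV.
rewrite -eqi' in phiUV; apply: subset_trans sI'.
case: sW' => sW'; have sR := inner_radical_inner ch' sW' phiUV.
  exact: subset_trans (subsetIl _ _) sR.
exact: subset_trans (subsetIr _ _) sR.
Qed.

(** If E covers U / V, then [U, G] lies in V * [E, G], hence in V, and all of G is inner on the
    factor. Otherwise the factor moves above E. *)
Lemma inner_radical_central G E W : E <| G -> [~: E, G] \subset W ->
  inner_radical G E \subset inner_radical G W.
Proof.
move=> nsEG cEG; apply/sub_inner_radicalP=> [|V U chUV sWV phiUV].
  exact: inner_radical_sub.
have [nsVG nsUG _ _] := chief_factorP _ _ _ chUV.
have [sUVE | nsUVE] := boolP (U \subset V * E); last first.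
  have [ch1 sI1 eqi1] := chief_factor_join chUV nsEG nsUVE.
  rewrite (subset_trans _ sI1) // inner_radical_inner ?eqi1 //.
  exact: joing_subr.
apply: subset_trans (inner_radical_sub _ _) _.
apply: sub_cent_inner_on => //; rewrite commGC.
apply: subset_trans (commSg _ sUVE) _; rewrite commMG.
  by rewrite mul_subG ?(subset_trans cEG) // commg_subl normal_norm.
apply: normsR; last exact: subset_trans (normal_sub nsEG) (normG G).
exact: subset_trans (normal_sub nsEG) (normal_norm nsVG).
Qed.

Lemma phi_length_leS n G W W' : W \subset W' ->
  phi_length_le n G W -> phi_length_le n G W'.
Proof.
elim: n W W' => [|n IHn] W W' sWW' /=.
  by move=> noW V U chUV sWV; apply: noW => //; apply: subset_trans sWV.
by apply: IHn; apply: inner_radicalS.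
Qed.

Lemma phi_length_leW n m G W : W \subset G -> n <= m ->
  phi_length_le n G W -> phi_length_le m G W.
Proof.
move=> sWG; elim: m => [|m IHm]; first by rewrite leqn0 => /eqP->.
rewrite leq_eqVlt ltnS => /predU1P[-> // | le_nm] leG.
exact: phi_length_leS (sub_inner_radical sWG) (IHm le_nm leG).
Qed.

Lemma phi_length_leI n G W1 W2 : W1 <| G -> W2 <| G ->
  phi_length_le n G W1 -> phi_length_le n G W2 ->
  phi_length_le n G (W1 :&: W2)%G.
Proof.
elim: n W1 W2 => [|n IHn] W1 W2 nsW1 nsW2 /= leW1 leW2.
  move=> V U chUV sWV.
  have [V' [U' [ch' sW' _ <-]]] := chief_factor_above chUV nsW1 nsW2 sWV.
  by case: sW' => sW'; [apply: leW1 | apply: leW2].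
apply: phi_length_leS (inner_radicalI nsW1 nsW2) _.
by apply: IHn => //; apply: inner_radical_normal.
Qed.

Lemma phi_length_le_self n G : phi_length_le n G G.
Proof.
apply: (@phi_length_leW 0) => // V U chUV sGV.
have [_ nsUG prVU _] := chief_factorP _ _ _ chUV.
case/negP: (proper_subn prVU); exact: subset_trans (normal_sub nsUG) sGV.
Qed.

(** This is how a bound on the length is reduced to a single chief factor: the finite intersection
    defining the radical is handled by [phi_length_leI]. *)
Lemma phi_length_le_inner n G W :
    (forall V U, chief_factor G V U -> W \subset V -> phi #|U : V| ->
       phi_length_le n G (inner_on G U V)) ->
  phi_length_le n.+1 G W.
Proof.
move=> leI /=.
(* The big intersection ranges over sets, so [Q] carries the group along; intersecting with G turns
   the neutral element [setT] into G. *)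
pose Q (A : {set gT}) := exists X : {group gT},
  [/\ X :=: G :&: A, X <| G & phi_length_le n G X].
suffices [X [defX _ leX]] :
    Q (\bigcap_(P : {group gT} * {group gT}
            | [&& chief_factor G P.1 P.2, W \subset P.1
                & phi #|P.2 : P.1|]) inner_on G P.2 P.1).
  by apply: phi_length_leS leX; rewrite defX.
apply: big_ind => [|A1 A2 [X1 [def1 ns1 le1]] [X2 [def2 ns2 le2]]|[V U]] /=.
- by exists G; rewrite setIT normal_refl; split=> //; apply: phi_length_le_self.
- exists (X1 :&: X2)%G; rewrite normalI //; split=> //=.
    by rewrite def1 def2 setIACA setIid.
  exact: phi_length_leI.
case/and3P=> chUV sWV phiUV; have [nsVG nsUG _ _] := chief_factorP _ _ _ chUV.
have nsI := inner_on_normal nsVG nsUG.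
by exists (inner_on G U V); rewrite (setIidPr (normal_sub nsI)); split; auto.
Qed.

End Radical.

(** * Radicals and chief factors under quotients *)

Section Transfer.

Variable gT : finGroupType.
Implicit Types A B G H K M N U V W X Y E : {group gT}.

Lemma chief_factor_quotient G U V W : W <| G -> W \subset V ->
  chief_factor G V U -> chief_factor (G / W) (V / W) (U / W).
Proof.
move=> nsWG sWV /chief_factorP[nsVG nsUG prVU minU].
have sVU := proper_sub prVU.
apply/chief_factorP; split; rewrite ?quotient_normal //=.
  rewrite properE quotientS //= quotientSGK ?proper_subn //.
  exact: subset_trans (normal_sub nsUG) (normal_norm nsWG).
move=> X nsXG sVX sXU; have [Y defX sWY nsYG] := inv_quotientN nsWG nsXG.
have nWY := subset_trans (normal_sub nsYG) (normal_norm nsWG).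
have nWV := subset_trans (normal_sub nsVG) (normal_norm nsWG).
have sWU := subset_trans sWV sVU.
rewrite defX quotientSGK // in sVX; rewrite defX quotientSGK // in sXU.
by rewrite defX; case: (minU Y nsYG sVX sXU) => ->; [left | right].
Qed.

Lemma chief_factor_cosetpre A V (Xb Yb : {group coset_of V}) :
    A \subset 'N(V) -> chief_factor (A / V) Yb Xb ->
  exists Y X, [/\ chief_factor A Y X, X / V = Xb, Y / V = Yb, A :&: V \subset Y
                & #|X : Y| = #|Xb : Yb|].
Proof.
move=> nVA /chief_factorP[nsYb nsXb prYX minX].
have [X defX] : exists X : {group gT}, X :=: A :&: coset V @*^-1 Xb.
  by exists (A :&: coset V @*^-1 Xb)%G.
have [Y defY] : exists Y : {group gT}, Y :=: A :&: coset V @*^-1 Yb.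
  by exists (A :&: coset V @*^-1 Yb)%G.
exists Y, X.
have quoI (Z : {group coset_of V}) : Z \subset A / V ->
    (A :&: coset V @*^-1 Z) / V = Z.
  by move=> sZA; rewrite quotientIG ?sub_cosetpre // cosetpreK (setIidPr sZA).
have qX : X / V = Xb by rewrite defX quoI ?normal_sub.
have qY : Y / V = Yb by rewrite defY quoI ?normal_sub.
have sVY : A :&: V \subset Y by rewrite defY setIS ?sub_cosetpre.
have nsI (Z : {group coset_of V}) : Z <| A / V -> A :&: coset V @*^-1 Z <| A.
  move=> nsZ; apply: normalGI (_ : A \subset coset V @*^-1 (A / V)) _.
    by rewrite -sub_quotient_pre.
  by rewrite cosetpre_normal.
have sYX : Y \subset X by rewrite defX defY setIS // morphpreS ?proper_sub.
have sXA : X \subset A by rewrite defX subsetIl.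
have nVX := subset_trans sXA nVA.
split=> //; last first.
  rewrite -(index_quotient_eq _ sYX nVX) ?qX ?qY //.
  by rewrite (subset_trans _ sVY) ?setSI.
apply/chief_factorP; split; rewrite ?defX ?defY ?nsI // -?defX -?defY.
  rewrite properE sYX; apply: contra (proper_subn prYX).
  by rewrite -qX -qY => /quotientS->.
move=> Z nsZA sYZ sZX.
have sAVZ := subset_trans sVY sYZ.
have defZ (T : {group gT}) : T \subset A -> A :&: V \subset T ->
    T :=: A :&: coset V @*^-1 (T / V).
  move=> sTA sVT; rewrite quotientK ?(subset_trans sTA) // -group_modr //.
  by rewrite mulSGid.
have [|||/= eqZ|/= eqZ] := minX (Z / V)%G; first exact: quotient_normal.
- by rewrite -qY quotientS.
- by rewrite -qX quotientS.
- have {}eqZ : (Z / V)%g = Yb := eqZ.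
  by left; rewrite (defZ Z) ?(normal_sub nsZA) // eqZ -defY.
have {}eqZ : (Z / V)%g = Xb := eqZ.
by right; rewrite (defZ Z) ?(normal_sub nsZA) // eqZ -defX.
Qed.

Lemma quotient_inner_radical (phi : pred nat) A V W :
    A \subset 'N(V) -> W \subset A :&: V ->
  inner_radical phi A W / V \subset inner_radical phi (A / V) 1.
Proof.
move=> nVA sWV; apply/sub_inner_radicalP=> [|Y X chYX _ phiYX].
  by rewrite quotientS ?inner_radical_sub.
have [Y1 [X1 [ch1 qX qY sVY eqi]]] := chief_factor_cosetpre nVA chYX.
have [nsY1 nsX1 _ _] := chief_factorP _ _ _ ch1.
have [nsY nsX _ _] := chief_factorP _ _ _ chYX.
rewrite -eqi in phiYX.
apply: subset_trans (quotientS V (inner_radical_inner ch1 _ phiYX)) _.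
  exact: subset_trans sWV sVY.
have sC : 'C_A(X1 / Y1 | 'Q) \subset A := subsetIl _ _.
rewrite quotientY ?(subset_trans _ nVA) ?(normal_sub nsX1) //.
rewrite join_subG qX sub_inner_on /=.
apply: sub_cent_inner_on; rewrite ?quotientS //.
rewrite -{1}qX -quotientR ?(subset_trans _ nVA) ?(normal_sub nsX1) //.
by rewrite -qY quotientS // -(sub_factor_cent nsY1 nsX1).
Qed.

(** Links the radical relative to W with the recursion through quotients in [genFitting_series]. *)
Lemma inner_radical_cosetpre (phi : pred nat) G W : W <| G ->
  inner_radical phi G W = coset W @*^-1 inner_radical phi (G / W) 1
    :> {set gT}.
Proof.
move=> nsWG; have nWG := normal_norm nsWG.
have sRG := inner_radical_sub phi G W.
have nWR := subset_trans sRG nWG.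
have sWW : W \subset G :&: W by rewrite subsetI normal_sub /=.
have sqR := quotient_inner_radical phi nWG sWW.
apply/eqP; rewrite eqEsubset -sub_quotient_pre // sqR andTb.
set R := inner_radical phi (G / W) 1.
have sR : coset W @*^-1 R \subset G.
  by rewrite -(quotientGK nsWG) morphpreS ?inner_radical_sub.
apply/sub_inner_radicalP=> // V U chUV sWV phiUV.
have [nsVG nsUG /proper_sub sVU _] := chief_factorP _ _ _ chUV.
have nWU := subset_trans (normal_sub nsUG) nWG.
have chb : chief_factor (G / W) (V / W) (U / W) by apply: chief_factor_quotient.
have phib : phi #|U / W : V / W|.
  by rewrite index_quotient_eq // (subset_trans (subsetIr _ _)).
have := inner_radical_inner chb (sub1G _) phib; rewrite -/R => sRI.
have sWI : W \subset inner_on G U V.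
  exact: subset_trans (subset_trans sWV sVU) (sub_inner_on G U V).
rewrite -(quotientGK (normalS sWI (normal_sub (inner_on_normal nsVG nsUG)) nsWG)).
apply: morphpreS; apply: subset_trans sRI _.
rewrite join_subG quotientS ?sub_inner_on //=.
set C := 'C_(_)(_ | _).
have [nsVb nsUb _ _] := chief_factorP _ _ _ chb.
have nsC : C <| G / W := factor_cent_normal nsVb nsUb.
have [D defC _ nsDG] := inv_quotientN nsWG nsC.
have {}defC : C = (D / W)%g := defC.
rewrite defC; apply: quotientS; apply: sub_cent_inner_on (normal_sub nsDG) _ => //.
have nWD := subset_trans (normal_sub nsDG) nWG.
rewrite -(quotientSGK _ sWV) ?comm_subG //.
rewrite quotientR // -defC.
by rewrite -(sub_factor_cent nsVb nsUb) ?subsetIl.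
Qed.

End Transfer.

(** * Completely reducible groups *)

Section CompletelyReducible.

Variable gT : finGroupType.
Implicit Types A B G H K M N S T U V W X Y E : {group gT}.

(* "Completely reducible and centerless", the property of direct products of
   nonabelian simple groups that passes to normal subgroups and quotients. *)
Definition cr_centerless N := forall T, T <| N -> T \x 'C_N(T) = N.

(** Normality is transitive here because N is the product of T and ['C_N(T)], and the latter
    centralises K. *)
Lemma cr_centerless_trans N T K :
  cr_centerless N -> T <| N -> K <| T -> K <| N.
Proof.
move=> crN nsTN nsKT; have [_ defN cTC _] := dprodP (crN T nsTN).
apply/andP; split; first exact: subset_trans (normal_sub nsKT) (normal_sub nsTN).
rewrite -defN; apply: mul_subG (normal_norm nsKT) _.
by rewrite cents_norm // centsC (subset_trans (normal_sub nsKT)) // centsC.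
Qed.

Lemma cr_centerless_normal N T :
  cr_centerless N -> T <| N -> cr_centerless T.
Proof.
move=> crN nsTN K nsKT; have nsKN := cr_centerless_trans crN nsTN nsKT.
have [_ defN cKC tiKC] := dprodP (crN K nsKN).
have sTN := normal_sub nsTN.
have sCC : 'C_T(K) \subset 'C_N(K) by rewrite setSI.
rewrite dprodE; last first.
- by apply/trivgP; rewrite -tiKC setIS.
- exact: subset_trans sCC cKC.
have := group_modl 'C_N(K) (normal_sub nsKT).
by rewrite defN (setIidPr sTN) setIAC (setIidPr sTN).
Qed.

Lemma cr_centerless_abelian N T :
  cr_centerless N -> T <| N -> abelian T -> T :=: 1.
Proof.
move=> crN nsTN abT; have [_ _ _ tiTC] := dprodP (crN T nsTN).
by apply/trivgP; rewrite -tiTC subsetI subxx subsetI normal_sub.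
Qed.

(** The point is that K / T has trivial centre. The preimage Z of the centre is the direct product
    of T and ['C_Z(T)]; the derived subgroup of ['C_Z(T)] lies in T and in its centraliser, so
    ['C_Z(T)] is abelian and normal in N, hence trivial. The conclusion unfolds [cr_centerless],
    which inside this section is tied to [gT]. *)
Lemma cr_centerless_quotient N T :
  cr_centerless N -> T <| N -> forall Kb : {group coset_of T},
  Kb <| N / T -> Kb \x 'C_(N / T)(Kb) = N / T.
Proof.
move=> crN nsTN Kb nsKb; have [K defK sTK nsKN] := inv_quotientN nsTN nsKb.
have [_ defN cKC _] := dprodP (crN K nsKN).
have nTK := subset_trans (normal_sub nsKN) (normal_norm nsTN).
rewrite defK dprodE ?subsetIr //=.
  apply/eqP; rewrite eqEsubset; apply/andP; split.
    by rewrite mul_subG ?subsetIl // quotientS // (normal_sub nsKN).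
  rewrite -{1}defN quotientMl // mulgS // subsetI quotientS ?subsetIl //=.
  by rewrite quotient_cents // centsC.
set Zb := _ :&: _; have nsZb : Zb <| N / T.
  have nsKTN : K / T <| N / T by apply: quotient_normal.
  by rewrite normalI // /normal subsetIl normsI ?normG ?norms_cent ?normal_norm.
have [Z defZ sTZ nsZN] := inv_quotientN nsTN nsZb.
have {}defZ : Zb = Z / T := defZ.
have nTZ := subset_trans (normal_sub nsZN) (normal_norm nsTN).
have sZK : Z \subset K.
  by rewrite -(quotientSGK nTZ sTK) -defZ subsetIl.
have sZK1 : [~: Z, K] \subset T.
  rewrite -quotient_cents2 // -defZ.
  by rewrite (subset_trans (subsetIr _ _)) // subIset // orbC subxx.
have nsTZ : T <| Z by apply: normalS nsTN => //; apply: normal_sub.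
have nsEZ: 'C_Z(T) <| Z.
  by rewrite /normal subsetIl normsI ?normG ?norms_cent.
have nsEN : 'C_Z(T) <| N := cr_centerless_trans crN nsZN nsEZ.
have [_ defZ1 _ tiT] := dprodP (cr_centerless_normal crN nsZN nsTZ).
have E1 : 'C_Z(T) = 1.
  apply: (cr_centerless_abelian crN nsEN); apply/commG1P/trivgP.
  rewrite -tiT subsetI; apply/andP; split.
    apply: subset_trans sZK1; apply: commgSS; first exact: subsetIl.
    exact: subset_trans (subsetIl _ _) sZK.
  by rewrite (subset_trans (der_sub 1 _)).
by rewrite defZ -defZ1 E1 mulg1 trivg_quotient.
Qed.

(** A normal subgroup contains or centralises each simple factor. An abelian one contains none of
    them, so it is central in N and therefore trivial. *)
Lemma nonabelian_simple_product_cr N :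
  nonabelian_simple_product N -> cr_centerless N.
Proof.
case/existsP=> S /and3P[_ /forall_inP simS /eqP defN] T nsTN.
have defN1 := bigdprodWY defN.
have sHN H : H \in S -> H \subset N.
  by move=> SH; rewrite -defN1 sub_gen // (bigcup_max H).
have nsHN H : H \in S -> H <| N.
  by move=> SH; move: defN; rewrite (bigD1 H) //= => /dprod_normal2[].
have tiHC (K : {group gT}) H : K <| N -> H \in S -> H \subset K \/ H \subset 'C(K).
  move=> nsKN SH; have [/simpleP[_ maxH] _] := andP (simS H SH).
  have [|tiHK|sHK] := maxH (H :&: K)%G.
  - exact: normalGI (sHN H SH) nsKN.
  - right; apply/commG1P/trivgP; rewrite -tiHK subsetI.
    have nHK := subset_trans (normal_sub nsKN) (normal_norm (nsHN H SH)).
    have nKH := subset_trans (sHN H SH) (normal_norm nsKN).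
    by rewrite commg_subl commg_subr nHK.
  by left; apply/setIidPl.
have Z1 K : K <| N -> abelian K -> K :=: 1.
  move=> nsKN abK.
  have ZN1 : 'Z(N) = 1.
    rewrite -(center_bigdprod defN) big1 // => H SH.
    have [/simpleP[_ maxH] nabH] := andP (simS H SH).
    have [|//|ZH] := maxH 'Z(H)%G; first exact: center_normal.
    by case/negP: nabH; rewrite /abelian -{1}ZH subsetIr.
  apply/trivgP; rewrite -ZN1 subsetI normal_sub //= -defN1 cent_gen centsC.
  apply/bigcupsP=> H SH.
  have [sHK|//] := tiHC K H nsKN SH.
  have [_] := andP (simS H SH); case/negP; exact: abelianS sHK abK.
have nsCN : 'C_N(T) <| N.
  by rewrite /normal subsetIl normsI ?normG ?norms_cent ?normal_norm.
have tiTC : T :&: 'C_N(T) = 1.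
  apply: (Z1 (T :&: 'C_N(T))%G); first exact: normalI.
  apply/centsP=> x /setIP[Tx _] y /setIP[_ /setIP[_ /centP cTy]].
  by apply/commute_sym/cTy.
rewrite dprodE ?subsetIr //; apply/eqP.
rewrite eqEsubset mul_subG ?subsetIl ?(normal_sub nsTN) //=.
rewrite -norm_joinEr; last first.
  by rewrite cents_norm // subsetIr.
rewrite -{1}defN1 gen_subG; apply/bigcupsP=> H SH.
have [sHT | cHT] := tiHC T H nsTN SH.
  by rewrite (subset_trans sHT) ?joing_subl.
by rewrite (subset_trans _ (joing_subr _ _)) // subsetI sHN.
Qed.

Lemma minnormal_cr G N : minnormal N G -> ~~ solvable N -> cr_centerless N.
Proof.
by move=> minN /(minnormal_nonsol_product minN)/nonabelian_simple_product_cr.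
Qed.

Lemma cr_centerless_simple N S :
  cr_centerless N -> minnormal S N -> S \subset N -> simple S.
Proof.
move=> crN /mingroupP[/andP[ntS nSN] minS] sSN.
have nsSN : S <| N by apply/andP.
apply/simpleP; split=> // K nsKS.
have nsKN := cr_centerless_trans crN nsSN nsKS.
have [K1|ntK] := eqVneq (K : {set gT}) 1; [by left | right].
by apply: minS; rewrite ?ntK ?normal_norm ?normal_sub.
Qed.

(** E is Baer's norm of T, the intersection of the normalisers of all subgroups of T. Its cyclic
    subgroups are normal in E, hence trivial, so E = 1. A commutator [k, t] lies in E because k
    normalises both X and [X :^ t^-1]. *)
Lemma cr_centerless_norm_cent K T : cr_centerless T ->
  (forall X, X \subset T -> K \subset 'N(X)) -> K \subset 'C(T).
Proof.
move=> crT nTK; pose E := (T :&: \bigcap_(X : {group gT} | X \subset T) 'N(X))%G.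
have nXE X : X \subset T -> E \subset 'N(X).
  by move=> sXT; rewrite subIset // orbC (bigcap_inf X).
have sET : E \subset T := subsetIl _ _.
have nXJ X x : X \subset T -> x \in T -> X :^ x \subset T.
  by move=> sXT Tx; rewrite -(conjGid Tx) conjSg.
have nsET : E <| T.
  rewrite /normal sET; apply/subsetP=> t Tt; rewrite inE.
  apply/subsetP=> _ /imsetP[e /setIP[Te /bigcapP nXe] ->].
  rewrite inE groupJ //; apply/bigcapP=> X sXT.
  have sXtT : X :^ t^-1 \subset T by rewrite nXJ ?groupV.
  by rewrite -[X : {set gT}](conjsgKV t) /= normJ memJ_conjg (nXe (X :^ t^-1)%G).
have E1 : E :=: 1.
  apply/trivgP/subsetP=> x Ex.
  have nsx : <[x]> <| E.
    by rewrite /normal cycle_subG Ex nXE // cycle_subG (subsetP sET).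
  have := cr_centerless_abelian crT (cr_centerless_trans crT nsET nsx) (cycle_abelian x).
  by move/trivgP; rewrite cycle_subG.
apply/commG1P/trivgP; rewrite -E1 gen_subG.
apply/subsetP=> _ /imset2P[k t Kk Tt ->]; rewrite inE.
have nTk : k \in 'N(T) by apply: (subsetP (nTK T (subxx T))).
rewrite {1}commgEr groupM ?memJ_norm ?groupV //=.
apply/bigcapP=> X sXT.
have sXtT : X :^ t^-1 \subset T by rewrite nXJ ?groupV.
have nXk : k \in 'N(X) := subsetP (nTK X sXT) k Kk.
rewrite commgEl groupM ?groupV //.
rewrite /= -(conjsgKV t X) normJ memJ_conjg.
exact: subsetP (nTK (X :^ t^-1)%G sXtT) k Kk.
Qed.

End CompletelyReducible.

(** * Mutually permutable products *)

Section AbelianProducts.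

Variable gT : finGroupType.
Implicit Types A B G H K S X Y : {group gT}.

(** Ito's theorem. Conjugating [a, b] by a1 * b1 or by b1 * a1 gives the same commutator
    [[~ a3, b2]], so the generators of [A, B] commute with each other; and [A, B] contains G'. *)
Lemma abelian_product_der1 G A B :
  G :=: A * B -> abelian A -> abelian B -> abelian G^`(1).
Proof.
move=> defG abA abB.
have commAB : commute A B by apply/comm_group_setP; rewrite -defG groupP.
have defGJ : A <*> B = G by rewrite comm_joingE.
have defBA : G :=: B * A by rewrite defG.
have nsR : [~: A, B] <| G by rewrite -defGJ commg_normal.
have nRA : A \subset 'N([~: A, B]) by rewrite commg_norml.
have nRB : B \subset 'N([~: A, B]) by rewrite commg_normr.
have sG'R : G^`(1) \subset [~: A, B].
  apply: der1_min; first exact: normal_norm nsR.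
  rewrite -defGJ quotientY // abelianY !quotient_abelian //=.
  by rewrite quotient_cents2r // commGC.
apply: abelianS sG'R _; rewrite /abelian cent_gen gen_subG.
have memAB x : x \in G -> exists2 a, a \in A & exists2 b, b \in B & x = a * b.
  by rewrite defG => /mulsgP[a b Aa Bb ->]; exists a => //; exists b.
have memBA x : x \in G -> exists2 b, b \in B & exists2 a, a \in A & x = b * a.
  by rewrite defBA => /mulsgP[b a Bb Aa ->]; exists b => //; exists a.
have sAG : A \subset G by rewrite defG mulG_subl.
have sBG : B \subset G by rewrite defG mulG_subr.
have cA x y : x \in A -> y \in A -> [~ x, y] = 1.
  by move=> Ax Ay; apply/eqP/commgP; apply: (centsP abA).
have cB x y : x \in B -> y \in B -> [~ x, y] = 1.
  by move=> Bx By; apply/eqP/commgP; apply: (centsP abB).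
have key a b a1 b1 : a \in A -> b \in B -> a1 \in A -> b1 \in B ->
    [~ a, b] ^ (a1 * b1) = [~ a, b] ^ (b1 * a1).
  move=> Aa Bb Aa1 Bb1.
  have [|a2 Aa2 [b2 Bb2 def_b]] := memAB (b ^ a1).
    by apply: groupJ; [apply: (subsetP sBG) | apply: (subsetP sAG)].
  have [|b3 Bb3 [a3 Aa3 def_a]] := memBA (a ^ b1).
    by apply: groupJ; [apply: (subsetP sAG) | apply: (subsetP sBG)].
  have a_a1 : a ^ a1 = a by apply/conjg_fixP; rewrite cA.
  have b_b1 : b ^ b1 = b by apply/conjg_fixP; rewrite cB.
  have b2_b1 : b2 ^ b1 = b2 by apply/conjg_fixP; rewrite cB.
  have a3_a1 : a3 ^ a1 = a3 by apply/conjg_fixP; rewrite cA.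
  transitivity [~ a3, b2].
    rewrite conjgM conjRg a_a1 def_b commgMJ (cA a a2) // conj1g mulg1.
    by rewrite conjRg def_a b2_b1 commMgJ (cB b3 b2) // conj1g mul1g.
  rewrite conjgM conjRg b_b1 def_a commMgJ (cB b3 b) // conj1g mul1g.
  by rewrite conjRg def_b a3_a1 commgMJ (cA a3 a2) // conj1g mulg1.
apply/subsetP=> _ /imset2P[a b Aa Bb ->]; apply/centP=> _ /imset2P[a1 b1 Aa1 Bb1 ->].
have defR : [~ a1, b1] = (a1^-1 * b1^-1) * (a1 * b1).
  by rewrite commgEl /conjg !mulgA.
apply/commgP/conjg_fixP; rewrite defR conjgM key ?groupV // -conjgM.
by rewrite mulgA mulgKV mulVg conjg1.
Qed.

Lemma abelian_product_solvable G A B :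
  G :=: A * B -> abelian A -> abelian B -> solvable G.
Proof.
move=> defG abA abB; rewrite (series_sol (der_normal 1 G)).
rewrite abelian_sol ?(abelian_product_der1 defG) //=.
by rewrite abelian_sol ?der_abelian.
Qed.

End AbelianProducts.

Section MutuallyPermutable.

Variable gT : finGroupType.
Implicit Types A B G H K N R S X Y V : {group gT}.

Lemma mutually_permutable_sym G A B :
  mutually_permutable_product G A B -> mutually_permutable_product G B A.
Proof. by case=> defG pAB pBA; split=> //; rewrite defG pAB. Qed.

Lemma mutually_permutable_subl G A B :
  mutually_permutable_product G A B -> A \subset G.
Proof. by case=> -> _ _; rewrite mulG_subl. Qed.

Lemma mutually_permutable_subr G A B :
  mutually_permutable_product G A B -> B \subset G.
Proof. by case=> -> _ _; rewrite mulG_subr. Qed.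

(** By Dedekind's law the subgroups XB and AY intersect in X (A :&: B) Y, and [A :&: B] is absorbed
    by the factor that contains it. So X * Y is a subgroup. *)
Lemma mutually_permutable_commute G A B X Y :
    mutually_permutable_product G A B -> X \subset A -> Y \subset B ->
    A :&: B \subset X \/ A :&: B \subset Y ->
  commute X Y.
Proof.
case=> defG pAB pBA sXA sYB sD.
have commAY : commute A Y := pAB Y sYB.
have commXB : commute X B by apply: commute_sym; apply: pBA.
apply/comm_group_setP.
have -> : X * Y = (X <*> B) :&: (A <*> Y).
  have sXAY : X \subset A <*> Y by rewrite (subset_trans sXA) ?joing_subl.
  rewrite (comm_joingE commXB) -group_modl //= (comm_joingE commAY).
  rewrite -group_modr // mulgA.
  by case: sD => sD; rewrite setIC ?(mulGSid sD) // -mulgA (mulSGid sD).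
exact: groupP.
Qed.

Lemma mutually_permutable_quotient G A B V :
  mutually_permutable_product G A B -> V <| G ->
  mutually_permutable_product (G / V) (A / V) (B / V).
Proof.
move=> mpG nsVG; have nVG := normal_norm nsVG.
have nVA := subset_trans (mutually_permutable_subl mpG) nVG.
have nVB := subset_trans (mutually_permutable_subr mpG) nVG.
case: mpG => defG pAB pBA.
have pre (C : {group gT}) (Xb : {group coset_of V}) :
    Xb \subset C / V -> exists2 X : {group gT}, X \subset C & Xb :=: X / V.
  move=> sXC; exists (C :&: coset V @*^-1 Xb)%G; first exact: subsetIl.
  by rewrite /= quotientIG ?sub_cosetpre // cosetpreK; apply/esym/setIidPr.
split=> [|Xb /pre[X sXB ->]|Xb /pre[X sXA ->]] /=.
- by rewrite defG quotientMl.
- by rewrite -!quotientMl ?pAB // (subset_trans sXB).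
by rewrite -!quotientMl ?pBA // (subset_trans sXA).
Qed.

(** P is the product of the two intersections. It equals [(A :&: N) B :&: N], which B normalises,
    and symmetrically A normalises it. P may be smaller than N; for N minimal normal it is N or
    1. *)
Lemma mutually_permutable_normalI G A B N :
    mutually_permutable_product G A B -> N <| G ->
  exists P : {group gT}, P <| G /\
    mutually_permutable_product P (A :&: N) (B :&: N).
Proof.
move=> mpG nsNG; have [defG _ _] := mpG.
have sAG := mutually_permutable_subl mpG.
have sBG := mutually_permutable_subr mpG.
have sNN (C : {group gT}) : C \subset G -> C \subset 'N(N).
  by move=> sCG; apply: subset_trans sCG (normal_norm nsNG).
have commE A1 B1 X : mutually_permutable_product G A1 B1 ->
    X \subset A1 :&: N -> X * (B1 :&: N) = (X <*> B1) :&: N.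
  case=> _ _ pB1; rewrite subsetI => /andP[sXA sXN].
  by rewrite comm_joingE ?group_modl //; apply: commute_sym; apply: pB1.
have commEs A1 B1 X : mutually_permutable_product G A1 B1 ->
    X \subset A1 :&: N -> commute X (B1 :&: N)%G.
  move=> mp1 sX; apply/comm_group_setP; rewrite /= (commE _ _ _ mp1 sX).
  exact: groupP.
have mpG' := mutually_permutable_sym mpG.
have commAB : commute (A :&: N)%G (B :&: N)%G by apply: commEs mpG _.
pose P := ((A :&: N) <*> (B :&: N))%G.
have defP : P = (A :&: N) * (B :&: N) :> {set gT} by rewrite -comm_joingE.
have nPB : B \subset 'N(P).
  have -> : P = (((A :&: N)%G <*> B) :&: N)%G :> {set gT}.
    by rewrite defP (commE A B) ?subxx.
  by rewrite normsI ?sNN // (subset_trans _ (normG _)) ?joing_subr.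
have nPA : A \subset 'N(P).
  have -> : P = (((B :&: N)%G <*> A) :&: N)%G :> {set gT}.
    by rewrite defP commAB (commE B A) ?subxx.
  by rewrite normsI ?sNN // (subset_trans _ (normG _)) ?joing_subr.
exists P; split.
  apply/andP; split; last by rewrite defG mul_subG.
  by rewrite join_subG !subIset ?sAG ?sBG.
split=> // X sX; last exact: esym (commEs A B X mpG sX).
exact: esym (commEs B A X mpG' sX).
Qed.

(** [(A :&: N) * Y] is the intersection of the subgroups AY and N, both normalised by A. This turns
    permutability into an action of A on subgroups of [B :&: N] modulo [A :&: N]. *)
Lemma mutually_permutable_norm G A B N Y :
    mutually_permutable_product G A B -> N <| G -> Y \subset B :&: N ->
  commute (A :&: N)%G Y /\ A \subset 'N((A :&: N) <*> Y).
Proof.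
move=> mpG nsNG; rewrite subsetI => /andP[sYB sYN].
have [_ pAB _] := mpG; have commAY : commute A Y := pAB Y sYB.
have defANY : (A :&: N) * Y = (A <*> Y) :&: N.
  by rewrite setIC group_modr // comm_joingE // setIC.
have cANY : commute (A :&: N)%G Y.
  by apply/comm_group_setP; rewrite /= defANY groupP.
split=> //; rewrite (comm_joingE cANY) /= defANY.
apply: normsI; first exact: subset_trans (joing_subl A Y) (normG _).
exact: subset_trans (mutually_permutable_subl mpG) (normal_norm nsNG).
Qed.

Lemma prime_power_into H x : x \notin H ->
  exists b r, [/\ b \in <[x]>, prime r, b \notin H & b ^+ r \in H].
Proof.
move=> notHx.
have ex_m : exists m, (0 < m) && (x ^+ m \in H).
  by exists #[x]; rewrite order_gt0 expg_order group1.
have [m /andP[m_gt0 Hxm] min_m] := ex_minnP ex_m.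
have m_gt1 : 1 < m.
  by case: m m_gt0 Hxm {min_m} => [|[|m]] //; rewrite expg1 (negPf notHx).
have pr_m : prime (pdiv m) by apply: pdiv_prime.
exists (x ^+ (m %/ pdiv m)), (pdiv m); split=> //.
- by rewrite mem_cycle.
- apply: contraL (ltn_Pdiv (prime_gt1 pr_m) m_gt0) => Hx.
  by rewrite -leqNgt min_m // Hx divn_gt0 ?prime_gt0 // pdiv_leq.
by rewrite -expgM divnK // pdiv_dvd.
Qed.

Lemma index_cycle_prime H b r : prime r -> b \notin H -> b ^+ r \in H ->
  #|<[b]> : H :&: <[b]>| = r.
Proof.
move=> pr_r notHb Hbr; apply/prime_nt_dvdP => //.
  rewrite indexg_eq1 subsetI cycle_subG negb_and.
  by rewrite notHb.
have sbr : <[b ^+ r]> \subset H :&: <[b]>.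
  by rewrite cycle_subG inE Hbr mem_cycle.
apply: (@dvdn_trans #|<[b]> : <[b ^+ r]>|).
  by rewrite -(Lagrange_index (subsetIr _ _) sbr) dvdn_mulr.
rewrite -divgS ?cycle_subG ?mem_cycle // -!orderE orderXgcd.
rewrite divnA ?dvdn_gcdl // mulKn ?order_gt0 //.
exact: dvdn_gcdr.
Qed.

(* Choose n = ab in N with b of prime order r modulo A.  Then N meets A<b> in a
   subgroup R of order r normalised by A, and a counting argument shows that R
   is also the intersection of N with B((A :&: B)<a>), which B normalises. *)
Lemma mutually_permutable_avoid G A B N :
    mutually_permutable_product G A B -> N <| G -> N :!=: 1 ->
    A :&: N = 1 -> B :&: N = 1 ->
  exists R, [/\ R <| G, R \subset N & prime #|R|].
Proof.
move=> mpG nsNG ntN tiAN tiBN; have [defG pAB pBA] := mpG.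
have sAG := mutually_permutable_subl mpG.
have sBG := mutually_permutable_subr mpG.
have nNA := subset_trans sAG (normal_norm nsNG).
have nNB := subset_trans sBG (normal_norm nsNG).
have [n0 Nn0 ntn0] := trivgPn N ntN.
have [a0 [b0 [Aa0 Bb0 def_n0]]] :
    exists a0, exists b0, [/\ a0 \in A, b0 \in B & n0 = a0 * b0].
  have := subsetP (normal_sub nsNG) _ Nn0.
  by rewrite defG => /mulsgP[a0 b0 Aa0 Bb0 ->]; exists a0, b0.
have notAb0 : b0 \notin A.
  apply: contra ntn0 => Ab0; rewrite -in_set1 -[[set 1]]tiAN inE Nn0.
  by rewrite def_n0 groupM.
have [b [r [b0b pr_r notAb Abr]]] := prime_power_into notAb0.
have Bb : b \in B by apply: subsetP b0b; rewrite cycle_subG.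
have sbB : <[b]> \subset B by rewrite cycle_subG.
have ib : #|<[b]> : A :&: <[b]>| = r by apply: index_cycle_prime.
have commAb : commute A <[b]>%G := pAB <[b]>%G sbB.
have AN_b : b \in A <*> N.
  apply: subsetP b0b; rewrite cycle_subG -(groupMl _ (_ : a0 \in _)) -?def_n0.
    by rewrite (subsetP (joing_subr A N)).
  by rewrite (subsetP (joing_subl A N)).
pose R := (N :&: (A <*> <[b]>))%G.
have defAb : A * R = A * <[b]>.
  rewrite group_modl ?joing_subl // -norm_joinEl //=.
  rewrite -[RHS](comm_joingE commAb); apply/setIidPr; rewrite join_subG joing_subl cycle_subG.
  exact: AN_b.
have tiAR : A :&: R = 1 by apply/trivgP; rewrite -tiAN setIS ?subsetIl.
have cardR : #|R| = r.
  have cardAR : (#|A| * #|R|)%N = #|A * <[b]>| by rewrite -defAb TI_cardMg.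
  have := mul_cardG A <[b]>%G; rewrite -cardAR /= -mulnA => /eqP.
  rewrite eqn_pmul2l // -(Lagrange (subsetIr A <[b]>)) ib mulnC.
  by rewrite eqn_pmul2r // => /eqP.
have nRA : A \subset 'N(R).
  by rewrite normsI // (subset_trans _ (normG _)) ?joing_subl.
have [a Aa [n Rn def_n]] : exists2 a, a \in A & exists2 n, n \in R & n = a * b.
  have: b \in A * R by rewrite defAb (subsetP (mulG_subr _ _)) ?cycle_id.
  case/mulsgP=> a1 n Aa1 Rn def_b; exists a1^-1; first by rewrite groupV.
  by exists n; rewrite // def_b mulKg.
have sDA : A :&: B \subset A := subsetIl _ _.
have sDB : A :&: B \subset B := subsetIr _ _.
have saA : <[a]> \subset A by rewrite cycle_subG.
have commDb : commute (A :&: B)%G <[b]>%G.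
  by apply: mutually_permutable_commute mpG _ _ _ => //; left.
have commDa : commute (A :&: B)%G <[a]>%G.
  by apply: commute_sym; apply: mutually_permutable_commute mpG _ _ _ => //; right.
(* Adjoining [A :&: B] makes the two subgroups permute with each other. *)
pose Y := ((A :&: B) <*> <[b]>)%G; pose X := ((A :&: B) <*> <[a]>)%G.
have sYB : Y \subset B by rewrite join_subG sDB.
have sXA : X \subset A by rewrite join_subG sDA.
have commXY : commute X Y.
  by apply: mutually_permutable_commute mpG _ _ _ => //; left; apply: joing_subl.
have defDb : (A :&: B) :&: <[b]> = A :&: <[b]>.
  by rewrite -setIA (setIidPr sbB).
have cardY : #|Y| = (#|A :&: B| * r)%N.
  have := mul_cardG (A :&: B)%G <[b]>%G; rewrite -comm_joingE //= defDb.
  rewrite -(Lagrange (subsetIr A <[b]>)) ib mulnA mulnAC => /eqP.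
  by rewrite eqn_pmul2r // => /eqP.
have nRY : Y \subset 'N(R).
  rewrite normsI //; first exact: subset_trans sYB nNB.
  by rewrite (subset_trans _ (normG _)) // genS // setSU // sDA.
have tiYR : Y :&: R = 1.
  by apply/trivgP; rewrite -tiBN setISS ?subsetIl.
have sXYR : X \subset Y * R.
  have sDY : A :&: B \subset Y := joing_subl _ _.
  rewrite -norm_joinEl // join_subG (subset_trans sDY (joing_subl Y R)) /=.
  rewrite cycle_subG -(groupMr _ (_ : b \in _)) -?def_n.
    by rewrite (subsetP (joing_subr Y R)).
  by rewrite (subsetP (joing_subl Y R)) // (subsetP (joing_subr _ _)) ?cycle_id.
have tiXR : X :&: R = 1 by apply/trivgP; rewrite -tiAR setSI.
(* XR lies in YR, and R meets both X and Y trivially. *)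
have leXY : #|X| <= #|Y|.
  rewrite -(leq_pmul2r (cardG_gt0 R)) -!TI_cardMg // subset_leq_card //.
  by rewrite -{2}[R : {set gT}]mulGid mulgA mulSg.
pose S := (N :&: (B <*> X))%G.
have commBX : commute B X := pBA X sXA.
have tiBS : B :&: S = 1 by apply/trivgP; rewrite -tiBN setIS ?subsetIl.
(* Combine |B| |S| <= |BX| = |B| |X| / |B :&: X| with |X| <= |Y| = |A :&: B| r and |A :&: B| <= |B
   :&: X|. *)
have leSr : #|S| <= r.
  have leBS : (#|B| * #|S|)%N <= #|B * X|.
    rewrite -TI_cardMg // subset_leq_card // -(comm_joingE commBX).
    by rewrite mul_subG ?joing_subl ?subsetIr.
  have sDBX : A :&: B \subset B :&: X by rewrite subsetI sDB joing_subl.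
  rewrite -(leq_pmul2l (cardG_gt0 (A :&: B)%G)) -cardY.
  apply: leq_trans leXY; rewrite -(leq_pmul2l (cardG_gt0 B)).
  rewrite [X in _ <= X]mul_cardG mulnCA mulnC.
  exact: leq_mul leBS (subset_leq_card sDBX).
have Nn : n \in N by apply: subsetP Rn; apply: subsetIl.
have Sn : n \in S.
  rewrite inE Nn def_n groupM //.
    by rewrite (subsetP (joing_subr _ _)) // (subsetP (joing_subr _ _)) ?cycle_id.
  by rewrite (subsetP (joing_subl _ _)).
have ntn : n != 1.
  by apply: contra notAb => /eqP n1; rewrite -(groupMl _ Aa) -def_n n1.
have defR : R :=: <[n]>.
  apply/eqP; rewrite eq_sym eqEcard cycle_subG Rn cardR -orderE /=.
  suffices -> : #[n] = r by [].
  by apply/prime_nt_dvdP; rewrite ?order_eq1 // -cardR order_dvdG.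
have sRS : R \subset S by rewrite defR cycle_subG.
have eqRS : R :=: S by apply/eqP; rewrite eqEcard sRS cardR.
exists R; rewrite cardR; split=> //; last exact: subsetIl.
rewrite /normal (subset_trans (subsetIl _ _) (normal_sub nsNG)) /= defG mul_subG //.
rewrite eqRS normsI //.
exact: subset_trans (joing_subl B X) (normG _).
Qed.

End MutuallyPermutable.

(** * Permutable subgroups of simple groups *)

Section Kegel.

Variable gT : finGroupType.
Implicit Types A B G H K N R S X Y V : {group gT}.

Lemma commute_joing X Y K : commute X K -> commute Y K -> commute (X <*> Y) K.
Proof.
move=> cXK cYK; apply: commute_sym; rewrite -genM_join.
have [n ->] := gen_expgs (X * Y); apply: commuteX.
rewrite (setUidPr _); last by rewrite sub1set -[1]mulg1 mem_mulg.
by apply: commuteM; apply: commute_sym.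
Qed.

(** Factorising x itself gives x = k * h; conjugating the factorisation of G by [h^-1] then turns
    [K :^ x] into K. *)
Lemma mulg_conj_eq G H K x : x \in G -> H * (K :^ x) = G -> H * K = G.
Proof.
move=> Gx defG; have sHG : H \subset G by rewrite -defG mulG_subl.
have := Gx; rewrite -{1}defG => /mulsgP[h _ Hh /imsetP[k Kk ->] def_x].
have {}def_x : x = k * h.
  move: def_x; rewrite conjgE !mulgA -{1}[x]mul1g => /mulIg def1.
  apply: invg_inj; rewrite invMg; apply: (mulgI h); apply: (mulIg k).
  by rewrite mulKVg mulVg -def1.
have HhG : h^-1 \in G by rewrite groupV (subsetP sHG).
rewrite -(conjGid HhG) -defG conjsMg def_x -!conjsgM mulgK.
by rewrite (conjGid Kk) conjGid ?groupV.
Qed.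

(* Kegel: if neither factor is trivial, H can be replaced by the larger subgroup
   generated by H and a conjugate of H under an element of a conjugate of K. *)
Lemma kegel_simple S H K :
    simple S -> H \subset S -> K \subset S ->
    (forall x, x \in S -> commute (H :^ x) K) -> H * K != S ->
  H :=: 1 \/ K :=: 1.
Proof.
move=> simS; have [n] := ubnP (#|S| - #|H|); elim: n H => // n IHn H.
rewrite ltnS => leSH sHS sKS cHK neHKS.
have [K1 | ntK] := eqVneq (K : {set gT}) 1; [by right | left].
have [//| ntH] := eqVneq (H : {set gT}) 1.
have [_ maxS] := simpleP _ simS.
have cHKxy x y : x \in S -> y \in S -> commute (H :^ x) (K :^ y).
  move=> Sx Sy; have := cHK _ (groupM Sx (groupVr Sy)).
  move/(congr1 (fun C : {set gT} => C :^ y)).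
  by rewrite /= /commute !conjsMg -!conjsgM mulgKV.
(* Otherwise the normal closure of K, which is S, would normalise H. *)
have [y Sy /subsetPn[k Kyk notNk]] : exists2 y, y \in S & ~~ (K :^ y \subset 'N(H)).
  apply/exists_inP; rewrite -negb_forall_in; apply/negP => /forall_inP nHK.
  have sKclos : <<class_support K S>> \subset 'N(H).
    rewrite gen_subG class_supportEr; apply/bigcupsP=> x Sx; exact: nHK.
  have nsclos : <<class_support K S>> <| S.
    rewrite /normal gen_subG class_support_subG //=.
    by rewrite norms_gen // class_support_norm.
  have [clos1|closS] := maxS <<class_support K S>>%G nsclos.
    case/negP: ntK; rewrite -subG1 -clos1 /=.
    exact: subset_trans (sub_class_support S K) (subset_gen _).
  have nsH : H <| S by rewrite /normal sHS -{1}closS.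
  have [H1|HS] := maxS H nsH; first by rewrite H1 eqxx in ntH.
  by case/negP: neHKS; rewrite HS; apply/eqP/mulGSid.
have Sk : k \in S.
  by apply: subsetP Kyk; rewrite -(conjGid Sy) conjSg.
pose H1 := (H <*> H :^ k)%G.
have sH1S : H1 \subset S by rewrite join_subG sHS -(conjGid Sk) conjSg.
have ltHH1 : #|H| < #|H1|.
  apply: proper_card; rewrite properE joing_subl /=; apply: contra notNk => sH1H.
  by rewrite inE (subset_trans (joing_subr _ _) sH1H).
have [|||H11|K1] := IHn H1 _ sH1S sKS.
- apply: leq_trans leSH; apply: ltn_sub2l => //.
  exact: leq_trans ltHH1 (subset_leq_card sH1S).
- move=> x Sx; rewrite /= conjYg.
  rewrite -conjsgM; have := @commute_joing (H :^ x)%G (H :^ (k * x))%G K.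
  by apply; apply: cHK; rewrite ?groupM.
(* Since k lies in [K :^ y], the subgroup [H * K :^ y] contains [H :^ k] and hence [H1]. So S = H1 K
   would give [S = H * K :^ y], and then S = H K. *)
- apply: contra neHKS => /eqP H1K.
  have H1Ky : H1 * K :^ y = S.
    apply: (@mulg_conj_eq S H1 (K :^ y)%G y^-1); first by rewrite groupV.
    by rewrite /= conjsgK.
  apply/eqP; apply: (mulg_conj_eq Sy); apply/eqP.
  have sKyS : K :^ y \subset S by rewrite -(conjGid Sy) conjSg.
  rewrite eqEsubset mul_subG //=.
  have cHKy : commute H (K :^ y)%G by have := cHKxy 1 y (group1 S) Sy; rewrite conjsg1.
  rewrite -{1}H1Ky -(comm_joingE cHKy) mul_subG ?joing_subr // join_subG joing_subl /=.
  have Jk : k \in H <*> K :^ y by rewrite (subsetP (joing_subr _ _)).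
  by rewrite -(conjGid Jk) conjSg joing_subl.
- by apply/trivgP; rewrite -H11 joing_subl.
by rewrite K1 eqxx in ntK.
Qed.

End Kegel.

Section SimpleProducts.

Variable gT : finGroupType.
Implicit Types A B G H K N R S X Y V : {group gT}.

(* Write g = ab: X^a lies in A, hence permutes with B = B^b. *)
Lemma conj_subgroup_commute S A B X g :
    mutually_permutable_product S A B -> X \subset A -> g \in S ->
  commute (X :^ g) B.
Proof.
move=> mpS sXA; have [defS _ pBA] := mpS.
rewrite defS => /mulsgP[a b Aa Bb ->].
have sXaA : X :^ a \subset A by rewrite -(conjGid Aa) conjSg.
have := congr1 (fun C : {set gT} => C :^ b) (pBA (X :^ a)%G sXaA).
by rewrite /= !conjsMg (conjGid Bb) -conjsgM => cBX; apply: commute_sym.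
Qed.

(** By [kegel_simple] every nontrivial subgroup X of A satisfies XB = S. This excludes [X = A :&: B]
    unless it is trivial, and then Dedekind's law gives X = A; so A has no proper nontrivial
    subgroup. *)
Lemma simple_product_abelian S A B :
    simple S -> mutually_permutable_product S A B ->
    A :!=: S -> B :!=: S -> abelian A.
Proof.
move=> simS mpS neAS neBS; have [defS _ _] := mpS.
have sAS := mutually_permutable_subl mpS.
have sBS := mutually_permutable_subr mpS.
have key X : X \subset A -> X * B = S \/ X :=: 1.
  move=> sXA; have [XB | neXB] := eqVneq (X * B) S; [by left | right].
  have [|||| //|B1] := @kegel_simple _ S X B simS.
  - exact: subset_trans sXA sAS.
  - by [].
  - by move=> x Sx; apply: conj_subgroup_commute mpS sXA Sx.
  - by [].
  by case/eqP: neAS; rewrite defS B1 mulg1.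
have D1 : A :&: B = 1.
  have [defBS | //] := key (A :&: B)%G (subsetIl _ _).
  by case/eqP: neBS; rewrite -defBS; apply/esym/mulSGid/subsetIr.
have maxA X : X \subset A -> X :=: 1 \/ X :=: A.
  move=> sXA; have [XB|] := key X sXA; [right | by left].
  by rewrite -[RHS](setIidPr sAS) -XB -group_modl // setIC D1 mulg1.
have [A1 | ntA] := eqVneq (A : {set gT}) 1; first by rewrite A1 abelian1.
have [x Ax ntx] := trivgPn A ntA.
have [|x1 | <-] := maxA <[x]>%G; last exact: cycle_abelian.
  by rewrite cycle_subG.
by move/eqP: x1; rewrite /= cycle_eq1 (negPf ntx).
Qed.

(** If both factors are proper they are abelian and S is soluble by Ito's theorem. If one is S, the
    other permutes with all its own conjugates, and [kegel_simple] is applied to it paired with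
    itself. *)
Lemma simple_product_cases S A B :
    simple S -> ~~ abelian S -> mutually_permutable_product S A B ->
  [/\ A :=: 1 \/ A :=: S, B :=: 1 \/ B :=: S & A :=: S \/ B :=: S].
Proof.
move=> simS nabS mpS.
have full1 A1 B1 : mutually_permutable_product S A1 B1 ->
    B1 :=: S -> A1 :=: 1 \/ A1 :=: S.
  move=> mp1 B1S; have [A1S | neA1S] := eqVneq (A1 : {set gT}) S; [by right|left].
  have sA1S := mutually_permutable_subl mp1.
  have [_ pA1 _] := mp1.
  have [||||//|//] := @kegel_simple _ S A1 A1 simS => //.
    move=> x Sx; apply: commute_sym; apply: (pA1 (A1 :^ x)%G).
    by rewrite B1S -(conjGid Sx) conjSg.
  by rewrite mulGid.
have mpS' := mutually_permutable_sym mpS.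
have [AS | neAS] := eqVneq (A : {set gT}) S.
  by split; [right | apply: full1 mpS' AS | left].
have [BS | neBS] := eqVneq (B : {set gT}) S.
  by split; [apply: full1 mpS BS | right | right].
case/negP: nabS; apply: cyclic_abelian; apply: prime_cyclic.
apply: simple_sol_prime => //; have [defS _ _] := mpS.
apply: (abelian_product_solvable defS).
  exact: simple_product_abelian simS mpS neAS neBS.
exact: simple_product_abelian simS mpS' neBS neAS.
Qed.

End SimpleProducts.

(** Induction modulo a simple normal subgroup S. If A and B both avoided S there would be a normal
    subgroup of prime order, so by [simple_product_cases] one of them contains S, and the other
    contains or avoids it. *)
Lemma cr_product_normal (gT : finGroupType) (N A B : {group gT}) :
    cr_centerless N -> mutually_permutable_product N A B ->
  A <| N /\ B <| N.
Proof.
have [n] := ubnP #|N|; elim: n => // n IHn in gT N A B *; rewrite ltnS => leNn.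
move=> crN mpN; have [N1 | ntN] := eqVneq (N : {set gT}) 1.
  have [sAN sBN] := (mutually_permutable_subl mpN, mutually_permutable_subr mpN).
  move: sAN sBN; rewrite N1 => /trivgP-> /trivgP->.
  by split; apply: normal_refl.
have [S minS sSN] := minnormal_exists ntN (normG N).
have [/andP[ntS nSN] minS'] := mingroupP minS.
have nsSN : S <| N by apply/andP.
have simS := cr_centerless_simple crN minS sSN.
have nabS : ~~ abelian S.
  by apply: contra ntS => abS; rewrite (cr_centerless_abelian crN nsSN abS).
have half A1 B1 : mutually_permutable_product N A1 B1 -> S \subset A1 ->
    B1 :&: S = 1 \/ S \subset B1 -> A1 <| N /\ B1 <| N.
  move=> mp1 sSA1 sSB1.
  have sA1N := mutually_permutable_subl mp1.
  have sB1N := mutually_permutable_subr mp1.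
  have crq : cr_centerless (N / S)%G := cr_centerless_quotient crN nsSN.
  have [|nsA1 nsB1] := IHn _ _ _ _ _ crq (mutually_permutable_quotient mp1 nsSN).
    by apply: leq_trans leNn; apply: ltn_quotient.
  split.
    by rewrite -(quotientGK (normalS sSA1 sA1N nsSN)) -(quotientGK nsSN) cosetpre_normal.
  have nSB1 := subset_trans sB1N nSN.
  have nsSB1 : S <*> B1 <| N.
    by rewrite -(quotientYK nSB1) -(quotientGK nsSN) cosetpre_normal.
  case: sSB1 => [tiSB | sSB1]; last by rewrite -(joing_idPr sSB1).
  (* Any X in S lies in [A1], so [B1] normalises [(B1 :&: S) * X = X]. Then [B1] is recovered as the
     intersection of the normal subgroups [S <*> B1] and ['C_N(S)]. *)
  have cSB1 : B1 \subset 'C(S).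
    apply: cr_centerless_norm_cent (cr_centerless_normal crN nsSN) _ => X sXS.
    have [|_] := mutually_permutable_norm (mutually_permutable_sym mp1) nsSN (Y := X).
      by rewrite subsetI sXS (subset_trans sXS).
    by rewrite /= tiSB joing1G.
  have [_ _ _ tiSC] := dprodP (crN S nsSN).
  suffices <- : (S <*> B1) :&: 'C_N(S) = B1.
    apply: normalI => //.
    by rewrite /normal subsetIl normsI ?normG ?norms_cent ?(normal_norm nsSN).
  rewrite norm_joinEr // setIC -group_modr ?subsetI ?sB1N //.
  by rewrite setIC tiSC mul1g.
have [P [nsPN mpP]] := mutually_permutable_normalI mpN nsSN.
have [defP _ _] := mpP.
have sPS : P \subset S by rewrite defP mul_subG ?subsetIr.
have [P1 | ntP] := eqVneq (P : {set gT}) 1.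
  have tiAS : A :&: S = 1 by apply/trivgP; rewrite -P1 defP mulG_subl.
  have tiBS : B :&: S = 1 by apply/trivgP; rewrite -P1 defP mulG_subr.
  have [R [nsRN _ prR]] := mutually_permutable_avoid mpN nsSN ntS tiAS tiBS.
  have R1 := cr_centerless_abelian crN nsRN (cyclic_abelian (prime_cyclic prR)).
  by rewrite R1 cards1 in prR.
have {sPS ntP} eqPS : P = S.
  by apply/val_inj/minS'; rewrite ?ntP ?(normal_norm nsPN).
rewrite eqPS in mpP.
have [cA cB cAB] := simple_product_cases simS nabS mpP.
have mpN' := mutually_permutable_sym mpN.
case: cAB => [AS | BS].
  apply: half mpN _ _; first by rewrite -AS subsetIl.
  by case: cB => [B1 | BS]; [left | right; rewrite -BS subsetIl].
suffices [] : B <| N /\ A <| N by [].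
apply: half mpN' _ _; first by rewrite -BS subsetIl.
by case: cA => [A1 | AS]; [left | right; rewrite -AS subsetIl].
Qed.

(** * Minimal normal subgroups of mutually permutable products *)

Section MinimalNormal.

Variable gT : finGroupType.
Implicit Types A B G H K N R S X Y V : {group gT}.

Lemma minnormal_product G A B N :
    mutually_permutable_product G A B -> minnormal N G -> N \subset G ->
    A :&: N <> 1 \/ B :&: N <> 1 ->
  mutually_permutable_product N (A :&: N) (B :&: N).
Proof.
move=> mpG /mingroupP[/andP[ntN nNG] minN] sNG ntAB.
have nsNG : N <| G by apply/andP.
have [P [nsPG mpP]] := mutually_permutable_normalI mpG nsNG.
have [defP _ _] := mpP.
suffices eqPN : P = N by rewrite eqPN in mpP.
apply/val_inj/minN; last by rewrite defP mul_subG ?subsetIr.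
rewrite (normal_norm nsPG) andbT; apply/eqP=> P1.
by case: ntAB; case; apply/trivgP; rewrite -P1 defP ?mulG_subl ?mulG_subr.
Qed.

Lemma minnormal_avoid_prime G A B N :
    mutually_permutable_product G A B -> minnormal N G -> N \subset G ->
    A :&: N = 1 -> B :&: N = 1 -> prime #|N|.
Proof.
move=> mpG /mingroupP[/andP[ntN nNG] minN] sNG tiA tiB.
have nsNG : N <| G by apply/andP.
have [R [nsRG sRN prR]] := mutually_permutable_avoid mpG nsNG ntN tiA tiB.
suffices <- : R :=: N by [].
apply: minN; rewrite ?(normal_norm nsRG) ?andbT //.
by rewrite -cardG_gt1 prime_gt1.
Qed.

(** Once the complement C of [A :&: N] in N is known to lie in [B :&: N], each subgroup X of C
    equals [(A :&: N) * X] intersected with C, which A normalises; so A centralises C by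
    [cr_centerless_norm_cent]. *)
Lemma minnormal_nonabelian_product G A B N :
    mutually_permutable_product G A B -> minnormal N G -> N \subset G ->
    ~~ solvable N ->
  [/\ A :&: N <| N, B :&: N <| N, N :=: (A :&: N) * (B :&: N)
    & A \subset 'C('C_N(A :&: N))].
Proof.
move=> mpG minN sNG nsolN; have crN := minnormal_cr minN nsolN.
have [/andP[_ nNG] _] := mingroupP minN.
have nsNG : N <| G by apply/andP.
have mpN : mutually_permutable_product N (A :&: N) (B :&: N).
  apply: (minnormal_product mpG minN sNG).
  have [tiA | /eqP] := eqVneq (A :&: N) 1; last by left.
  have [tiB | /eqP] := eqVneq (B :&: N) 1; last by right.
  have prN := minnormal_avoid_prime mpG minN sNG tiA tiB.
  by case/negP: nsolN; rewrite abelian_sol // cyclic_abelian // prime_cyclic.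
have [nsAN nsBN] := cr_product_normal crN mpN.
have [defN _ _] := mpN; split=> //.
pose N1 := (A :&: N)%G; pose N2 := (B :&: N)%G; pose C := ('C_N(N1))%G.
have nsCN : C <| N.
  by rewrite /normal subsetIl normsI ?normG ?norms_cent ?(normal_norm nsAN).
have crC := cr_centerless_normal crN nsCN.
(* The complement E of [C :&: N2] in C centralises both [N1] and [N2], hence N, so it is abelian and
   normal in N, and therefore trivial. *)
have sCN2 : C \subset N2.
  have nsCN2 : C :&: N2 <| C := normalGI (normal_sub nsCN) nsBN.
  have [_ defC _ tiCE] := dprodP (crC (C :&: N2)%G nsCN2).
  pose E := ('C_C(C :&: N2))%G.
  have nsEC : E <| C.
    by rewrite /normal subsetIl normsI ?normG ?norms_cent ?(normal_norm nsCN2).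
  have nsEN : E <| N := cr_centerless_trans crN nsCN nsEC.
  have tiEN2 : E :&: N2 = 1.
    apply/trivgP; rewrite -tiCE subsetI subsetIl andbT subsetI subsetIr andbT.
    by rewrite subIset // subsetIl.
  have cEN2 : E \subset 'C(N2).
    apply/commG1P/trivgP; rewrite -tiEN2 commg_subI // subsetI subxx.
      exact: subset_trans (normal_sub nsEN) (normal_norm nsBN).
    exact: subset_trans (normal_sub nsBN) (normal_norm nsEN).
  have cEN1 : E \subset 'C(N1).
    by rewrite (subset_trans (subsetIl _ _)) ?subsetIr.
  have E1 : E :=: 1.
    apply: (cr_centerless_abelian crN nsEN); rewrite /abelian.
    rewrite (subset_trans (normal_sub nsEN)) // centsC defN centM subsetI.
    by rewrite cEN1.
  by rewrite -defC -[ 'C_C(_)]/(gval E) E1 mulg1 subsetIr.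
apply: cr_centerless_norm_cent crC _ => X sXC.
have sXN2 : X \subset B :&: N := subset_trans sXC sCN2.
have [cN1X nN1X] := mutually_permutable_norm mpG nsNG sXN2.
have [_ _ _ tiN1C] := dprodP (crN N1 nsAN).
suffices <- : ((A :&: N) <*> X) :&: C = X.
  apply: normsI => //; have sAG := mutually_permutable_subl mpG.
  have nNA := subset_trans sAG nNG.
  by rewrite normsI // norms_cent // normsI // normG.
rewrite (comm_joingE cN1X) setIC -group_modr //.
by rewrite setIC tiN1C mul1g.
Qed.

End MinimalNormal.

(** Automorphisms of a cyclic group are power maps, so they commute. *)
Lemma cyclic_norm_der1 (gT : finGroupType) (K X : {group gT}) :
  cyclic X -> K \subset 'N(X) -> K^`(1) \subset 'C(X).
Proof.
case/cyclicP=> x defX nXK; have Xx : x \in X by rewrite defX cycle_id.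
have powK k : k \in K -> exists i, x ^ k = x ^+ i.
  move=> Kk; apply/cycleP; rewrite -defX memJ_norm //.
  exact: subsetP nXK k Kk.
rewrite defX cent_cycle gen_subG; apply/subsetP=> _ /imset2P[k l Kk Kl ->].
have comm_x i j : i \in K -> j \in K -> x ^ (i * j) = x ^ (j * i).
  move=> /powK[m xi] /powK[q xj].
  by rewrite !conjgM xi xj !conjXg xi xj -!expgM mulnC.
have defR : [~ k, l] = (k^-1 * l^-1) * (k * l) by rewrite commgEl /conjg !mulgA.
apply/cent1P/commute_sym/commgP/conjg_fixP.
rewrite defR conjgM comm_x ?groupV // -conjgM.
by rewrite mulgA mulgKV mulVg conjg1.
Qed.

(** * Subnormality of the derived subgroup of a factor *)

Section DerivedSubnormal.

Variable gT : finGroupType.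
Implicit Types A B G H K N R S X Y V : {group gT}.

Lemma cosetpre_subnormal G N (Kb : {group coset_of N}) :
  N <| G -> Kb <|<| G / N -> coset N @*^-1 Kb <|<| G.
Proof.
move=> nsNG /subnormalP[s path_s last_s]; apply/subnormalP.
exists (map (fun L : {group coset_of N} => (coset N @*^-1 L)%G) s).
  elim: s Kb path_s {last_s} => //= L s IHs Kb /andP[nsKL /IHs->].
  by rewrite andbT cosetpre_normal.
rewrite (last_map (fun L : {group coset_of N} => (coset N @*^-1 L)%G) s Kb).
by apply: val_inj; rewrite /= last_s quotientGK.
Qed.

(** Modulo [A :&: N] every element of N comes from some y in [B :&: N], and A normalises the image
    of <[y]>; A' centralises this cyclic image. *)
Lemma commg_der1_meet G A B N :
    mutually_permutable_product G A B -> N <| G -> abelian N ->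
    N :=: (A :&: N) * (B :&: N) ->
  [~: A^`(1), N] \subset A :&: N.
Proof.
move=> mpG nsNG abN defN; have sAG := mutually_permutable_subl mpG.
have nNA := subset_trans sAG (normal_norm nsNG).
pose N1 := (A :&: N)%G.
have nN1A : A \subset 'N(N1) by rewrite normsI ?normG.
have nN1N : N \subset 'N(N1).
  by rewrite cents_norm // (subset_trans abN) // centS ?subsetIr.
have sA'A : A^`(1) \subset A := der_sub 1 A.
rewrite gen_subG; apply/subsetP=> _ /imset2P[x n A'x Nn ->].
have nN1x : x \in 'N(N1) := subsetP nN1A x (subsetP sA'A x A'x).
have: n \in (A :&: N) * (B :&: N) by rewrite -defN.
case/mulsgP=> n1 y N1n1 By_y ->; have [_ Ny] := setIP By_y.
have nN1y := subsetP nN1N y Ny.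
rewrite commgMJ groupM //; last first.
  rewrite memJ_norm // commgEr groupM ?groupV //.
  by rewrite memJ_norm ?groupV.
have [_ nXA] : commute N1 <[y]>%G /\ A \subset 'N(N1 <*> <[y]>).
  by apply: mutually_permutable_norm mpG nsNG _; rewrite cycle_subG.
have nN1Y : <[y]> \subset 'N(N1) by rewrite cycle_subG.
have nXb : A / N1 \subset 'N(<[y]> / N1).
  by rewrite -(quotientYidl nN1Y) quotient_norms.
have := cyclic_norm_der1 (quotient_cyclic N1 (cycle_cyclic y)) nXb.
rewrite -quotient_der // quotient_cents2 //; last exact: subset_trans sA'A _.
by move/subsetP; apply; rewrite mem_commg ?cycle_id.
Qed.

(** If N is abelian and is the product of its intersections with A and B, the chain is A',
    [A' (A :&: N)], A' N; its second step is normal because [A', N] lies in [A :&: N]. In the other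
    cases N normalises A'. *)
Lemma der1_subnormal_lift G A B N :
    mutually_permutable_product G A B -> minnormal N G -> N \subset G ->
  A^`(1) <|<| N <*> A^`(1).
Proof.
move=> mpG minN sNG; have [/andP[_ nNG] _] := mingroupP minN.
have nsNG : N <| G by apply/andP.
have sAG := mutually_permutable_subl mpG.
have sA'A : A^`(1) \subset A := der_sub 1 A.
have nNA := subset_trans sAG nNG.
have normN : N \subset 'N(A^`(1)) -> A^`(1) <|<| N <*> A^`(1).
  move=> nA'N; apply: normal_subnormal.
  by rewrite /normal joing_subr join_subG nA'N normG.
have [solN | nsolN] := boolP (solvable N); last first.
  have [ns1 _ _ cAC] := minnormal_nonabelian_product mpG minN sNG nsolN.
  have [_ defN _ _] := dprodP (minnormal_cr minN nsolN ns1).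
  apply: normN; rewrite -defN mul_subG //.
    by apply: subset_trans (subsetIl _ _) (der_norm 1 A).
  by rewrite cents_norm // centsC (subset_trans sA'A).
have [_ _ /is_abelemP[p _ abelN]] := minnormal_solvable minN (subxx _) solN.
have abN := abelem_abelian abelN.
have normN_meet : mutually_permutable_product N (A :&: N) (B :&: N) ->
    A^`(1) <|<| N <*> A^`(1).
  case=> defN _ _; have sRN1 := commg_der1_meet mpG nsNG abN defN.
  pose M := (A^`(1) <*> (A :&: N))%G.
  have nsA'M : A^`(1) <| M.
    rewrite /normal joing_subl join_subG normG.
    exact: subset_trans (subsetIl _ _) (der_norm 1 A).
  apply: subnormal_trans (normal_subnormal nsA'M) (normal_subnormal _).
  rewrite /normal join_subG joing_subr (subset_trans (subsetIr A N)) ?joing_subl //=.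
  rewrite join_subG (subset_trans (joing_subl _ _) (normG M)) andbT.
  apply/subsetP=> n Nn; rewrite inE /= conjYg join_subG.
  have nN1n : n \in 'N(A :&: N).
    by rewrite (subsetP _ n Nn) // cents_norm // (subset_trans abN) ?centS ?subsetIr.
  rewrite (normP nN1n) joing_subr andbT.
  apply/subsetP=> _ /imsetP[x A'x ->]; rewrite -(mulKVg x (x ^ n)) -commgEl.
  rewrite groupM ?(subsetP (joing_subl _ _) x) //.
  by rewrite (subsetP (joing_subr _ _)) // (subsetP sRN1) ?mem_commg.
have [tiA | ntA] := eqVneq (A :&: N) 1.
  have [tiB | ntB] := eqVneq (B :&: N) 1.
    have prN := minnormal_avoid_prime mpG minN sNG tiA tiB.
    have cNA := cyclic_norm_der1 (prime_cyclic prN) nNA.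
    by apply: normN; rewrite cents_norm // centsC.
  have /eqP ntB' := ntB.
  have mpN := minnormal_product mpG minN sNG (or_intror ntB').
  exact: normN_meet mpN.
have /eqP ntA' := ntA.
exact: normN_meet (minnormal_product mpG minN sNG (or_introl ntA')).
Qed.

End DerivedSubnormal.

Lemma der1_subnormal (gT : finGroupType) (G A B : {group gT}) :
  mutually_permutable_product G A B -> A^`(1) <|<| G.
Proof.
have [n] := ubnP #|G|; elim: n => // n IHn in gT G A B *; rewrite ltnS => leGn mpG.
have sAG := mutually_permutable_subl mpG.
have sA'A : A^`(1) \subset A := der_sub 1 A.
have [G1 | ntG] := eqVneq (G : {set gT}) 1.
  have -> : A^`(1) = G.
    by apply/eqP; rewrite eqEsubset (subset_trans sA'A sAG) G1 sub1G.
  exact: subnormal_refl.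
have [N minN sNG] := minnormal_exists ntG (normG G).
have [/andP[ntN nNG] _] := mingroupP minN.
have nsNG : N <| G by apply/andP.
have nNA' := subset_trans sA'A (subset_trans sAG nNG).
have := IHn _ _ _ _ _ (mutually_permutable_quotient mpG nsNG).
rewrite /= -quotient_der ?(subset_trans sAG) // => snA'.
apply: subnormal_trans (der1_subnormal_lift mpG minN sNG) _.
rewrite /= -[N <*> _](quotientYK nNA').
apply: (@cosetpre_subnormal _ G N (A^`(1) / N)%G) => //.
by apply: snA'; apply: leq_trans leGn; apply: ltn_quotient.
Qed.

(** * Inner actions on minimal normal subgroups *)

Section InnerAction.

Variable gT : finGroupType.
Implicit Types A B G H K N M R S T U X Y V : {group gT}.

Lemma minnormal_chief_factor G M :
  minnormal M G -> M \subset G -> chief_factor G 1 M.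
Proof.
move=> /mingroupP[/andP[ntM nMG] minM] sMG; apply/chief_factorP; split.
- exact: normal1.
- exact/andP.
- by rewrite proper1G.
move=> X nsXG _ sXM; have [X1 | ntX] := eqVneq (X : {set gT}) 1; first by left.
by right; apply: minM; rewrite ?ntX ?(normal_norm nsXG).
Qed.

Lemma chief_factor1_cent G M : M <| G -> 'C_G(M / 1%G | 'Q) = 'C_G(M).
Proof.
move=> nsMG; apply/eqP; rewrite eqEsubset; apply/andP; split.
  rewrite subsetI subsetIl /=; apply/commG1P/trivgP.
  by rewrite -(sub_factor_cent (normal1 G) nsMG) ?subsetIl.
rewrite sub_factor_cent ?normal1 ?subsetIl //.
by apply/trivgP/commG1P; apply: subsetIr.
Qed.

Lemma quotient_sub_inner_on G U V X :
    V <| G -> U <| G -> X \subset G -> X / V \subset (U / V) * 'C(U / V) ->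
  X \subset inner_on G U V.
Proof.
move=> nsVG nsUG sXG sXUC; apply/subsetP=> x Xx.
have Gx := subsetP sXG x Xx; have nVG := normal_norm nsVG.
have nVx := subsetP nVG x Gx.
have: coset V x \in (U / V) * 'C(U / V) by rewrite (subsetP sXUC) ?mem_quotient.
case/mulsgP=> _ c /morphimP[u nVu Uu ->] Cc def_x.
have Gu := subsetP (normal_sub nsUG) u Uu.
have Iu := subsetP (sub_inner_on G U V) u Uu.
rewrite -(mulKVg u x) groupM //.
have sC : 'C_G(U / V | 'Q) \subset inner_on G U V := joing_subr _ _.
apply: (subsetP sC); rewrite inE groupM ?groupV //= astabQ.
rewrite mem_morphpre ?groupM ?groupV //= morphM ?groupV //= morphV //= def_x.
by rewrite mulKg.
Qed.

(** If e acts on T as t does and on M as m does, it acts on both as t * m, because T and M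
    centralise each other. *)
Lemma inner_join A R T M :
    R \subset A -> T <| A -> M <| A -> M \subset 'C(T) ->
    R \subset T * 'C_A(T) -> R \subset M * 'C_A(M) ->
  R \subset (T <*> M) * 'C_A(T <*> M).
Proof.
move=> sRA nsTA nsMA cMT sRT sRM.
apply/subsetP=> e Re; have Ae := subsetP sRA e Re.
have /mulsgP[t c Tt /setIP[Ac cTc] def_tc] := subsetP sRT e Re.
have /mulsgP[m d Mm /setIP[Ad cMd] def_md] := subsetP sRM e Re.
have cmt : m * t = t * m by apply: (centP (subsetP cMT m Mm)).
have Ttm : t * m \in T <*> M.
  have [Jt Jm] := (subsetP (joing_subl T M) t Tt, subsetP (joing_subr T M) m Mm).
  exact: groupM.
have At := subsetP (normal_sub nsTA) t Tt.
have Am := subsetP (normal_sub nsMA) m Mm.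
have Atme : (t * m)^-1 * e \in A by rewrite groupM // groupV groupM.
rewrite -(mulKVg (t * m) e) mem_mulg // inE Atme /= centY inE; apply/andP; split.
  rewrite invMg def_tc -mulgA mulKg groupM ?groupV //.
  exact: subsetP cMT m Mm.
rewrite -cmt invMg def_md -mulgA mulKg groupM ?groupV //.
have cTM : T \subset 'C(M) by rewrite centsC.
exact: subsetP cTM t Tt.
Qed.

(** N is filled up by minimal normal subgroups of A, each taken in the complement ['C_N(T)] of the
    part T already reached; [inner_join] glues the inner actions. *)
Lemma inner_radical_cr (phi : pred nat) A N :
    N <| A -> cr_centerless N ->
    (forall M, minnormal M A -> M \subset N -> phi #|M|) ->
  inner_radical phi A 1 \subset N * 'C_A(N).
Proof.
move=> nsNA crN phiM; set R := inner_radical phi A 1.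
have sRA : R \subset A := inner_radical_sub phi A 1.
suffices step n T : #|N| - #|T| < n -> T <| A -> T \subset N ->
    R \subset T * 'C_A(T) -> R \subset N * 'C_A(N).
  by apply: (step _ 1%G (leqnn _)); rewrite ?normal1 ?sub1G // cent1T setIT mul1g.
elim: n T => // n IHn T; rewrite ltnS => leTn nsTA sTN sRT.
have [eqTN | neTN] := eqVneq (T : {set gT}) N; first by rewrite -eqTN.
have nsTN : T <| N by apply: normalS nsTA => //; apply: normal_sub.
have [_ defN _ tiTC] := dprodP (crN T nsTN).
have ntC : 'C_N(T) != 1.
  by apply: contra neTN => /eqP C1; rewrite -defN C1 mulg1.
have nCA : A \subset 'N('C_N(T)).
  by rewrite normsI ?norms_cent ?(normal_norm nsNA) ?(normal_norm nsTA).
have [M minM sMC] := minnormal_exists ntC nCA.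
have [/andP[ntM nMA] _] := mingroupP minM.
have [sMN cMT] := subsetIP sMC.
have sMA := subset_trans sMN (normal_sub nsNA).
have nsMA : M <| A by apply/andP.
have chM := minnormal_chief_factor minM sMA.
have sRM : R \subset M * 'C_A(M).
  rewrite -(chief_factor1_cent nsMA) -(inner_onE (normal1 A) nsMA).
  by apply: inner_radical_inner => //; rewrite indexg1 phiM.
have tiTM : T :&: M = 1 by apply/trivgP; rewrite -tiTC setIS.
apply: (IHn (T <*> M)%G).
- apply: leq_trans leTn; apply: ltn_sub2l.
    by apply: proper_card; rewrite properEneq neTN.
  apply: proper_card; rewrite properE joing_subl /= join_subG subxx /=.
  by apply: contra ntM => sMT; rewrite -subG1 -tiTM subsetI sMT subxx.
- exact: normalY.
- by rewrite join_subG sTN.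
exact: inner_join sRA nsTA nsMA cMT sRT sRM.
Qed.

(** H stands for the intersection of N with a factor A, and K for a minimal normal subgroup of A
    inside it: the condition keeps such K in the class. All group types are allowed because it is
    applied in quotients. *)
Definition subnormal_hereditary (phi : pred nat) :=
  forall (rT : finGroupType) (G N H K : {group rT}), minnormal N G ->
    phi #|N| -> H <| N -> K <| H -> K :!=: 1 -> phi #|K|.

Lemma minnormal_nonabelian_inner (phi : pred nat) G A B N :
    subnormal_hereditary phi -> mutually_permutable_product G A B ->
    minnormal N G -> N \subset G -> ~~ solvable N -> phi #|N| ->
  inner_radical phi A 1 \subset N * 'C(N).
Proof.
move=> herphi mpG minN sNG nsolN phiN.
have crN := minnormal_cr minN nsolN.
have [ns1 _ _ cAC] := minnormal_nonabelian_product mpG minN sNG nsolN.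
have [/andP[_ nNG] _] := mingroupP minN.
have sAG := mutually_permutable_subl mpG.
pose N1 := (A :&: N)%G; have crN1 := cr_centerless_normal crN ns1.
have ns1A : N1 <| A by rewrite /normal subsetIl normsI ?normG ?(subset_trans sAG).
have sR := inner_radical_cr ns1A crN1.
have{sR} : inner_radical phi A 1 \subset N1 * 'C_A(N1).
  apply: sR => M minM sMN1; have [/andP[ntM nMA] _] := mingroupP minM.
  apply: herphi minN phiN ns1 _ ntM.
  by rewrite /normal sMN1 (subset_trans (normal_sub ns1A)).
move/subset_trans; apply; apply/subsetP=> _ /mulsgP[n c N1n /setIP[Ac cN1c] ->].
rewrite mem_mulg ?(subsetP (normal_sub ns1)) //.
have [_ <- _ _] := dprodP (crN N1 ns1).
by rewrite centM inE cN1c (subsetP cAC).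
Qed.

End InnerAction.

(** * Action on abelian minimal normal subgroups *)

Section AbelianFactors.

Variable gT : finGroupType.
Implicit Types A B G H K N M R S T U X Y V E : {group gT}.

(** With t = [x, f], fixed by f, one gets [x ^ (f ^+ k) = x * t ^+ k]. For k = #[f] this makes the
    order of the p-element t a p'-number. *)
Lemma coprime_stable_fix p T (f x : gT) :
    p.-group T -> p^'.-elt f -> [~ x, f] \in T -> f \in 'C(T) ->
  x ^ f = x.
Proof.
move=> pT p'f Txf cTf; have [t def_t] : exists t, t = [~ x, f] by exists [~ x, f].
rewrite -def_t in Txf.
have def_xf : x ^ f = x * t by rewrite def_t commgEl mulKVg.
have tf : t ^ f = t by apply/conjg_fixP/commgP/commute_sym/(centP cTf).
have def_xfk k : x ^ (f ^+ k) = x * t ^+ k.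
  elim: k => [|k IHk]; first by rewrite conjg1 mulg1.
  by rewrite expgSr conjgM IHk conjMg def_xf conjXg tf expgS mulgA.
have t_m : t ^+ #[f] = 1.
  by apply: (mulgI x); rewrite -def_xfk expg_order conjg1 mulg1.
have p_t : p.-elt t := mem_p_elt pT Txf.
have p'_t : p^'.-nat #[t] by apply: pnat_dvd p'f; rewrite order_dvdn t_m.
have /eqP := pnat_1 p_t p'_t.
by rewrite order_eq1 => /eqP t1; rewrite def_xf t1 mulg1.
Qed.

Lemma subnormal_pcore pi H G : H <|<| G -> 'O_pi(H) \subset 'O_pi(G).
Proof.
case/subnormalP=> s path_s <-{G}; elim: s H path_s => //= K s IHs H.
case/andP=> nsHK /IHs; apply: subset_trans; apply: pcore_max.
  exact: pcore_pgroup.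
exact: char_normal_trans (pcore_char pi H) nsHK.
Qed.

Lemma p_elt_pgroup p G : (forall x, x \in G -> p^'.-elt x -> x = 1) -> p.-group G.
Proof.
move=> p'G1; apply/pgroupP=> q pr_q /(Cauchy pr_q)[x Gx ox].
apply/idPn=> p'q; have x1 : x = 1 by apply: p'G1 => //; rewrite /p_elt ox pnatE.
by rewrite -ox x1 order1 in pr_q.
Qed.

(** K acts on the p-group N as its Sylow p-subgroup S does, so it has nontrivial fixed points in N;
    these form a normal subgroup of G, which is N by minimality. *)
Lemma minnormal_pcore_cent (p : nat) G N K :
    minnormal N G -> p.-group N -> N \subset G -> K <| G ->
    'C_G(N) \subset K -> p.-group (K / 'C_G(N)) -> K \subset 'C(N).
Proof.
move=> minN pN sNG nsKG sCK pKC; have [/andP[ntN nNG] minN'] := mingroupP minN.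
have nsCG : 'C_G(N) <| G by rewrite /normal subsetIl normsI ?normG ?norms_cent.
have nsCK : 'C_G(N) <| K := normalS sCK (normal_sub nsKG) nsCG.
have [S sylS] := Sylow_exists p K.
have [sSK pS _] := and3P sylS.
have nNS : S \subset 'N(N) := subset_trans sSK (subset_trans (normal_sub nsKG) nNG).
have pNS : p.-group (N <*> S) by rewrite norm_joinEr // pgroupM pN.
have nsN : N <| N <*> S by rewrite /normal joing_subl join_subG normG.
have ntCS : 'C_N(S) != 1.
  apply: contra (meet_center_nil (pgroup_nil pNS) nsN ntN); rewrite -!subG1.
  apply: subset_trans; rewrite setIS // (subset_trans (subsetIr _ _)) //.
  by rewrite centS ?joing_subr.
have nCK : K \subset 'N('C_G(N)) := normal_norm nsCK.
have sKCS : K \subset 'C_G(N) * S.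
  have sylSC := quotient_pHall (subset_trans sSK nCK) sylS.
  by rewrite -quotientSK // -(pHall_id sylSC pKC) /=.
have sCSK : 'C_N(S) \subset 'C_N(K).
  rewrite subsetI subsetIl centsC (subset_trans sKCS) // mul_subG //.
    by rewrite (subset_trans (subsetIr _ _)) // centS ?subsetIl.
  by rewrite centsC subsetIr.
have nsCN : 'C_N(K) <| G.
  by rewrite /normal subIset ?sNG // normsI ?norms_cent ?(normal_norm nsKG).
rewrite centsC; apply/setIidPl; apply: minN'; rewrite ?subsetIl //.
rewrite (normal_norm nsCN) andbT; apply: contra ntCS; rewrite -!subG1.
exact: subset_trans.
Qed.

Lemma normal_stab_cent p A M (f : gT) :
    p.-group M -> M <| A -> p^'.-elt f -> f \in A ->
    (forall X Y, chief_factor A Y X -> X \subset M ->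
       forall x, x \in X -> [~ x, f] \in Y) ->
  f \in 'C(M).
Proof.
move=> pM nsMA p'f Af stabf.
suffices step n T : #|M| - #|T| < n -> T <| A -> T \subset M ->
    f \in 'C(T) -> f \in 'C(M).
  by apply: (step _ 1%G (leqnn _)); rewrite ?normal1 ?sub1G ?cent1T ?inE.
elim: n T => // n IHn T; rewrite ltnS => leTn nsTA sTM cTf.
have [eqTM | neTM] := eqVneq (T : {set gT}) M; first by rewrite -eqTM.
have prTM : T \proper M by rewrite properEneq neTM.
have [X chTX sXM] := chief_factor_between nsTA nsMA prTM.
have [_ nsXA prTX _] := chief_factorP _ _ _ chTX.
apply: (IHn X) => //.
  by apply: leq_trans leTn; apply: ltn_sub2l; apply: proper_card.
apply/centP=> x Xx; apply/commute_sym/commgP/conjg_fixP.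
exact: coprime_stable_fix (pgroupS sTM pM) p'f (stabf X T chTX sXM x Xx) cTf.
Qed.

End AbelianFactors.

Section AbelianChief.

Variable gT : finGroupType.
Implicit Types A B G H K N M R S T U X Y V E C : {group gT}.

Lemma p_elt_quotient_lift pi A C (xb : coset_of C) :
    xb \in A / C -> pi.-elt xb ->
  exists2 a, a \in A & a \in 'N(C) /\ pi.-elt a /\ xb = coset C a.
Proof.
case/morphimP=> a nCa Aa -> pi_xb; exists a.`_pi; first exact: groupX.
split; first exact: groupX.
split; first exact: p_elt_constt.
by rewrite morph_constt // constt_p_elt.
Qed.

Lemma subgroup_stabilizes A E X Y (M : {group gT}) f x :
  (forall X Y, chief_factor A Y X -> X \subset M -> [~: E, X] \subset Y) ->
  f \in E -> chief_factor A Y X -> X \subset M -> x \in X -> [~ x, f] \in Y.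
Proof.
move=> stabE Ef chXY sXM Xx; rewrite -invg_comm groupV.
by rewrite (subsetP (stabE X Y chXY sXM)) ?mem_commg.
Qed.

(* A p'-element of F = [E, A] centralises A :&: N and N / (A :&: N), hence N, so
   that F / C_F(N) is a p-group; as F is subnormal in G, it lies in O_p(G / C_G(N)),
   which is trivial. *)
Lemma minnormal_abelian_commutator G A B N E :
    mutually_permutable_product G A B -> minnormal N G -> N \subset G ->
    solvable N -> E <| A ->
    (forall X Y, chief_factor A Y X -> X \subset A :&: N -> [~: E, X] \subset Y) ->
  [~: E, A] \subset 'C(N).
Proof.
move=> mpG minN sNG solN nsEA stabE; have [/andP[_ nNG] _] := mingroupP minN.
have nsNG : N <| G by apply/andP.
have [_ _ /is_abelemP[p _ abelN]] := minnormal_solvable minN (subxx _) solN.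
have [abN pN] := (abelem_abelian abelN, abelem_pgroup abelN).
have sAG := mutually_permutable_subl mpG; have nNA := subset_trans sAG nNG.
have sFA' : [~: E, A] \subset A^`(1) by rewrite commSg ?(normal_sub nsEA).
have [/andP[/eqP tiA /eqP tiB] | ntAB] := boolP ((A :&: N == 1) && (B :&: N == 1)).
  have prN := minnormal_avoid_prime mpG minN sNG tiA tiB.
  exact: subset_trans sFA' (cyclic_norm_der1 (prime_cyclic prN) nNA).
have{ntAB} ntAB : A :&: N <> 1 \/ B :&: N <> 1.
  by move: ntAB; rewrite negb_and => /orP[] /eqP; [left | right].
have [defN _ _] := minnormal_product mpG minN sNG ntAB.
have sRN1 := commg_der1_meet mpG nsNG abN defN.
have nsN1A : A :&: N <| A by rewrite /normal subsetIl normsI ?normG.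
have pN1 : p.-group (A :&: N) := pgroupS (subsetIr A N) pN.
have sA'A : A^`(1) \subset A := der_sub 1 A.
pose F := [~: E, A]%G.
have sFE : F \subset E by rewrite commg_subl normal_norm.
have fixN f : f \in F -> p^'.-elt f -> f \in 'C(N).
  move=> Ff p'f; have A'f := subsetP sFA' f Ff.
  have cN1f : f \in 'C(A :&: N).
    apply: (@normal_stab_cent _ p A (A :&: N)%G) => //.
      exact: subsetP sA'A f A'f.
    move=> X Y chXY sXN x Xx.
    exact: subgroup_stabilizes stabE (subsetP sFE f Ff) chXY sXN Xx.
  apply/centP=> n Nn; apply/commute_sym/commgP/conjg_fixP.
  apply: (@coprime_stable_fix _ p (A :&: N)%G) => //.
  by rewrite -invg_comm groupV (subsetP sRN1) ?mem_commg.
pose C := ('C_G(N))%G.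
have nsCG : C <| G by rewrite /normal subsetIl normsI ?normG ?norms_cent.
have sFG : F \subset G := subset_trans sFA' (subset_trans sA'A sAG).
have pFC : p.-group (F / C).
  apply: p_elt_pgroup => xb Fxb /(p_elt_quotient_lift Fxb)[f Ff [_ [p'f ->]]].
  by apply: coset_id; rewrite inE (subsetP sFG) ?fixN.
have snF : F <|<| G.
  apply: subnormal_trans (der1_subnormal mpG); apply: normal_subnormal.
  apply: (normalS sFA' sA'A); rewrite /normal (subset_trans sFA' sA'A) /=.
  by rewrite commg_normr.
have nCF := subset_trans sFG (normal_norm nsCG).
have nsK : coset C @*^-1 'O_p(G / C) <| G.
  by rewrite -{2}(quotientGK nsCG) cosetpre_normal pcore_normal.
have sFK : F \subset coset C @*^-1 'O_p(G / C).
  rewrite -sub_quotient_pre // -{1}(pcore_pgroup_id pFC).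
  exact: subnormal_pcore (quotient_subnormal _ snF).
apply: subset_trans sFK _.
apply: (minnormal_pcore_cent minN pN sNG (K := (coset C @*^-1 'O_p(G / C))%G)) => //.
  exact: sub_cosetpre.
by rewrite cosetpreK pcore_pgroup.
Qed.

(** Put [Y = (A :&: B) <[b]>]. The index of [A :&: B] in Y is prime to p, so the normal p-subgroup
    [Y :&: N] of Y lies in [A :&: B]. Hence [(A :&: N) * Y] meets N exactly in [A :&: N], and b
    normalises this intersection. *)
Lemma p'_elt_norm_meet p G A B N b :
    mutually_permutable_product G A B -> N <| G -> p.-group N ->
    b \in B -> p^'.-elt b ->
  b \in 'N(A :&: N).
Proof.
move=> mpG nsNG pN Bb p'b.
have sBG := mutually_permutable_subr mpG.
have sDA : A :&: B \subset A := subsetIl _ _.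
have sDB : A :&: B \subset B := subsetIr _ _.
have sbB : <[b]> \subset B by rewrite cycle_subG.
pose D := (A :&: B)%G.
have cDb : commute D <[b]>%G.
  by apply: (mutually_permutable_commute mpG) => //; left.
pose Y := (D <*> <[b]>)%G.
have sYB : Y \subset B by rewrite join_subG sDB.
have cN1Y : commute (A :&: N)%G Y.
  by apply: (mutually_permutable_commute mpG); rewrite ?subsetIl ?joing_subl //; right.
have sDY : D \subset Y := joing_subl _ _.
have nsZY : Y :&: N <| Y := normalGI (subset_trans sYB sBG) nsNG.
have nZD := subset_trans sDY (normal_norm nsZY).
pose Z := (Y :&: N)%G.
have sZD : Z \subset D.
  rewrite -indexg_eq1; apply/eqP.
  have pi1 : p.-nat #|Z : D|.
    rewrite -indexgI; apply: pnat_dvd (dvdn_indexg _ _) _.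
    exact: pgroupS (subsetIr Y N) pN.
  have pi2 : p^'.-nat #|Z : D|.
    have sDZY : D <*> Z \subset Y by rewrite join_subG sDY subsetIl.
    apply: (@pnat_dvd _ #|Y : D|).
      rewrite -(Lagrange_index sDZY (joing_subl D Z)) dvdn_mull //.
      have -> : (D <*> Z)%G = D * Z :> {set gT} by apply: norm_joinEl.
      by rewrite indexMg.
    rewrite /= (comm_joingE cDb) indexMg -indexgI.
    by apply: pnat_dvd p'b; apply: dvdn_indexg.
  exact: pnat_1 pi1 pi2.
have <- : ((A :&: N) <*> Y) :&: N = A :&: N.
  rewrite (comm_joingE cN1Y) /= -group_modl ?subsetIr //.
  apply: mulGSid; rewrite subsetI subsetIr andbT.
  exact: subset_trans sZD sDA.
have Yb : b \in Y by rewrite (subsetP (joing_subr _ _)) ?cycle_id.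
have Jb : b \in (A :&: N) <*> Y by rewrite (subsetP (joing_subr _ _)).
have nNb : b \in 'N(N) by rewrite (subsetP (normal_norm nsNG)) ?(subsetP sBG).
by apply/normP; rewrite conjIg (normP nNb) conjGid.
Qed.

End AbelianChief.

(** * Nilpotency of the action when both factors stabilise *)

Section Scalars.

Variable gT : finGroupType.
Implicit Types A B G H K N M R S T U X Y V E C : {group gT}.

(** For independent v and w, comparing the images of v, w and v * w shows that b raises v and w to
    the same power. *)
Lemma abelem_power_scalar p T (b : gT) :
    p.-abelem T -> (forall v, v \in T -> v ^ b \in <[v]>) ->
  exists i, forall v, v \in T -> v ^ b = v ^+ i.
Proof.
move=> abelT powT; have [T1 | ntT] := eqVneq (T : {set gT}) 1.
  by exists 0 => v; rewrite T1 => /set1P->; rewrite conj1g.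
have cTT := centsP (abelem_abelian abelT).
have [v Tv ntv] := trivgPn T ntT; have /cycleP[i vb] := powT v Tv.
have ov := abelem_order_p abelT Tv ntv.
have [p_pr _ _] := pgroup_pdiv (abelem_pgroup abelT) ntT.
exists i => w Tw; have [/cycleP[k ->] | notvw] := boolP (w \in <[v]>).
  by rewrite conjXg vb -!expgM mulnC.
have ntw : w != 1 by apply: contraNneq notvw => ->; apply: group1.
have ow := abelem_order_p abelT Tw ntw.
have tivw : <[w]> :&: <[v]> = 1.
  by apply: prime_TIg; rewrite -?orderE ?ow // cycle_subG.
have /cycleP[j wb] := powT w Tw.
have /cycleP[k vwb] := powT (v * w) (groupM Tv Tw).
have cvw : commute v w := cTT v Tv w Tw.
rewrite conjMg vb wb expgMn // in vwb.
have def1 : (v ^+ k)^-1 * v ^+ i = w ^+ k * (w ^+ j)^-1.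
  by apply: (mulgI (v ^+ k)); apply: (mulIg (w ^+ j)); rewrite mulKVg -!mulgA mulVg mulg1.
have eq1 : (v ^+ k)^-1 * v ^+ i = 1.
  apply/set1gP; rewrite -tivw inE {1}def1.
  by rewrite !groupM ?groupV ?mem_cycle.
move/eqP: (def1); rewrite eq1 eq_sym -eq_mulgV1 => /eqP eqwk.
move/eqP: eq1; rewrite -eq_mulVg1 eq_expg_mod_order ov -ow -eq_expg_mod_order.
by rewrite eqwk wb => /eqP.
Qed.

Lemma scalar_commutator T (b x : gT) i :
    (forall v, v \in T -> v ^ b = v ^+ i) -> b \in 'N(T) -> x \in 'N(T) ->
  [~ x, b] \in 'C(T).
Proof.
move=> scalb nTb nTx; apply/centP=> v Tv; apply/commute_sym/commgP/conjg_fixP.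
have defR : [~ x, b] = (b * x)^-1 * (x * b) by rewrite invMg commgEl /conjg !mulgA.
pose u := v ^ (b * x)^-1.
have Tu : u \in T by rewrite memJ_norm // groupV groupM.
have Tux : u ^ x \in T by rewrite memJ_norm.
rewrite defR conjgM -/u conjgM (scalb _ Tux) -conjXg -(scalb _ Tu) -conjgM.
by rewrite -conjgM mulVg conjg1.
Qed.

(** Modulo [A :&: N] the p-element x normalises a subgroup of order 1 or p generated by an element
    of [B :&: N], and a p-group acts trivially on such a subgroup. *)
Lemma p_elt_stab_meet p G A B N (x : gT) :
    mutually_permutable_product G A B -> N <| G -> p.-abelem N ->
    N :=: (A :&: N) * (B :&: N) -> x \in A -> p.-elt x ->
  forall n, n \in N -> [~ n, x] \in A :&: N.
Proof.
move=> mpG nsNG abelN defN Ax p_x n Nn.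
have [abN pN] := (abelem_abelian abelN, abelem_pgroup abelN).
have sAG := mutually_permutable_subl mpG.
have nNA := subset_trans sAG (normal_norm nsNG).
pose N1 := (A :&: N)%G.
have nN1A : A \subset 'N(N1) by rewrite normsI ?normG.
have nN1N : N \subset 'N(N1).
  by rewrite cents_norm // (subset_trans abN) // centS ?subsetIr.
have nN1x := subsetP nN1A x Ax.
have: n \in (A :&: N) * (B :&: N) by rewrite -defN.
case/mulsgP=> n1 y N1n1 By_y ->; have [_ Ny] := setIP By_y.
have nN1y := subsetP nN1N y Ny.
have [_ nXA] : commute N1 <[y]>%G /\ A \subset 'N(N1 <*> <[y]>).
  by apply: (mutually_permutable_norm mpG nsNG); rewrite cycle_subG.
have nN1Y : <[y]> \subset 'N(N1) by rewrite cycle_subG.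
have nXb : A / N1 \subset 'N(<[y]> / N1).
  by rewrite -(quotientYidl nN1Y) quotient_norms.
rewrite commMgJ groupM //.
  rewrite memJ_norm // commgEl groupM ?groupV //.
  by rewrite memJ_norm.
apply: coset_idr; first by rewrite groupR.
rewrite morphR //; apply/eqP/commgP.
pose yb := coset N1 y; pose xb := coset N1 x.
have [yb1 | ntyb] := eqVneq yb 1.
  by rewrite /commute [_ y]yb1 mulg1 mul1g.
have p_yb : p.-group <[yb]> by apply: morph_p_elt => //; apply: mem_p_elt Ny.
have p_xb : p.-group <[xb]> by apply: morph_p_elt.
have nyx : <[xb]> \subset 'N(<[yb]>).
  rewrite cycle_subG -quotient_cycle // (subsetP nXb) // mem_quotient //.
have p_P : p.-group (<[yb]> <*> <[xb]>) by rewrite norm_joinEr // pgroupM p_yb.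
have nsP : <[yb]> <| <[yb]> <*> <[xb]> by rewrite /normal joing_subl join_subG normG.
have ntY : <[yb]> != 1 by rewrite cycle_eq1.
have pr_p : prime p by have [] := pgroup_pdiv p_yb ntY.
have nty : y != 1 by apply: contraNneq ntyb => y1; rewrite /yb y1 morph1.
have pr_yb : prime #|<[yb]>|.
  suffices -> : #|<[yb]>| = p by [].
  apply/prime_nt_dvdP; rewrite // -orderE ?order_eq1 //.
  by rewrite -(abelem_order_p abelN Ny nty) morph_order.
have := prime_meetG pr_yb (meet_center_nil (pgroup_nil p_P) nsP ntY).
rewrite cycle_subG => /setIP[_ /centP]; apply.
by rewrite (subsetP (joing_subr _ _)) ?cycle_id.
Qed.

End Scalars.

Section PGroups.

Variable gT : finGroupType.
Implicit Types A B G H K N M R S T U X Y V E C : {group gT}.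

Lemma pgroup_product pi G A B :
  G :=: A * B -> pi.-group A -> pi.-group B -> pi.-group G.
Proof.
move=> defG piA piB; rewrite /pgroup defG.
apply: (@pnat_dvd _ (#|A| * #|B|)); first by rewrite mul_cardG dvdn_mulr.
by rewrite pnatM; apply/andP.
Qed.

Lemma der1_p'group_pcore p G (x : gT) :
  p^'.-group G^`(1) -> x \in G -> p^'.-elt x -> x \in 'O_p^'(G).
Proof.
move=> p'G' Gx p'x; have sxG : <[x]> \subset G by rewrite cycle_subG.
have nG'x : <[x]> \subset 'N(G^`(1)).
  by rewrite (subset_trans sxG) ?der_norm.
have nsJ : G^`(1) <*> <[x]> <| G.
  by apply: sub_der1_normal; rewrite ?joing_subl // join_subG der_sub.
have p'J : p^'.-group (G^`(1) <*> <[x]>) by rewrite norm_joinEr // pgroupM p'G'.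
by rewrite (subsetP (pcore_max p'J nsJ)) // (subsetP (joing_subr _ _)) ?cycle_id.
Qed.

End PGroups.

Section NilpotentAction.

Variable gT : finGroupType.
Implicit Types A B G H K N M R S T U X Y V E C : {group gT}.

Lemma scalar_p'_commutator p G A B N (x b : gT) : prime p ->
    mutually_permutable_product G A B -> N <| G -> p.-abelem N ->
    N :=: (A :&: N) * (B :&: N) -> (A :&: N) :&: (B :&: N) = 1 ->
    p^'.-group (G / 'C_G(N))^`(1) ->
    x \in A -> p.-elt x -> b \in B -> p^'.-elt b ->
  [~ x, b] \in 'C(N).
Proof.
move=> p_pr mpG nsNG abelN defN tiN p'G' Ax p_x Bb p'b.
have [_ pN] := (abelem_abelian abelN, abelem_pgroup abelN).
have sAG := mutually_permutable_subl mpG.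
have sBG := mutually_permutable_subr mpG.
have [nNA nNB] := (subset_trans sAG (normal_norm nsNG), subset_trans sBG (normal_norm nsNG)).
have [Gx Gb] := (subsetP sAG x Ax, subsetP sBG b Bb).
pose N1 := (A :&: N)%G; pose N2 := (B :&: N)%G.
have nN1A : A \subset 'N(N1) by rewrite normsI ?normG.
have nN1x := subsetP nN1A x Ax.
have nN1b : b \in 'N(N1) := p'_elt_norm_meet mpG nsNG pN Bb p'b.
(* As the two intersections with N are disjoint, <[v]> is the intersection of [N1] with [(B :&: N)
   <*> <[v]>], and b normalises both. *)
have pow_b v : v \in N1 -> v ^ b \in <[v]>.
  move=> N1v; have svN1 : <[v]> \subset A :&: N by rewrite cycle_subG.
  have [cN2v nJB] := mutually_permutable_norm (mutually_permutable_sym mpG) nsNG svN1.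
  have defv : N1 :&: ((B :&: N) <*> <[v]>) = <[v]>.
    rewrite (comm_joingE cN2v) cN2v setIC -group_modl //=.
    by rewrite setIC tiN mulg1.
  rewrite -defv inE memJ_norm // N1v /= memJ_norm ?(subsetP nJB) //.
  by rewrite (subsetP (joing_subr _ _)) ?cycle_id.
have abelN1 : p.-abelem N1 := abelemS (subsetIr A N) abelN.
have [i scal_b] := abelem_power_scalar abelN1 pow_b.
have cN1c := scalar_commutator scal_b nN1b nN1x.
have [c def_c] : exists c, c = [~ x, b] by exists [~ x, b].
rewrite -def_c in cN1c *.
have stab_x := p_elt_stab_meet mpG nsNG abelN defN Ax p_x.
have stab_c n : n \in N -> exists2 t, t \in N1 & n ^ c = n * t.
  move=> Nn; have stabE y m : m \in N -> [~ m, y] \in N1 ->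
      exists2 t, t \in N1 & m ^ y = m * t.
    by move=> Nm N1my; exists [~ m, y]; rewrite // commgEl mulKVg.
  have nNx := subsetP nNA x Ax; have nNb := subsetP nNB b Bb.
  have Nm : n ^ x^-1 \in N by rewrite memJ_norm ?groupV.
  have [t N1t def_t] := stabE x _ Nm (stab_x _ Nm).
  have Nbn : (n ^ x^-1) ^ b^-1 \in N by rewrite memJ_norm ?groupV.
  have [u N1u def_u] := stabE x _ Nbn (stab_x _ Nbn).
  have defn : n ^ x^-1 = n * t^-1.
    by apply: (mulIg t); rewrite -def_t conjgKV mulgKV.
  exists (t^-1 * u ^ b); first by rewrite groupM ?groupV // memJ_norm.
  rewrite def_c commgEl conjgM [x ^ b]conjgE.
  rewrite !conjgM def_u conjMg conjgKV.
  by rewrite defn -mulgA.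
have c_p : c ^+ p \in 'C(N).
  apply/centP=> n Nn; apply/commute_sym/commgP/conjg_fixP.
  have [t N1t nc] := stab_c n Nn.
  have tc : t ^ c = t by apply/conjg_fixP/commgP/commute_sym/(centP cN1c).
  have nck k : n ^ (c ^+ k) = n * t ^+ k.
    elim: k => [|k IHk]; first by rewrite conjg1 mulg1.
    by rewrite expgSr conjgM IHk conjMg nc conjXg tc expgS mulgA.
  have /and3P[_ _ /exponentP tp1] := abelN1.
  by rewrite nck tp1 // mulg1.
pose C := ('C_G(N))%G.
have nsCG : C <| G by rewrite /normal subsetIl normsI ?normG ?norms_cent ?(normal_norm nsNG).
have Gc : c \in G by rewrite def_c groupR.
have nCG := normal_norm nsCG.
have nCc := subsetP nCG c Gc.
have cb1 : coset C c = 1.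
  apply/eqP; rewrite -order_eq1; apply/eqP.
  have p_cb : p.-nat #[coset C c].
    apply: (@pnat_dvd _ p); last by rewrite pnat_id.
    have Cc_p : c ^+ p \in C by rewrite inE c_p groupX.
    by rewrite order_dvdn -morphX //; apply/eqP/coset_id.
  apply: pnat_1 p_cb _; apply: mem_p_elt p'G' _.
  by rewrite def_c morphR ?(subsetP nCG) // mem_commg ?mem_quotient.
by have /setIP[] := coset_idr nCc cb1.
Qed.

(** [a, b] is the product of [a^-1] and [a ^ b]; as b normalises [A :&: N], both centralise it. The
    argument for [B :&: N] is symmetric. *)
Lemma p'_p'_commutator p G A B N (a b : gT) :
    mutually_permutable_product G A B -> N <| G -> p.-group N ->
    N :=: (A :&: N) * (B :&: N) ->
    a \in A -> p^'.-elt a -> a \in 'C(A :&: N) ->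
    b \in B -> p^'.-elt b -> b \in 'C(B :&: N) ->
  [~ a, b] \in 'C(N).
Proof.
move=> mpG nsNG pN defN Aa p'a cN1a Bb p'b cN2b.
have nN1b : b \in 'N(A :&: N) := p'_elt_norm_meet mpG nsNG pN Bb p'b.
have nN2a : a \in 'N(B :&: N) := p'_elt_norm_meet (mutually_permutable_sym mpG) nsNG pN Aa p'a.
rewrite defN centM inE; apply/andP; split.
  rewrite commgEl groupM ?groupV // memJ_norm //.
  exact: subsetP (cent_norm (A :&: N)) b nN1b.
rewrite commgEr groupM // memJ_norm ?groupV //.
exact: subsetP (cent_norm (B :&: N)) a nN2a.
Qed.

Lemma p'_elt_central p G A B N (b : gT) : prime p ->
    mutually_permutable_product G A B -> N <| G -> p.-abelem N ->
    N :=: (A :&: N) * (B :&: N) -> (A :&: N) :&: (B :&: N) = 1 ->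
    p^'.-group (G / 'C_G(N))^`(1) -> abelian (B / 'C_G(N)) ->
    (forall a, a \in A -> p^'.-elt a -> a \in 'C(A :&: N)) ->
    b \in B -> p^'.-elt b -> b \in 'C(B :&: N) ->
  coset 'C_G(N) b \in 'Z(G / 'C_G(N)).
Proof.
move=> p_pr mpG nsNG abelN defN tiN p'G' abB cN1A Bb p'b cN2b.
have pN := abelem_pgroup abelN.
have sAG := mutually_permutable_subl mpG.
have sBG := mutually_permutable_subr mpG.
have Gb := subsetP sBG b Bb.
have nsCG : 'C_G(N) <| G.
  by rewrite /normal subsetIl normsI ?normG ?norms_cent ?(normal_norm nsNG).
have nCG := normal_norm nsCG.
have comm_b x : x \in G -> [~ x, b] \in 'C(N) ->
    commute (coset 'C_G(N) x) (coset 'C_G(N) b).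
  move=> Gx cNxb; apply/commgP; rewrite -morphR ?(subsetP nCG) //.
  by apply/eqP; apply: coset_id; rewrite inE groupR.
rewrite inE mem_quotient //=; have [defGb _ _] := mutually_permutable_quotient mpG nsCG.
rewrite defGb centM inE; apply/andP; split; last first.
  by apply: (subsetP abB); rewrite mem_quotient.
apply/centP=> _ /morphimP[a nCa Aa ->]; apply: commute_sym.
have Ga := subsetP sAG a Aa.
rewrite -(consttC p a) morphM ?groupX //; apply: commute_sym; apply: commuteM.
  apply/commute_sym/comm_b; first exact: groupX.
  apply: (scalar_p'_commutator p_pr mpG nsNG abelN) => //; first exact: groupX.
  exact: p_elt_constt.
apply/commute_sym/comm_b; first exact: groupX.
have Aa' : a.`_p^' \in A by apply: groupX.
have p'a' := p_elt_constt p^' a.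
exact: (p'_p'_commutator mpG nsNG pN defN Aa' p'a' (cN1A _ Aa' p'a') Bb p'b cN2b).
Qed.

(** A / C and B / C are abelian, so (G / C)' is abelian, and it is a p'-group because G / C has no
    normal p-subgroup. If [A :&: N] and [B :&: N] are disjoint, the p'-elements of A and B are
    central modulo C, so G / C is a p-group modulo its centre. Otherwise the product P of the
    intersections of A / C and B / C with ['O_p^'(G / C)] fixes the nontrivial group
    [(A :&: N) :&: (B :&: N)], hence all of N by minimality; so P = 1, and G / C is a p-group. *)
Lemma minnormal_nilpotent_quotient G A B N :
    mutually_permutable_product G A B -> minnormal N G -> N \subset G ->
    solvable N ->
    (forall X Y, chief_factor A Y X -> X \subset A :&: N -> [~: A, X] \subset Y) ->
    (forall X Y, chief_factor B Y X -> X \subset B :&: N -> [~: B, X] \subset Y) ->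
  nilpotent (G / 'C_G(N)).
Proof.
move=> mpG minN sNG solN stabA stabB; have [/andP[_ nNG] minN'] := mingroupP minN.
have nsNG : N <| G by apply/andP.
have [_ _ /is_abelemP[p p_pr abelN]] := minnormal_solvable minN (subxx _) solN.
have [_ pN] := (abelem_abelian abelN, abelem_pgroup abelN).
pose C := ('C_G(N))%G.
have nsCG : C <| G by rewrite /normal subsetIl normsI ?normG ?norms_cent.
have nCG := normal_norm nsCG.
have [/andP[/eqP tiA /eqP tiB] | ntAB] := boolP ((A :&: N == 1) && (B :&: N == 1)).
  have prN := minnormal_avoid_prime mpG minN sNG tiA tiB.
  apply: abelian_nil; apply: sub_der1_abelian; rewrite subsetI der_sub /=.
  exact: cyclic_norm_der1 (prime_cyclic prN) nNG.
have{ntAB} ntAB : A :&: N <> 1 \/ B :&: N <> 1.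
  by move: ntAB; rewrite negb_and => /orP[] /eqP; [left | right].
have mpN := minnormal_product mpG minN sNG ntAB.
have [defN _ _] := mpN; have [defN' _ _] := mutually_permutable_sym mpN.
have mpG' := mutually_permutable_sym mpG.
have abQ A1 B1 : mutually_permutable_product G A1 B1 ->
    (forall X Y, chief_factor A1 Y X -> X \subset A1 :&: N -> [~: A1, X] \subset Y) ->
    abelian (A1 / C).
  move=> mp1 stab1; apply: sub_der1_abelian; rewrite subsetI.
  rewrite (subset_trans (der_sub 1 A1) (mutually_permutable_subl mp1)) /=.
  exact: (minnormal_abelian_commutator mp1 minN sNG solN (normal_refl A1) stab1).
have [abA abB] := (abQ A B mpG stabA, abQ B A mpG' stabB).
have fixQ A1 : A1 \subset G ->
    (forall X Y, chief_factor A1 Y X -> X \subset A1 :&: N -> [~: A1, X] \subset Y) ->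
    forall a, a \in A1 -> p^'.-elt a -> a \in 'C(A1 :&: N).
  move=> sA1G stab1 a Aa p'a.
  apply: (@normal_stab_cent _ p A1 (A1 :&: N)%G) => //.
  - exact: pgroupS (subsetIr A1 N) pN.
  - by rewrite /normal subsetIl normsI ?normG ?(subset_trans sA1G).
  by move=> X Y chXY sXN x Xx; apply: subgroup_stabilizes stab1 Aa chXY sXN Xx.
have [sAG sBG] := (mutually_permutable_subl mpG, mutually_permutable_subr mpG).
have fixA := fixQ A sAG stabA; have fixB := fixQ B sBG stabB.
have mpGb := mutually_permutable_quotient mpG nsCG; have [defGb _ _] := mpGb.
have abG' : abelian (G / C)^`(1) := abelian_product_der1 defGb abA abB.
have Op1 : 'O_p(G / C) = 1.
  have nsK : coset C @*^-1 'O_p(G / C) <| G.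
    by rewrite -{2}(quotientGK nsCG) cosetpre_normal pcore_normal.
  rewrite -(cosetpreK 'O_p(G / C)); apply: quotientS1.
  rewrite subsetI normal_sub //=.
  apply: (minnormal_pcore_cent minN pN sNG (K := (coset C @*^-1 'O_p(G / C))%G)) => //.
    exact: sub_cosetpre.
  by rewrite cosetpreK pcore_pgroup.
have p'G' : p^'.-group (G / C)^`(1).
  have OpG'1 : 'O_p((G / C)^`(1)) = 1.
    apply/trivgP; rewrite -Op1 pcore_max ?pcore_pgroup //.
    exact: char_normal_trans (pcore_char p _) (der_normal 1 _).
  have := nilpotent_pcoreC p (abelian_nil abG').
  by rewrite OpG'1 dprod1g => <-; apply: pcore_pgroup.
have lift A1 (xb : coset_of C) : xb \in A1 / C -> p^'.-elt xb ->
    exists2 a, a \in A1 & p^'.-elt a /\ xb = coset C a.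
  by move=> A1x /(p_elt_quotient_lift A1x)[a Aa [_ [p'a ->]]]; exists a.
have [tiN | ntN0] := eqVneq ((A :&: N) :&: (B :&: N)) 1.
  have tiN' : (B :&: N) :&: (A :&: N) = 1 by rewrite setIC.
  rewrite -quotient_center_nil; apply: (@pgroup_nil _ p).
  have nsZ : 'Z(G / C) <| G / C := center_normal _.
  have [defQ _ _] := mutually_permutable_quotient mpGb nsZ.
  have pQ A1 : A1 \subset G -> (forall a, a \in A1 -> p^'.-elt a -> coset C a \in 'Z(G / C)) ->
      p.-group (A1 / C / 'Z(G / C)).
    move=> sA1G cenA1; apply: p_elt_pgroup => y Ay p'y.
    have [xb A1x [_ [p'x ->]]] := p_elt_quotient_lift Ay p'y.
    have [a Aa [p'a ->]] := lift A1 xb A1x p'x.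
    by apply: coset_id; apply: cenA1.
  apply: (pgroup_product defQ); apply: pQ => // a Aa p'a.
    exact: (p'_elt_central p_pr mpG' nsNG abelN defN' tiN' p'G' abA fixB Aa p'a (fixA a Aa p'a)).
  exact: (p'_elt_central p_pr mpG nsNG abelN defN tiN p'G' abB fixA Aa p'a (fixB a Aa p'a)).
pose H := 'O_p^'(G / C)%G.
have nsH : H <| G / C := pcore_normal _ _.
have [P [nsP mpP]] := mutually_permutable_normalI mpGb nsH.
have [defP _ _] := mpP.
have [K defK _ nsKG] := inv_quotientN nsCG nsP.
have nCK := subset_trans (normal_sub nsKG) nCG.
have cN0K : K \subset 'C((A :&: N) :&: (B :&: N)).
  apply/subsetP=> k Kk.
  have : coset C k \in (A / C :&: H) * (B / C :&: H).
    by rewrite -defP defK mem_quotient.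
  case/mulsgP=> ub vb /setIP[Au Hu] /setIP[Bv Hv] def_k.
  have p'H : p^'.-group H := pcore_pgroup _ _.
  have [a Aa [p'a def_u]] := lift A ub Au (mem_p_elt p'H Hu).
  have [b Bb [p'b def_v]] := lift B vb Bv (mem_p_elt p'H Hv).
  have [Ga Gb] := (subsetP sAG a Aa, subsetP sBG b Bb).
  have Gab : a * b \in G by rewrite groupM.
  have [nCa nCb] := (subsetP nCG a Ga, subsetP nCG b Gb).
  rewrite -(mulKVg (a * b) k); apply: groupM.
    rewrite groupM //.
      by apply: subsetP (fixA a Aa p'a); rewrite centS ?subsetIl.
    by apply: subsetP (fixB b Bb p'b); rewrite centS ?subsetIr.
  have Ck : (a * b)^-1 * k \in C.
    have nCk := subsetP nCK k Kk; have nCab := subsetP nCG _ Gab.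
    apply: coset_idr; first by rewrite groupM ?groupV.
    rewrite morphM ?groupV // morphV // morphM //.
    by rewrite /= def_k def_u def_v mulVg.
  have sN0N : (A :&: N) :&: (B :&: N) \subset N.
    by rewrite (subset_trans (subsetIl _ _)) ?subsetIr.
  by have [_] := setIP Ck; apply: subsetP; rewrite centS.
have cNK : K \subset 'C(N).
  rewrite centsC; apply/setIidPl; apply: minN'; rewrite ?subsetIl //.
  have nsCN : 'C_N(K) <| G.
    by rewrite /normal subIset ?sNG // normsI ?norms_cent ?(normal_norm nsKG).
  rewrite (normal_norm nsCN) andbT; apply: contra ntN0; rewrite -!subG1.
  apply: subset_trans; rewrite subsetI centsC cN0K andbT.
  by rewrite (subset_trans (subsetIl _ _)) ?subsetIr.
have P1 : P :=: 1.
  by rewrite defK; apply/quotientS1; rewrite subsetI (normal_sub nsKG).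
have pQ A1 : A1 \subset G -> (A1 / C) :&: H = 1 -> p.-group (A1 / C).
  move=> sA1G ti1; apply: p_elt_pgroup => y Ay p'y.
  apply/set1gP; rewrite -ti1 inE Ay; apply: der1_p'group_pcore => //.
  exact: subsetP (quotientS C sA1G) y Ay.
apply: (@pgroup_nil _ p); apply: (pgroup_product defGb); apply: pQ => //.
  by apply/trivgP; rewrite -P1 defP mulG_subl.
by apply/trivgP; rewrite -P1 defP mulG_subr.
Qed.

End NilpotentAction.

(** * Bounds for the length of a mutually permutable product *)

Section LowerBound.

Variable gT : finGroupType.
Implicit Types A B D G H K N M R S T U X Y V W Z E C : {group gT}.

(** V is taken maximal among the normal subgroups of G above W with [X :&: V \subset Y]. Any chief
    factor U / V then has [X :&: U] outside Y, and X = Y (X :&: U) because X / Y is a chief factor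
    of A. *)
Lemma chief_factor_restrict G A W X Y :
    A \subset G -> W <| G -> chief_factor A Y X -> A :&: W \subset Y ->
  exists V U, [/\ chief_factor G V U, W \subset V, X :=: Y * (X :&: U),
                  X :&: V \subset Y & #|X : Y| %| #|U : V|].
Proof.
move=> sAG nsWG /chief_factorP[nsYA nsXA prYX minX] sWY.
have sXG := subset_trans (normal_sub nsXA) sAG.
have sXWY : X :&: W \subset Y.
  by apply: subset_trans sWY; rewrite setSI ?(normal_sub nsXA).
have [V maxV _] : {V : {group gT} |
    [max V | [&& V <| G, W \subset V & X :&: V \subset Y]] & W \subset V}.
  by apply: maxgroup_exists; rewrite nsWG subxx.
have [/and3P[nsVG sWV sXVY] maxV'] := maxgroupP maxV.
have prVG : V \proper G.
  rewrite properE normal_sub //; apply: contra (proper_subn prYX) => sGV.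
  by apply: subset_trans sXVY; rewrite subsetI subxx (subset_trans sXG).
have [U chVU _] := chief_factor_between nsVG (normal_refl G) prVG.
have [_ nsUG prVU _] := chief_factorP _ _ _ chVU.
have sVU := proper_sub prVU.
have nsXU : X :&: U <| A.
  rewrite /normal subIset ?(normal_sub nsXA) // normsI ?(normal_norm nsXA) //.
  exact: subset_trans sAG (normal_norm nsUG).
have nYXU : X :&: U \subset 'N(Y).
  exact: subset_trans (normal_sub nsXU) (normal_norm nsYA).
have defX : X :=: Y * (X :&: U).
  have [|||eqY|eqX] := minX (Y <*> (X :&: U))%G.
  - by rewrite normalY.
  - exact: joing_subl.
  - by rewrite join_subG (proper_sub prYX) subsetIl.
  - case/negP: (proper_subn prVU); rewrite (maxV' U) //.
    by rewrite nsUG (subset_trans sWV) //= -eqY joing_subr.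
  by rewrite -{1}eqX /= norm_joinEr.
exists V, U; split=> //.
rewrite {1}defX indexMg -(indexgI _ Y).
apply: (@dvdn_trans #|X :&: U : (X :&: U) :&: V|).
  have sVY : (X :&: U) :&: V \subset (X :&: U) :&: Y.
    by rewrite subsetI subsetIl /= (subset_trans _ sXVY) // setSI ?subsetIl.
  by rewrite -(Lagrange_index (subsetIl _ _) sVY) dvdn_mulr.
have sXUG := subset_trans (normal_sub nsXU) sAG.
have nVXU : X :&: U \subset 'N(V) := subset_trans sXUG (normal_norm nsVG).
have sVXU : V <*> (X :&: U) \subset U by rewrite join_subG sVU subsetIr.
rewrite indexgI -(Lagrange_index sVXU (joing_subl _ _)) dvdn_mull //.
by rewrite /= norm_joinEr // indexMg.
Qed.

Lemma factor_cent_mul A D X Y Z :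
    X <| A -> Y <| A -> Z <| A -> X :=: Y * Z -> D \subset A ->
    [~: D, Z] \subset Y ->
  D \subset 'C_A(X / Y | 'Q).
Proof.
move=> nsXA nsYA nsZA defX sDA sDZ; rewrite sub_factor_cent //.
have nYD : D \subset 'N(Y) := subset_trans sDA (normal_norm nsYA).
have nYZ : Z \subset 'N(Y) := subset_trans (normal_sub nsZA) (normal_norm nsYA).
have nYX : X \subset 'N(Y) := subset_trans (normal_sub nsXA) (normal_norm nsYA).
rewrite -quotient_cents2 // defX quotientMl ?normG //.
by rewrite trivg_quotient mul1g quotient_cents2.
Qed.

Lemma abelian_inner_on G U V :
  V <| G -> U <| G -> abelian (U / V) -> inner_on G U V \subset 'C_G(U / V | 'Q).
Proof.
move=> nsVG nsUG abUV; rewrite join_subG subxx andbT.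
rewrite sub_factor_cent ?(normal_sub nsUG) // -quotient_cents2 //.
  exact: subset_trans (normal_sub nsUG) (normal_norm nsVG).
exact: subset_trans (normal_sub nsUG) (normal_norm nsVG).
Qed.

(** X / Y is a section of U / V, so U / V is in the class and a is inner on it. If U / V is abelian,
    a centralises it; otherwise the inner automorphism is corrected by an element x of [X :&: U],
    and the remainder centralises X / Y. *)
Lemma inner_radical_restrict (phi : pred nat) G A B W :
    (forall d n, d %| n -> phi d -> phi n) ->
    mutually_permutable_product G A B -> W <| G ->
  A :&: inner_radical phi G W \subset inner_radical phi A (A :&: W)%G.
Proof.
move=> phi_dvd mpG nsWG; have sAG := mutually_permutable_subl mpG.
set R := inner_radical phi G W.
apply/sub_inner_radicalP=> [|Y X chYX sWY phiYX]; first exact: subsetIl.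
have [nsYA nsXA _ _] := chief_factorP _ _ _ chYX.
have [V [U [chVU sWV defX sXVY dvdUV]]] := chief_factor_restrict sAG nsWG chYX sWY.
have [nsVG nsUG _ _] := chief_factorP _ _ _ chVU.
have phiUV := phi_dvd _ _ dvdUV phiYX.
have sRI : A :&: R \subset inner_on G U V.
  by rewrite subIset // (inner_radical_inner chVU sWV phiUV) orbT.
have nsXUA : X :&: U <| A.
  rewrite /normal subIset ?(normal_sub nsXA) // normsI ?(normal_norm nsXA) //.
  exact: subset_trans sAG (normal_norm nsUG).
have nVG := normal_norm nsVG; have nVA := subset_trans sAG nVG.
have nVU := subset_trans (normal_sub nsUG) nVG.
have nVXU : X :&: U \subset 'N(V) := subset_trans (subsetIr _ _) nVU.
have minUV := chief_factor_minnormal chVU.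
have centX D : D \subset A -> [~: D, X :&: U] \subset V ->
    D \subset 'C_A(X / Y | 'Q).
  move=> sDA sDV; apply: (factor_cent_mul nsXA nsYA nsXUA defX sDA).
  apply: subset_trans sXVY; rewrite subsetI sDV andbT.
  apply: subset_trans (commSg _ sDA) _; apply: subset_trans _ (subsetIl X U).
  by rewrite commg_subr (normal_norm nsXUA).
have sAR : A :&: R \subset A := subsetIl _ _.
have [solUV | nsolUV] := boolP (solvable (U / V)).
  have [_ _ /is_abelemP[_ _ /abelem_abelian abUV]] :=
    minnormal_solvable minUV (subxx _) solUV.
  apply: subset_trans (joing_subr _ _); apply: centX => //.
  apply: subset_trans (commgS _ (subsetIr X U)) _.
  rewrite -(sub_factor_cent nsVG nsUG (subset_trans sAR sAG)).
  exact: subset_trans sRI (abelian_inner_on nsVG nsUG abUV).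
have crUV := minnormal_cr minUV nsolUV.
have sUVG : U / V \subset G / V := quotientS V (normal_sub nsUG).
have [nsA1 _ _ _] := minnormal_nonabelian_product
  (mutually_permutable_quotient mpG nsVG) minUV sUVG nsolUV.
have sVU : V \subset U by have [_ _ /proper_sub] := chief_factorP _ _ _ chVU.
(* Mutual permutability makes the right-hand side normal in U / V, so the image of [X :&: U] splits
   off as a direct factor of U / V. *)
have nsX1 : (X :&: U) / V <| (A / V) :&: (U / V).
  rewrite -quotientIG //; apply: quotient_normal.
  apply: normalS (subsetIl A U) nsXUA.
  by rewrite setSI ?(normal_sub nsXA).
have nsX1N := cr_centerless_trans crUV nsA1 nsX1.
have [_ defUV _ _] := dprodP (crUV ((X :&: U) / V)%G nsX1N).
apply/subsetP=> a ARa; have Aa := subsetP sAR a ARa.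
have Ia := subsetP sRI a ARa.
have : a \in U * 'C_G(U / V | 'Q) by rewrite -inner_onE.
case/mulsgP=> u c Uu /setIP[Gc]; rewrite astabQ => /morphpreP[nVc cUVc] def_a.
have: coset V u \in (X :&: U) / V * 'C_(U / V)((X :&: U) / V).
  by rewrite defUV mem_quotient.
case/mulsgP=> _ t /morphimP[x nVx XUx ->] /setIP[_ cXt] def_u.
have [Xx _] := setIP XUx.
have Ax := subsetP (normal_sub nsXA) x Xx.
have Ad : x^-1 * a \in A by rewrite groupM ?groupV.
have nVd := subsetP nVA _ Ad.
have cXd : coset V (x^-1 * a) \in 'C((X :&: U) / V).
  have nVu := subsetP nVU u Uu.
  have -> : coset V (x^-1 * a) = (coset V x)^-1 * (coset V u * coset V c).
    by rewrite def_a morphM ?groupV ?groupM // morphV // morphM.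
  rewrite def_u -mulgA mulKg groupM //.
  by apply: subsetP cUVc; rewrite centS ?quotientS ?subsetIr.
rewrite -(mulKVg x a); apply: groupM; first exact: subsetP (sub_inner_on A X Y) x Xx.
have sC : 'C_A(X / Y | 'Q) \subset inner_on A X Y := joing_subr _ _.
apply: (subsetP sC); rewrite -cycle_subG; apply: centX; first by rewrite cycle_subG.
by rewrite -quotient_cents2 ?cycle_subG // quotient_cycle // cycle_subG.
Qed.

Lemma phi_length_le_restrict (phi : pred nat) n G A B W :
    (forall d n, d %| n -> phi d -> phi n) ->
    mutually_permutable_product G A B -> W <| G ->
  phi_length_le phi n G W -> phi_length_le phi n A (A :&: W)%G.
Proof.
move=> phi_dvd mpG; have sAG := mutually_permutable_subl mpG.
elim: n W => [|n IHn] W nsWG /=.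
  move=> noG Y X chYX sWY; apply/negP=> phiYX.
  have [V [U [chVU sWV _ _ dvdUV]]] := chief_factor_restrict sAG nsWG chYX sWY.
  by have /negP[] := noG V U chVU sWV; apply: phi_dvd dvdUV phiYX.
move/(IHn _ (inner_radical_normal phi G W)); apply: phi_length_leS.
exact: inner_radical_restrict phi_dvd mpG nsWG.
Qed.

End LowerBound.

Section UpperBound.

Variable gT : finGroupType.
Implicit Types A B D G H K N M R S T U X Y V W Z E C : {group gT}.

Lemma nonabelian_factor_inner (phi : pred nat) G A B V U :
    subnormal_hereditary phi -> mutually_permutable_product G A B ->
    chief_factor G V U -> phi #|U : V| -> ~~ solvable (U / V) ->
  inner_radical phi A (A :&: V)%G \subset A :&: inner_on G U V.
Proof.
move=> herphi mpG chUV phiUV nsolUV.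
have [nsVG nsUG _ _] := chief_factorP _ _ _ chUV.
have sAG := mutually_permutable_subl mpG.
have nVA := subset_trans sAG (normal_norm nsVG).
rewrite subsetI inner_radical_sub; apply: quotient_sub_inner_on => //.
  exact: subset_trans (inner_radical_sub _ _ _) sAG.
apply: subset_trans (quotient_inner_radical phi nVA (subxx _)) _.
apply: (minnormal_nonabelian_inner herphi (mutually_permutable_quotient mpG nsVG)) => //.
- exact: chief_factor_minnormal chUV.
- by rewrite quotientS ?(normal_sub nsUG).
rewrite card_quotient //.
exact: subset_trans (normal_sub nsUG) (normal_norm nsVG).
Qed.

Lemma stable_inner_radical (phi : pred nat) A N :
    abelian N -> (forall n, phi n) -> forall X Y,
    chief_factor A Y X -> X \subset N -> [~: inner_radical phi A 1, X] \subset Y.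
Proof.
move=> abN allphi X Y chYX sXN; have [nsYA nsXA _ _] := chief_factorP _ _ _ chYX.
rewrite -(sub_factor_cent nsYA nsXA) ?inner_radical_sub //.
apply: subset_trans (inner_radical_inner chYX (sub1G _) (allphi _)) _.
apply: abelian_inner_on => //; rewrite quotient_abelian //.
exact: abelianS sXN abN.
Qed.

End UpperBound.

Lemma nilpotent_quotient_sub (gT : finGroupType) (G H K : {group gT}) :
  H <| G -> K <| G -> H \subset K -> nilpotent (G / H) -> nilpotent (G / K).
Proof.
move=> nsHG nsKG sHK nilGH.
by rewrite -(isog_nil (third_isog sHK nsHG nsKG)) quotient_nil.
Qed.

Section HeightBound.

Variable gT : finGroupType.
Implicit Types A B D G H K N M R S T U X Y V W Z E C : {group gT}.

Lemma abelian_factor_commutator G A B V U :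
    mutually_permutable_product G A B -> chief_factor G V U ->
    solvable (U / V) ->
  [~: inner_radical predT A (A :&: V)%G, A] \subset inner_on G U V.
Proof.
move=> mpG chUV solUV; have [nsVG nsUG _ _] := chief_factorP _ _ _ chUV.
have sAG := mutually_permutable_subl mpG.
have nVA := subset_trans sAG (normal_norm nsVG).
set R := inner_radical _ _ _; have nsRA : R <| A := inner_radical_normal _ _ _.
have nVR := subset_trans (normal_sub nsRA) nVA.
have minUV := chief_factor_minnormal chUV.
have [_ _ /is_abelemP[_ _ /abelem_abelian abUV]] :=
  minnormal_solvable minUV (subxx _) solUV.
apply: quotient_sub_inner_on => //.
  apply: subset_trans sAG.
  by rewrite commg_subr (subset_trans (normal_sub nsRA)) ?normG.
apply: subset_trans (mulG_subr _ _); rewrite /= quotientR //.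
have sUVG : U / V \subset G / V := quotientS V (normal_sub nsUG).
apply: (minnormal_abelian_commutator (mutually_permutable_quotient mpG nsVG)
          minUV sUVG solUV (quotient_normal V nsRA)) => X Y chYX sXU.
have sR1 := quotient_inner_radical predT nVA (subxx (A :&: V)).
apply: subset_trans (commSg _ sR1) _.
exact: (stable_inner_radical abUV (fun=> isT) chYX (subset_trans sXU (subsetIr _ _))).
Qed.

Lemma no_factor_sub D X : X <| D -> no_phi_factor predT D X -> D \subset X.
Proof.
move=> nsXD noX; apply: contraT => nsDX.
have prXD : X \proper D by rewrite properE normal_sub.
have [U chXU _] := chief_factor_between nsXD (normal_refl D) prXD.
by have := noX X U chXU (subxx X).
Qed.

(** Chief factors of a nilpotent group are central, so every element is inner on them. *)
Lemma phi_length_le_nilpotent phi G W :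
  W <| G -> nilpotent (G / W) -> phi_length_le phi 1 G W.
Proof.
move=> nsWG nilGW; apply: phi_length_le_inner => V U chUV sWV _.
have [nsVG nsUG _ _] := chief_factorP _ _ _ chUV.
have nilGV := nilpotent_quotient_sub nsWG nsVG sWV nilGW.
have minUV := chief_factor_minnormal chUV.
have [/andP[ntUV _] minUV'] := mingroupP minUV.
have nsUV : U / V <| G / V by apply: quotient_normal.
have sUZ : U / V \subset 'Z(G / V).
  apply/setIidPl; apply: minUV'; rewrite ?subsetIl //.
  by rewrite meet_center_nil //= normsI ?normal_norm ?center_normal.
suffices -> : inner_on G U V = G by apply: phi_length_le_self.
apply/val_inj/eqP; rewrite eqEsubset normal_sub ?inner_on_normal //=.
apply: sub_cent_inner_on => //; rewrite -quotient_cents2 ?(normal_norm nsVG) //.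
  by rewrite centsC (subset_trans sUZ) ?subsetIr.
exact: subset_trans (normal_sub nsUG) (normal_norm nsVG).
Qed.

(** With [H = A :&: inner_on G U V], the group RH / H is central in A / H. By
    [inner_radical_central] replacing RH by H does not shrink the next radical, which is why the
    length has the form m + 1. *)
Lemma phi_length_le_central_quotient m G A B V U :
    mutually_permutable_product G A B -> chief_factor G V U -> solvable (U / V) ->
    phi_length_le predT m.+1 A (inner_radical predT A (A :&: V)%G) ->
  phi_length_le predT m.+1 A (A :&: inner_on G U V)%G.
Proof.
move=> mpG chUV solUV leA; have [nsVG nsUG _ _] := chief_factorP _ _ _ chUV.
have sAG := mutually_permutable_subl mpG.
have nsI := inner_on_normal nsVG nsUG.
have comA := abelian_factor_commutator mpG chUV solUV.
set R := inner_radical _ _ _ in leA comA; pose H := (A :&: inner_on G U V)%G.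
have nsRA : R <| A := inner_radical_normal _ _ _.
have nsHA : H <| A := normalGI sAG nsI.
have nsEA : R <*> H <| A by apply: normalY.
have sRAH : [~: R <*> H, A] \subset H.
  have nHR := subset_trans (normal_sub nsRA) (normal_norm nsHA).
  have nHE := subset_trans (normal_sub nsEA) (normal_norm nsHA).
  rewrite -quotient_cents2 ?(normal_norm nsHA) // quotientYidr //.
  rewrite quotient_cents2 ?(normal_norm nsHA) // subsetI comA andbT.
  by rewrite commg_subr (subset_trans (normal_sub nsRA)) ?normG.
apply: phi_length_leS (inner_radical_central predT nsEA sRAH) _.
exact: (phi_length_leS (joing_subl R H) leA).
Qed.

Lemma solvable_factor_nilpotent G A B V U :
    mutually_permutable_product G A B -> chief_factor G V U -> solvable (U / V) ->
    A \subset inner_radical predT A (A :&: V)%G ->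
    B \subset inner_radical predT B (B :&: V)%G ->
  nilpotent (G / inner_on G U V).
Proof.
move=> mpG chUV solUV sAR sBR; have [nsVG nsUG prVU _] := chief_factorP _ _ _ chUV.
have minUV := chief_factor_minnormal chUV.
have [_ _ /is_abelemP[_ _ /abelem_abelian abUV]] :=
  minnormal_solvable minUV (subxx _) solUV.
have nsI := inner_on_normal nsVG nsUG.
have sVI : V \subset inner_on G U V.
  exact: subset_trans (proper_sub prVU) (sub_inner_on G U V).
have sUVG : U / V \subset G / V := quotientS V (normal_sub nsUG).
have stab D : D \subset G -> D \subset inner_radical predT D (D :&: V)%G ->
    forall X Y : {group coset_of V}, chief_factor (D / V) Y X ->
    X \subset (D / V) :&: (U / V) ->
    [~: D / V, X] \subset Y.
  move=> sDG sDR X Y chYX sXU.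
  have nVD := subset_trans sDG (normal_norm nsVG).
  have sR1 := quotient_inner_radical predT nVD (subxx (D :&: V)).
  apply: subset_trans (commSg _ (subset_trans (quotientS V sDR) sR1)) _.
  exact: (stable_inner_radical abUV (fun=> isT) chYX (subset_trans sXU (subsetIr _ _))).
have nilQ := minnormal_nilpotent_quotient (mutually_permutable_quotient mpG nsVG)
  minUV sUVG solUV (stab A (mutually_permutable_subl mpG) sAR)
  (stab B (mutually_permutable_subr mpG) sBR).
rewrite -(isog_nil (third_isog sVI nsVG nsI)).
have nsUVG : U / V <| G / V := quotient_normal V nsUG.
have nsC : 'C_(G / V)(U / V) <| G / V.
  by rewrite /normal subsetIl normsI ?normG ?norms_cent ?(normal_norm nsUVG).
have sCI : 'C_(G / V)(U / V) \subset inner_on G U V / V.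
  have [D defC _ nsDG] := inv_quotientN nsVG nsC.
  have {}defC : 'C_(G / V)(U / V) = D / V := defC.
  rewrite defC quotientS // (quotient_sub_inner_on nsVG nsUG) ?(normal_sub nsDG) //.
  by apply: subset_trans (mulG_subr _ _); rewrite -defC subsetIr.
exact: (nilpotent_quotient_sub nsC (quotient_normal V nsI) sCI nilQ).
Qed.

Theorem phi_length_le_product_succ m G A B W :
    mutually_permutable_product G A B -> W <| G ->
    phi_length_le predT m A (A :&: W)%G -> phi_length_le predT m B (B :&: W)%G ->
  phi_length_le predT m.+1 G W.
Proof.
move=> mpG; have [defG _ _] := mpG; have mpG' := mutually_permutable_sym mpG.
have sAG := mutually_permutable_subl mpG.
have sBG := mutually_permutable_subr mpG.
elim: m W => [|m IHm] W nsWG leA leB.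
  have full D : D \subset G -> phi_length_le predT 0 D (D :&: W)%G -> D \subset W.
    move=> sDG leD; have nsDW : D :&: W <| D := normalGI sDG nsWG.
    exact: subset_trans (no_factor_sub nsDW leD) (subsetIr _ _).
  apply: (@phi_length_leS _ _ _ _ G); last exact: phi_length_le_self.
  by rewrite {1}defG mul_subG ?full.
apply: phi_length_le_inner => V U chUV sWV _.
have [nsVG nsUG _ _] := chief_factorP _ _ _ chUV.
have nsI := inner_on_normal nsVG nsUG.
have leA1 : phi_length_le predT m A (inner_radical predT A (A :&: V)%G).
  have le0 : phi_length_le predT m A (inner_radical predT A (A :&: W)%G) := leA.
  by apply: (phi_length_leS _ le0); apply: inner_radicalS; apply: setIS.
have leB1 : phi_length_le predT m B (inner_radical predT B (B :&: V)%G).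
  have le0 : phi_length_le predT m B (inner_radical predT B (B :&: W)%G) := leB.
  by apply: (phi_length_leS _ le0); apply: inner_radicalS; apply: setIS.
have [solUV | nsolUV] := boolP (solvable (U / V)); last first.
  have herT : subnormal_hereditary predT by [].
  apply: IHm => //.
    exact: phi_length_leS (nonabelian_factor_inner herT mpG chUV _ nsolUV) leA1.
  exact: phi_length_leS (nonabelian_factor_inner herT mpG' chUV _ nsolUV) leB1.
(* With a further step left, the next radical absorbs the central enlargement. With none, [leA1] and
   [leB1] say that A and B are their own radicals, and the spare unit pays for the nilpotent
   quotient of G by [inner_on G U V]. *)
case: m => [|m] in IHm leA leB leA1 leB1 *; last first.
  apply: IHm => //.
    exact: phi_length_le_central_quotient mpG chUV solUV leA1.
  exact: phi_length_le_central_quotient mpG' chUV solUV leB1.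
apply: phi_length_le_nilpotent => //.
apply: (solvable_factor_nilpotent mpG chUV solUV).
  exact: no_factor_sub (inner_radical_normal _ _ _) leA1.
exact: no_factor_sub (inner_radical_normal _ _ _) leB1.
Qed.

Theorem phi_length_le_product (phi : pred nat) m G A B W :
    subnormal_hereditary phi ->
    (forall (rT : finGroupType) (K N : {group rT}),
       minnormal N K -> phi #|N| -> ~~ solvable N) ->
    mutually_permutable_product G A B -> W <| G ->
    phi_length_le phi m A (A :&: W)%G -> phi_length_le phi m B (B :&: W)%G ->
  phi_length_le phi m G W.
Proof.
move=> herphi nsolphi mpG; have mpG' := mutually_permutable_sym mpG.
elim: m W => [|m IHm] W nsWG leA leB.
  move=> V U chUV sWV; apply/negP=> phiUV.
  have [nsVG nsUG prVU _] := chief_factorP _ _ _ chUV.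
  have nVU := subset_trans (normal_sub nsUG) (normal_norm nsVG).
  have minUV := chief_factor_minnormal chUV.
  have sUVG : U / V \subset G / V := quotientS V (normal_sub nsUG).
  have phiN : phi #|U / V| by rewrite card_quotient.
  have nsolN := nsolphi _ _ _ minUV phiN.
  (* A minimal normal subgroup of D / V inside the intersection would pull back to a chief factor of
     D in the class. So both intersections are trivial, although U / V is their product. *)
  have noD D E : mutually_permutable_product G D E ->
      phi_length_le phi 0 D (D :&: W)%G -> (D / V) :&: (U / V) = 1.
    move=> mpD leD; have sDG := mutually_permutable_subl mpD.
    have nVD := subset_trans sDG (normal_norm nsVG).
    have [nsD1 _ _ _] := minnormal_nonabelian_product
      (mutually_permutable_quotient mpD nsVG) minUV sUVG nsolN.
    apply/eqP/negPn/negP => ntD1.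
    have nsD1D : (D / V) :&: (U / V) <| D / V.
      by apply: normalGI (quotientS V sDG) _; apply: quotient_normal.
    have [M minM sMD1] := minnormal_exists ntD1 (normal_norm nsD1D).
    have [/andP[ntM nMD] _] := mingroupP minM.
    have nsMD1 : M <| (D / V) :&: (U / V).
      by rewrite /normal sMD1 (subset_trans (subsetIl _ _) nMD).
    have phiM := herphi _ _ _ _ _ minUV phiN nsD1 nsMD1 ntM.
    have chM := minnormal_chief_factor minM (subset_trans sMD1 (subsetIl _ _)).
    have [Y [X [chYX _ _ sVY eqi]]] := chief_factor_cosetpre nVD chM.
    have /negP[] := leD Y X chYX (subset_trans (setIS D sWV) sVY).
    by rewrite eqi indexg1.
  have [_ _ defN _] := minnormal_nonabelian_product
      (mutually_permutable_quotient mpG nsVG) minUV sUVG nsolN.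
  have [/andP[/eqP[] //]] := mingroupP minUV.
  by rewrite defN (noD A B mpG leA) (noD B A mpG' leB) mulg1.
apply: phi_length_le_inner => V U chUV sWV phiUV.
have [nsVG nsUG prVU _] := chief_factorP _ _ _ chUV.
have nVU := subset_trans (normal_sub nsUG) (normal_norm nsVG).
have minUV := chief_factor_minnormal chUV.
have nsolUV : ~~ solvable (U / V) by apply: nsolphi minUV _; rewrite card_quotient.
have nsI := inner_on_normal nsVG nsUG.
apply: IHm => //.
  apply: phi_length_leS (nonabelian_factor_inner herphi mpG chUV phiUV nsolUV) _.
  have le0 : phi_length_le phi m A (inner_radical phi A (A :&: W)%G) := leA.
  by apply: (phi_length_leS _ le0); apply: inner_radicalS; apply: setIS.
apply: phi_length_leS (nonabelian_factor_inner herphi mpG' chUV phiUV nsolUV) _.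
have le0 : phi_length_le phi m B (inner_radical phi B (B :&: W)%G) := leB.
  by apply: (phi_length_leS _ le0); apply: inner_radicalS; apply: setIS.
Qed.

End HeightBound.

(** * The generalized Fitting series *)

Section Components.

Variable gT : finGroupType.
Implicit Types A B D G H K L N M R S T U X Y V W Z E C : {group gT}.

Lemma quasisimple_normal K N :
  quasisimple K -> N <| K -> N :=: K \/ N \subset 'Z(K).
Proof.
case/andP=> /eqP perfK /simpleP[ntKZ maxKZ] nsNK.
have nsZ := center_normal K; have nZK := normal_norm nsZ.
have nZN := subset_trans (normal_sub nsNK) nZK.
have [|NZ1|NZK] := maxKZ (N / 'Z(K))%G; first exact: quotient_normal.
  by right; rewrite -quotient_sub1 // -NZ1 subxx.
left; apply/eqP; rewrite eqEsubset normal_sub //=.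
have sKNZ : K \subset 'Z(K) * N.
  by have {}NZK : N / 'Z(K) = K / 'Z(K) := NZK; rewrite -quotientSK // NZK.
rewrite -{1}perfK; apply: der1_min; first exact: normal_norm.
apply: (@abelianS _ _ (('Z(K) / N)%G)); last by rewrite quotient_abelian ?center_abelian.
have nNZ : 'Z(K) \subset 'N(N) := subset_trans (center_sub K) (normal_norm nsNK).
apply: subset_trans (quotientS N sKNZ) _.
by rewrite quotientMl // trivg_quotient mulg1.
Qed.

(** Induction along a subnormal chain: if K centralises [N :&: M] for a proper normal M above K,
    then [K, N] lies in [N :&: M], so [K, N, K] = 1, and the three subgroups lemma applies as K is
    perfect. *)
Lemma component_cent_normal K G N :
  component K G -> N <| G -> K \subset N \/ K \subset 'C(N).
Proof.
case/andP=> snKG qsK; have [n] := ubnP #|G|.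
elim: n G N snKG => // n IHn G N snKG; rewrite ltnS => leGn nsNG.
have [eqKG | [M [snKM nsMG prMG]]] := subnormalEr snKG.
  rewrite -eqKG in nsNG; have [-> | sNZ] := quasisimple_normal qsK nsNG.
    by left.
  by right; rewrite centsC (subset_trans sNZ) ?subsetIr.
have sMG := normal_sub nsMG.
have nsNM : N :&: M <| M by rewrite setIC; apply: normalGI nsNG.
have [||cKNM] := IHn M (N :&: M)%G snKM _ nsNM.
- exact: leq_trans (proper_card prMG) leGn.
- by rewrite subsetI => /andP[]; left.
right; have sKM := subnormal_sub snKM.
have sR : [~: K, N] \subset N :&: M.
  rewrite subsetI commg_subr (subset_trans (subset_trans sKM sMG) (normal_norm nsNG)) /=.
  apply: subset_trans (commSg _ sKM) _; rewrite commg_subl.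
  exact: subset_trans (normal_sub nsNG) (normal_norm nsMG).
have R1 : [~: K, N, K] = 1.
  by apply/commG1P; rewrite (subset_trans sR) // centsC.
have R2 : [~: N, K, K] = 1 by rewrite (commGC N).
have := three_subgroup R1 R2; have /andP[/eqP perfK _] := qsK.
rewrite -derg1 perfK => /commG1P; exact.
Qed.

(** A component lies in U or centralises it, and the Fitting subgroup centralises every chief
    factor. *)
Lemma genFitting_sub_inner_radical G :
  genFitting G \subset inner_radical predT G 1.
Proof.
have sFG := normal_sub (genFitting_normal G).
apply/sub_inner_radicalP=> // V U chUV _ _.
have [nsVG nsUG _ _] := chief_factorP _ _ _ chUV.
rewrite join_subG; apply/andP; split; last first.
  rewrite gen_subG; apply/bigcupsP=> K cK.
  have sKG : K \subset G by case/andP: cK => /subnormal_sub.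
  have [sKU | cKU] := component_cent_normal cK nsUG.
    exact: subset_trans sKU (sub_inner_on G U V).
  by apply: sub_cent_inner_on => //; move/commG1P: cKU => ->; apply: sub1G.
have minUV := chief_factor_minnormal chUV.
have [/andP[ntUV _] minUV'] := mingroupP minUV.
apply: (quotient_sub_inner_on nsVG nsUG (Fitting_sub G)).
apply: subset_trans (mulG_subr _ _).
pose F := ('F(G) / V)%G.
have nsF : F <| G / V by rewrite quotient_normal ?Fitting_normal.
have nsUb : U / V <| G / V by apply: quotient_normal.
have nilF : nilpotent F by rewrite quotient_nil ?Fitting_nil.
have [tiFU | ntFU] := eqVneq (U / V :&: F) 1.
  have nUF := subset_trans (normal_sub nsF) (normal_norm nsUb).
  have nFU := subset_trans (normal_sub nsUb) (normal_norm nsF).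
  by apply/commG1P/trivgP; rewrite -tiFU setIC commg_subI // subsetI subxx.
have sUF : U / V \subset F.
  apply/setIidPl/minUV'; rewrite ?subsetIl // ntFU /=.
  by rewrite normsI ?normal_norm.
have nsUF : U / V <| F := normalS sUF (normal_sub nsF) nsUb.
have sUZ : U / V \subset 'Z(F).
  apply/setIidPl/minUV'; rewrite ?subsetIl // meet_center_nil //=.
  rewrite normsI ?(normal_norm nsUb) //.
  exact: normal_norm (char_normal_trans (center_char F) nsF).
by rewrite centsC (subset_trans sUZ) ?subsetIr.
Qed.

Lemma genFittingS H G : H <| G -> genFitting H \subset genFitting G.
Proof.
move=> nsHG; rewrite join_subG; apply/andP; split.
  apply: subset_trans (joing_subl _ _); apply: Fitting_max; last exact: Fitting_nil.
  exact: char_normal_trans (Fitting_char H) nsHG.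
apply: subset_trans (joing_subr _ _); rewrite gen_subG.
apply/bigcupsP=> K /andP[snKH qsK]; apply: sub_gen; apply: bigcup_max (subxx K).
by rewrite /component qsK (subnormal_trans snKH) ?normal_subnormal.
Qed.

Lemma simple_quasisimple K : simple K -> ~~ abelian K -> quasisimple K.
Proof.
move=> simK nabK; have /simpleP[ntK maxK] := simK.
have Z1 : 'Z(K) = 1.
  have [|//|ZK] := maxK 'Z(K)%G; first exact: center_normal.
  by case/negP: nabK; rewrite /abelian -{1}ZK subsetIr.
rewrite /quasisimple /= Z1 -(isog_simple (quotient1_isog K)) simK andbT.
have [|/commG1P abK|->] := maxK (K^`(1))%G; first exact: der_normal.
  by case/negP: nabK.
by [].
Qed.

Lemma nonabelian_simple_product_genFitting N :
  nonabelian_simple_product N -> N \subset genFitting N.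
Proof.
case/existsP=> S /and3P[_ /forall_inP simS /eqP defN].
apply: subset_trans (joing_subr _ _).
rewrite -{1}(bigdprodWY defN) gen_subG; apply/bigcupsP=> H SH.
have /andP[simH nabH] := simS H SH.
apply: sub_gen; apply: bigcup_max (subxx H).
rewrite /component simple_quasisimple // andbT normal_subnormal //.
by move: defN; rewrite (bigD1 H) //= => /dprod_normal2[].
Qed.

End Components.

(** * The generalized Fitting subgroup and central quotients *)

Section CentralExtension.

Variable gT : finGroupType.
Implicit Types A B D G H K L N M R S T U X Y V W Z E C : {group gT}.

(** D = N D'' with N central, so D / D'' is abelian and D' is perfect. If W / N is the centre of D /
    N, then [W, D, D] = 1, and the three subgroups lemma shows that D' centralises W; hence the
    centre of D' is [W :&: D']. *)
Lemma quasisimple_central_lift D N :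
    N <| D -> N \subset 'Z(D) -> quasisimple (D / N) ->
  quasisimple D^`(1) /\ D / N = D^`(1) / N.
Proof.
move=> nsND sNZ /andP[/eqP perfDN simDN].
have nND := normal_norm nsND; pose K := (D^`(1))%G.
have nsKD : K <| D := der_normal 1 D.
have nNK := subset_trans (normal_sub nsKD) nND.
have qK : D / N = K / N by rewrite /K /= quotient_der // perfDN.
split=> //; apply/andP; split.
  have nsK'D : K^`(1) <| D := char_normal_trans (der_char 1 K) nsKD.
  rewrite eqEsubset der_sub /=; apply: der1_min; first exact: normal_norm.
  have sDNK' : D \subset N * K^`(1).
    by rewrite -quotientSK // quotient_der // -qK perfDN.
  have nK'N : N \subset 'N(K^`(1)).
    exact: subset_trans (normal_sub nsND) (normal_norm nsK'D).
  apply: abelianS (quotientS _ sDNK') _.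
  rewrite quotientMl // trivg_quotient mulg1 quotient_abelian //.
  exact: abelianS sNZ (center_abelian D).
have [W defW sNW nsWD] := inv_quotientN nsND (center_normal (D / N)).
have {}defW : 'Z(D / N) = W / N := defW.
have nNW := subset_trans (normal_sub nsWD) nND.
have cDN : N \subset 'C(D) by rewrite (subset_trans sNZ) ?subsetIr.
have sWDN : [~: W, D] \subset N.
  by rewrite -quotient_cents2 // -defW subsetIr.
have cKW : K \subset 'C(W).
  have R1 : [~: W, D, D] = 1 by apply/commG1P; apply: subset_trans sWDN cDN.
  have R2 : [~: D, W, D] = 1 by rewrite (commGC D).
  exact/commG1P/(three_subgroup R2 R1).
have ZK : 'Z(K) = W :&: K.
  apply/eqP; rewrite eqEsubset; apply/andP; split; last first.
    by rewrite subsetI subsetIr /= subIset // centsC cKW.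
  have sZD := subset_trans (center_sub K) (normal_sub nsKD).
  rewrite subsetI center_sub andbT -(quotientSGK (subset_trans sZD nND) sNW).
  rewrite -defW subsetI quotientS //= qK quotient_cents //.
  exact: subsetIr.
have nWK : K \subset 'N(W) := subset_trans (normal_sub nsKD) (normal_norm nsWD).
have isoKW : K / (W :&: K) \isog K / W := second_isog nWK.
have eqDK : D / W = K / W.
  apply/eqP; rewrite eqEsubset [K / W \subset _]quotientS ?(normal_sub nsKD) // andbT.
  rewrite quotientSK ?(normal_norm nsWD) //.
  have sDNK : D \subset N * K by rewrite -quotientSK // qK.
  exact: subset_trans sDNK (mulSg _ sNW).
have simDW : simple (D / W) by rewrite -(isog_simple (third_isog sNW nsND nsWD)) -defW.
have simKW : simple (K / W) by rewrite -eqDK.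
have simKZ : simple (K / (W :&: K)) by rewrite (isog_simple isoKW).
by rewrite -ZK in simKZ.
Qed.

Lemma genFitting_central_quotient X N :
  N <| X -> N \subset 'Z(X) -> genFitting (X / N) \subset genFitting X / N.
Proof.
move=> nsNX sNZ; have nNX := normal_norm nsNX.
rewrite join_subG; apply/andP; split.
  have [D defD sND nsDX] := inv_quotientN nsNX (Fitting_normal (X / N)).
  have {}defD : 'F(X / N) = D / N := defD.
  rewrite defD quotientS //; apply: subset_trans (joing_subl _ _).
  apply: Fitting_max => //.
  have sNZD : N \subset 'Z(D).
    rewrite subsetI sND (subset_trans sNZ) // (subset_trans (subsetIr _ _)) //.
    by rewrite centS ?(normal_sub nsDX).
  have nsND : N <| D := normalS sND (normal_sub nsDX) nsNX.
  rewrite -quotient_center_nil.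
  apply: (nilpotent_quotient_sub nsND (center_normal D) sNZD).
  by rewrite -defD Fitting_nil.
rewrite gen_subG; apply/bigcupsP=> Kb /andP[snKb qsKb].
have [D defD sND sDX] := inv_quotientS nsNX (subnormal_sub snKb).
have sNZD : N \subset 'Z(D).
  rewrite subsetI sND (subset_trans sNZ) // (subset_trans (subsetIr _ _)) //.
  by rewrite centS.
have nsND : N <| D := normalS sND sDX nsNX.
have eqDb : Kb = (D / N)%G by apply: val_inj.
rewrite eqDb in snKb qsKb *.
have [qsD' qD] := quasisimple_central_lift nsND sNZD qsKb.
rewrite /= qD quotientS // (subset_trans _ (joing_subr _ _)) //.
apply: sub_gen; apply: (bigcup_max (D^`(1))%G) => //; rewrite /component qsD' andbT.
apply: subnormal_trans (normal_subnormal (der_normal 1 D)) _.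
by rewrite -(quotientGK nsND); apply: cosetpre_subnormal.
Qed.

End CentralExtension.

(** X is kept apart from G so that the induction can pass to X / N and to ['C_X(N)] while the chief
    factors stay those of G or G / N. A minimal normal subgroup N of G inside X is central in X if
    it is abelian; otherwise X = N C with [C = 'C_X(N)]. *)
Lemma inner_radical_sub_genFitting (gT : finGroupType) (G X : {group gT}) :
  X <| G -> X \subset inner_radical predT G 1 -> X \subset genFitting X.
Proof.
have [n] := ubnP #|X|; elim: n => // n IHn in gT G X *; rewrite ltnS => leXn.
move=> nsXG sXR; have [X1 | ntX] := eqVneq (X : {set gT}) 1.
  by rewrite X1 sub1G.
have [N minN sNX] := minnormal_exists ntX (normal_norm nsXG).
have [/andP[ntN nNG] _] := mingroupP minN.
have sNG := subset_trans sNX (normal_sub nsXG).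
have nsNG : N <| G by apply/andP.
have nsNX : N <| X := normalS sNX (normal_sub nsXG) nsNG.
have chN := minnormal_chief_factor minN sNG.
have sXI : X \subset inner_on G N 1.
  by apply: subset_trans sXR _; apply: inner_radical_inner chN (sub1G _) _.
have [solN | nsolN] := boolP (solvable N).
  have [_ _ /is_abelemP[_ _ /abelem_abelian abN]] :=
    minnormal_solvable minN (subxx _) solN.
  have cNX : N \subset 'Z(X).
    rewrite subsetI sNX centsC (subset_trans sXI) //.
    apply: subset_trans (abelian_inner_on (normal1 G) nsNG _) _.
      by rewrite quotient_abelian.
    by rewrite (chief_factor1_cent nsNG) subsetIr.
  have nNX := normal_norm nsNX.
  have sNF : N \subset genFitting X.
    apply: subset_trans (joing_subl _ _).
    by rewrite Fitting_max ?abelian_nil.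
  rewrite -(quotientSGK nNX sNF).
  apply: subset_trans (genFitting_central_quotient nsNX cNX).
  apply: (IHn _ (G / N)%G).
  - exact: leq_trans (ltn_quotient ntN sNX) leXn.
  - exact: quotient_normal.
  apply: subset_trans (quotientS N sXR) _.
  by apply: quotient_inner_radical; rewrite ?sub1G.
pose C := ('C_X(N))%G.
have nsCG : C <| G.
  rewrite /normal subIset ?(normal_sub nsXG) //.
  by rewrite normsI ?norms_cent ?(normal_norm nsXG).
have nsCX : C <| X := normalS (subsetIl _ _) (normal_sub nsXG) nsCG.
have ltCX : #|C| < #|X|.
  apply: proper_card; rewrite properE subsetIl; apply: contra nsolN => sXC.
  apply: abelian_sol; rewrite /abelian (subset_trans sNX) //.
  by rewrite (subset_trans sXC) ?subsetIr.
have sCX : C \subset genFitting X.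
  apply: subset_trans (genFittingS nsCX).
  apply: (IHn _ G) => //; first exact: leq_trans ltCX leXn.
  exact: subset_trans (subsetIl _ _) sXR.
have sNFX : N \subset genFitting X.
  apply: subset_trans (genFittingS nsNX).
  exact: nonabelian_simple_product_genFitting (minnormal_nonsol_product minN nsolN).
have sXNC : X \subset N * C.
  rewrite -[X in N * X]/('C_X(N)) setIC group_modl // subsetI subxx andbT.
  apply: subset_trans sXI _; rewrite (inner_onE (normal1 G) nsNG).
  by rewrite (chief_factor1_cent nsNG) mulgS ?subsetIr.
by apply: subset_trans sXNC _; rewrite mul_subG.
Qed.

Section Height.

Variable gT : finGroupType.
Implicit Types G W : {group gT}.

Lemma inner_radical_genFitting G : inner_radical predT G 1 = genFitting G.
Proof.
apply/val_inj/eqP; rewrite eqEsubset genFitting_sub_inner_radical andbT.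
have nsR := inner_radical_normal predT G 1.
exact: subset_trans (inner_radical_sub_genFitting nsR (subxx _)) (genFittingS nsR).
Qed.

End Height.

Lemma genFitting_series_iter (gT : finGroupType) i (G : {group gT}) :
  genFitting_series i G = iter i (inner_radical predT G) 1%G.
Proof.
elim: i => // i IHi; rewrite iterS -IHi; apply: val_inj.
have := inner_radical_cosetpre predT (genFitting_series_normal i G).
by rewrite inner_radical_genFitting => defR; apply: esym defR.
Qed.

Lemma phi_length_le_iter (gT : finGroupType) (phi : pred nat) n (G W : {group gT}) :
  phi_length_le phi n G W <-> no_phi_factor phi G (iter n (inner_radical phi G) W).
Proof. by elim: n W => [|n IHn] W //; rewrite iterSr; apply: IHn. Qed.

Lemma generalized_fitting_heightP (gT : finGroupType) n (G : {group gT}) :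
  generalized_fitting_height G <= n <-> phi_length_le predT n G 1.
Proof.
have lengthE m : phi_length_le predT m G 1 <-> genFitting_series m G == G.
  split=> [/phi_length_le_iter | /eqP defG]; last first.
    apply/phi_length_le_iter; rewrite -genFitting_series_iter defG.
    exact: (@phi_length_le_self predT gT 0 G).
  rewrite -genFitting_series_iter => noF.
  have nsF := genFitting_series_normal m G.
  rewrite -val_eqE [val _]/(gval _) eqEsubset (normal_sub nsF).
  exact: no_factor_sub nsF noF.
rewrite /generalized_fitting_height; case: ex_minnP => h serh minh; split.
  by move=> le_hn; apply: phi_length_leW (sub1G G) le_hn _; apply/lengthE.
by move/lengthE/minh.
Qed.

(** * Non-p-soluble length *)

Definition mixed_order (p : nat) : pred nat :=
  [pred n | ~~ (p.-nat n || p^'.-nat n)].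

Lemma mixed_order_dvd p d n : d %| n -> mixed_order p d -> mixed_order p n.
Proof.
move=> dvd_dn; apply: contra => /orP[] pn; apply/orP; [left | right];
exact: pnat_dvd dvd_dn pn.
Qed.

(** A subnormal pi-subgroup of N lies in ['O_pi(N)], which is characteristic in N and so equals N by
    minimality. *)
Lemma mixed_order_hereditary p : subnormal_hereditary (mixed_order p).
Proof.
move=> rT G N H K minN phiN nsHN nsKH ntK; have [/andP[_ nNG] minN'] := mingroupP minN.
have piK (pi : nat_pred) : pi.-group K -> pi.-group N.
  move=> piK; have sKN : K \subset 'O_pi(N).
    apply: subset_trans (subnormal_pcore pi (normal_subnormal nsHN)).
    exact: pcore_max.
  have <- : 'O_pi(N) = N; last exact: pcore_pgroup.
  apply: minN'; last exact: pcore_sub.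
  rewrite (char_norm_trans (pcore_char pi N)) // andbT.
  by apply: contra ntK => /eqP O1; rewrite -subG1 -O1.
apply: contra phiN => /orP[] /piK piN; apply/orP; [left | right]; exact: piN.
Qed.

Lemma mixed_order_nonsolvable p (rT : finGroupType) (K N : {group rT}) :
  minnormal N K -> mixed_order p #|N| -> ~~ solvable N.
Proof.
move=> minN phiN; apply/negP=> solN; case/negP: phiN.
have [_ _ /is_abelemP[q _ /abelem_pgroup qN]] := minnormal_solvable minN (subxx _) solN.
have [<- | neqp] := eqVneq q p; apply/orP; first by left.
by right; apply: pi_pnat qN _; rewrite !inE.
Qed.

Section PSoluble.

Variables (p : nat) (gT : finGroupType).
Implicit Types G H K L M N Q T U V W X Y : {group gT}.
Notation phi := (mixed_order p).

Lemma no_phi_factor_quotient G W : W <| G ->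
  p_soluble p (G / W) <-> no_phi_factor phi G W.
Proof.
move=> nsWG; have nWG := normal_norm nsWG.
have indexE (rT : finGroupType) (A U V : {group rT}) : chief_factor A V U ->
    p.-group (U / V) || p^'.-group (U / V) = ~~ phi #|U : V|.
  case/chief_factorP=> nsVA nsUA _ _; rewrite negbK /pgroup card_quotient //.
  exact: subset_trans (normal_sub nsUA) (normal_norm nsVA).
split=> [/forallP psol V U chUV sWV | noW].
  have chb := chief_factor_quotient nsWG sWV chUV.
  have [_ nsUG /proper_sub sVU _] := chief_factorP _ _ _ chUV.
  have := implyP (forallP (psol (U / W)%G) (V / W)%G) chb.
  rewrite (indexE _ _ _ _ chb) /= index_quotient_eq //.
    by rewrite (subset_trans (subsetIr _ _)).
  exact: subset_trans (normal_sub nsUG) nWG.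
apply/forallP=> Ub; apply/forallP=> Vb; apply/implyP=> chb.
have [V [U [chUV _ _ sWV eqi]]] := chief_factor_cosetpre nWG chb.
rewrite (indexE _ _ _ _ chb) -eqi; apply: noW chUV _.
by rewrite (subset_trans _ sWV) // subsetI normal_sub /=.
Qed.

(** An L-chief factor X / V inside U / V has order outside the class; by heredity so has U / V, a
    minimal normal subgroup of G / V. *)
Lemma no_phi_factor_normal G L K V U :
    L <| G -> no_phi_factor phi L K -> chief_factor G V U ->
    K \subset V -> U \subset L -> ~~ phi #|U : V|.
Proof.
move=> nsLG noL chUV sKV sUL; have [nsVG nsUG prVU _] := chief_factorP _ _ _ chUV.
have sVU := proper_sub prVU; have sLG := normal_sub nsLG.
have nsVL : V <| L := normalS (subset_trans sVU sUL) sLG nsVG.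
have nsUL : U <| L := normalS sUL sLG nsUG.
have [X chVX sXU] := chief_factor_between nsVL nsUL prVU.
have [_ nsXL prVX _] := chief_factorP _ _ _ chVX.
have nVU := subset_trans (normal_sub nsUG) (normal_norm nsVG).
have nVX := subset_trans sXU nVU.
apply: contra (noL V X chVX sKV) => phiUV.
rewrite -card_quotient // in phiUV; rewrite -card_quotient //.
apply: (@mixed_order_hereditary p _ (G / V)%G (U / V)%G (U / V)%G (X / V)%G) => //.
- exact: chief_factor_minnormal chUV.
- by rewrite quotient_normal // (normalS sXU (normal_sub nsUL)).
by rewrite -subG1 quotient_sub1 ?proper_subn.
Qed.

Lemma no_phi_factor_ext T K W :
    K <| T -> W \subset K -> no_phi_factor phi K W -> no_phi_factor phi T K ->
  no_phi_factor phi T W.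
Proof.
move=> nsKT sWK noK noT V U chUV sWV.
have [sUVK | nsUVK] := boolP (U \subset V * K).
  have [ch1 _ <-] := chief_factor_meet chUV nsKT sUVK.
  apply: (no_phi_factor_normal nsKT noK ch1 _ (subsetIr _ _)).
  by rewrite subsetI sWV.
have [ch1 _ <-] := chief_factor_join chUV nsKT nsUVK.
by apply: noT ch1 _; apply: joing_subr.
Qed.

(** L cannot cover a factor of the class, so the factor moves above L. If M avoids it there, it
    moves above M and M is trivially inner on it; otherwise it moves inside M, where the image of
    its top is a direct factor of M / L. *)
Lemma nonabelian_simple_product_inner G K L M :
    L <| G -> M <| G -> L \subset M -> K \subset L ->
    no_phi_factor phi L K -> nonabelian_simple_product (M / L) ->
  M \subset inner_radical phi G K.
Proof.
move=> nsLG nsMG sLM sKL noL nspML.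
apply/sub_inner_radicalP=> [|V U chUV sKV phiUV]; first exact: normal_sub.
have [sUVL | nsUVL] := boolP (U \subset V * L).
  have [ch1 _ eqi] := chief_factor_meet chUV nsLG sUVL.
  have := no_phi_factor_normal nsLG noL ch1; rewrite eqi phiUV => noUV.
  by have := noUV _ (subsetIr _ _); rewrite subsetI sKV => /(_ sKL).
have [ch1 sI1 _] := chief_factor_join chUV nsLG nsUVL.
apply: subset_trans sI1.
have sLV1 : L \subset V <*> L := joing_subr V L.
pose V1 := (V <*> L)%G; pose U1 := (U <*> L)%G.
have {}ch1 : chief_factor G V1 U1 := ch1.
rewrite -/V1 -/U1.
have [sUVM | nsUVM] := boolP (U1 \subset V1 * M); last first.
  have [ch2 sI2 _] := chief_factor_join ch1 nsMG nsUVM.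
  exact: subset_trans (subset_trans (joing_subr U1 M) (sub_inner_on _ _ _)) sI2.
have [ch2 sI2 _] := chief_factor_meet ch1 nsMG sUVM.
apply: subset_trans sI2; have [nsV2 nsU2 _ _] := chief_factorP _ _ _ ch2.
have sLV2 : L \subset V1 :&: M by rewrite subsetI sLV1.
have sU2M : U1 :&: M \subset M := subsetIr _ _.
have nsU2M : U1 :&: M <| M := normalS sU2M (normal_sub nsMG) nsU2.
have crML := nonabelian_simple_product_cr nspML.
have [_ defML _ _] := dprodP (crML _ (quotient_normal L nsU2M)).
have sMI : M \subset inner_on G (U1 :&: M)%G L.
  apply: (quotient_sub_inner_on nsLG nsU2 (normal_sub nsMG)).
  by rewrite -defML mulgS ?subsetIr.
apply: subset_trans sMI _; rewrite join_subG sub_inner_on.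
apply: sub_cent_inner_on => //; first exact: subsetIl.
apply: subset_trans sLV2.
by rewrite -(sub_factor_cent nsLG nsU2) ?subsetIl.
Qed.

Lemma lambda_series_phi_length G h (s : h.*2.+2.-tuple {group gT}) :
  lambda_series p G s -> phi_length_le phi h G 1.
Proof.
case/and4P=> /eqP s0 /eqP sG /forallP nsG /forallP stepG.
pose f i := nth 1%G s i.
have ns i : i < h.*2.+2 -> f i <| G.
  by move=> lt_i; apply: (nsG (Ordinal lt_i)).
have step i : i < h.*2.+1 -> f i \subset f i.+1 /\
    if odd i then nonabelian_simple_product (f i.+1 / f i)
    else p_soluble p (f i.+1 / f i).
  by move=> lt_i; have /andP[] := stepG (Ordinal lt_i).
have noF j : j <= h -> no_phi_factor phi (f j.*2.+1) (f j.*2).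
  move=> le_jh; have lt_j : j.*2 < h.*2.+1 by rewrite ltnS leq_double.
  have [sf] := step j.*2 lt_j; rewrite odd_double => psol.
  apply/no_phi_factor_quotient => //.
  by apply: normalS sf (normal_sub (ns _ _)) (ns _ _); rewrite // ltnW.
(* Even indices are the bottoms of the p-soluble layers, so one radical step covers a p-soluble
   layer together with the product of simple groups above it. *)
have sub j : j <= h -> f j.*2 \subset iter j (inner_radical phi G) 1%G.
  elim: j => [|j IHj] lt_jh; first by rewrite /f s0 /= sub1G.
  have le_jh := ltnW lt_jh.
  rewrite iterS; apply: subset_trans (inner_radicalS phi G (IHj le_jh)).
  have lt1 : j.*2.+1 < h.*2.+1 by rewrite ltnS ltn_double.
  have [sf1 nsp] := step _ lt1; rewrite /= odd_double /= in nsp.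
  have [sf0 _] := step j.*2 (ltnW lt1).
  rewrite doubleS; apply: nonabelian_simple_product_inner sf1 sf0 (noF j le_jh) nsp.
    by apply: ns; rewrite ltnW.
  exact: ns.
apply/phi_length_le_iter; have := noF h (leqnn h).
rewrite {1}/f sG => noG V U chUV sV; apply: noG chUV _.
exact: subset_trans (sub h (leqnn h)) sV.
Qed.

Lemma nonabelian_simple_product_join T M :
    nonabelian_simple_product T -> nonabelian_simple_product M ->
    M \subset 'C(T) -> T :&: M = 1 -> nonabelian_simple_product (T <*> M).
Proof.
case/existsP=> S1 /and3P[ntS1 /forall_inP simS1 /eqP defT].
case/existsP=> S2 /and3P[ntS2 /forall_inP simS2 /eqP defM] cTM tiTM.
have subS (S : {set {group gT}}) L H :
    \big[dprod/1]_(K in S) K = gval L -> H \in S -> H \subset L.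
  by move=> defL SH; rewrite -(bigdprodWY defL) sub_gen // (bigcup_max H).
have tiS : [disjoint S2 & S1].
  apply/pred0P=> H /=; apply/negP=> /andP[S2H S1H].
  have /andP[/simpleP[ntH _] _] := simS1 H S1H.
  case/eqP: ntH; apply/trivgP; rewrite -tiTM subsetI.
  by rewrite (subS S1) ?(subS S2).
apply/existsP; exists (S1 :|: S2); apply/and3P; split.
- by apply: contra ntS1; rewrite setU_eq0 => /andP[].
- by apply/forall_inP=> H /setUP[/simS1 | /simS2].
rewrite (big_setID S1) setUK setDUl setDv set0U (setDidPl tiS) /= defT defM.
by rewrite dprodEY.
Qed.

(** Q is filled up as in [inner_radical_cr], but now the splitting [Q = T * 'C_Q(T)] comes from the
    inner action on T, since Q is not yet known to be completely reducible. *)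
Lemma inner_radical_simple_product X Q :
    (forall M, minnormal M X -> M \subset X -> phi #|M|) ->
    Q <| X -> Q :!=: 1 -> Q \subset inner_radical phi X 1 ->
  nonabelian_simple_product Q.
Proof.
move=> phiM nsQX ntQ sQR.
have sQX := normal_sub nsQX.
(* The start T = 1 needs its own alternative, as [nonabelian_simple_product] excludes the empty
   product. *)
suffices step n T : #|Q| - #|T| < n -> T <| X -> T \subset Q ->
    (T :==: 1) || nonabelian_simple_product T -> Q \subset T * 'C_X(T) ->
    nonabelian_simple_product Q.
  apply: (step _ 1%G (leqnn _)); rewrite ?normal1 ?sub1G ?eqxx //.
  by rewrite cent1T setIT mul1g.
elim: n T => // n IHn T; rewrite ltnS => leTn nsTX sTQ nspT sQTC.
have [eqTQ | neTQ] := eqVneq T Q.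
  by move: nspT; rewrite eqTQ (negPf ntQ).
have ntC : 'C_Q(T) != 1.
  apply: contra neTQ => /eqP C1; rewrite -val_eqE eqEsubset sTQ /=.
  have := group_modl 'C_X(T) sTQ.
  rewrite setIAC (setIidPr sQX) C1 mulg1 => ->.
  by rewrite subsetI sQTC subxx.
have nCX : X \subset 'N('C_Q(T)).
  by rewrite normsI ?norms_cent ?(normal_norm nsQX) ?(normal_norm nsTX).
have [M minM sMC] := minnormal_exists ntC nCX.
have [/andP[ntM nMX] _] := mingroupP minM.
have [sMQ cMT] := subsetIP sMC; have sMX := subset_trans sMQ sQX.
have nsMX : M <| X by apply/andP.
have chM := minnormal_chief_factor minM sMX.
have phi_M := phiM M minM sMX.
have nsolM := mixed_order_nonsolvable minM phi_M.
have sQM : Q \subset M * 'C_X(M).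
  rewrite -(chief_factor1_cent nsMX) -(inner_onE (normal1 X) nsMX).
  apply: subset_trans sQR _.
  by apply: inner_radical_inner => //; rewrite indexg1.
have nspM := minnormal_nonsol_product minM nsolM.
have tiTM : T :&: M = 1.
  case/orP: nspT => [/eqP-> | /nonabelian_simple_product_cr crT].
    exact: setI1g.
  have [_ _ _ tiTC] := dprodP (crT T (normal_refl T)).
  apply/trivgP; rewrite -tiTC subsetI subsetIl subsetI subsetIl.
  by rewrite (subset_trans (subsetIr _ _)).
apply: (IHn (T <*> M)%G).
- apply: leq_trans leTn; apply: ltn_sub2l.
    by apply: proper_card; rewrite properEneq neTQ.
  apply: proper_card; rewrite properE joing_subl /= join_subG subxx /=.
  by apply: contra ntM => sMT; rewrite -subG1 -tiTM subsetI sMT subxx.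
- exact: normalY.
- by rewrite join_subG sTQ.
- apply/orP; right; case/orP: nspT => [/eqP T1 | nspT].
    have -> : (T <*> M)%G = M by apply: val_inj; rewrite /= T1 joing1G.
    exact: nspM.
  exact: nonabelian_simple_product_join.
exact: inner_join sQX nsTX nsMX cMT sQTC sQM.
Qed.

End PSoluble.

Section LambdaSeries.

Variables (p : nat) (gT : finGroupType).
Implicit Types G H K L M N Q T U V W X Y : {group gT}.
Notation phi := (mixed_order p).

(** K is a maximal normal subgroup of G with K / W p-soluble. If the radical lies in K, a nonabelian
    layer would be empty, so the first p-soluble layer of the series above K is merged with K / W;
    hence h may be smaller than n. *)
Lemma phi_length_lambda_series n G W :
    W <| G -> phi_length_le phi n G W ->
  exists2 h, h <= n & exists f : nat -> {group gT},
    [/\ f 0 = W, f h.*2.+1 = G, forall i, i < h.*2.+2 -> f i <| G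
      & forall i, i < h.*2.+1 -> f i \subset f i.+1 /\
         if odd i then nonabelian_simple_product (f i.+1 / f i)
         else p_soluble p (f i.+1 / f i)].
Proof.
elim: n W => [|n IHn] W nsWG leG.
  exists 0 => //; exists (fun i => if i is 0 then W else G); split=> //.
    by case.
  case=> // _ /=; split; first exact: normal_sub.
  exact/no_phi_factor_quotient.
pose good K := [&& K <| G, W \subset K & p_soluble p (K / W)].
have [K maxK _] : {K : {group gT} | [max K | good K] & W \subset K}.
  apply: maxgroup_exists; rewrite /good nsWG subxx /=.
  apply/no_phi_factor_quotient => [|V U chUV sWV]; first exact: normal_refl.
  have [_ nsUW prVU _] := chief_factorP _ _ _ chUV.
  by case/negP: (proper_subn prVU); apply: subset_trans (normal_sub nsUW) sWV.
have [/and3P[nsKG sWK psolKW] maxK'] := maxgroupP maxK.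
have sKG := normal_sub nsKG; have nKG := normal_norm nsKG.
have nsWK : W <| K := normalS sWK sKG nsWG.
have noKW : no_phi_factor phi K W by apply/no_phi_factor_quotient.
pose M := (inner_radical phi G W <*> K)%G.
have nsRG := inner_radical_normal phi G W.
have nsMG : M <| G by rewrite normalY.
have leR : phi_length_le phi n G (inner_radical phi G W) := leG.
have leM : phi_length_le phi n G M := phi_length_leS (joing_subl _ K) leR.
have [h le_hn [f [f0 fG nf sf]]] := IHn M nsMG leM.
have [eqMK | neMK] := eqVneq M K.
  exists h; first exact: leqW.
  exists (fun i => if i is 0 then W else f i); split=> //.
    by case=> // i lt_i; apply: nf.
  case=> [|i] lt_i; last exact: sf.
  have [s01] := sf 0 lt_i; rewrite /= f0 eqMK in s01 * => psolf1.
  split; first exact: subset_trans sWK s01.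
  have s1G : f 1%N \subset G by apply/normal_sub/nf.
  have nsWf1 : W <| f 1%N := normalS (subset_trans sWK s01) s1G nsWG.
  have nsKf1 : K <| f 1%N := normalS s01 s1G nsKG.
  apply/no_phi_factor_quotient => //.
  apply: (no_phi_factor_ext nsKf1 sWK noKW).
  exact: (no_phi_factor_quotient p nsKf1).1 psolf1.
have sKM : K \subset M := joing_subr _ K.
have nspMK : nonabelian_simple_product (M / K).
  apply: (@inner_radical_simple_product p _ (G / K)%G (M / K)%G).
  (* A minimal normal subgroup of G / K with order outside the class would enlarge K. *)
  - move=> Lb minL sLG; have [/andP[ntL nLG] _] := mingroupP minL.
    have nsLb : Lb <| G / K by apply/andP.
    have [L defL sKL nsLG] := inv_quotientN nsKG nsLb.
    apply: contraT => nphiL; case/negP: ntL.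
    have sLG' := normal_sub nsLG.
    have nsKL : K <| L := normalS sKL sLG' nsKG.
    suffices eqLK : L = K by rewrite defL eqLK trivg_quotient.
    apply/val_inj/maxK' => //; apply/and3P; split; rewrite ?(subset_trans sWK) //.
    have nsWL : W <| L := normalS (subset_trans sWK sKL) sLG' nsWG.
    apply/no_phi_factor_quotient => //.
    apply: (no_phi_factor_ext nsKL sWK noKW) => V U chUV sKV.
    apply: contra nphiL; apply: mixed_order_dvd.
    have [_ nsUL prVU _] := chief_factorP _ _ _ chUV.
    rewrite defL card_quotient ?(normal_norm nsKL) //.
    rewrite -(Lagrange_index (normal_sub nsUL) (subset_trans sKV (proper_sub prVU))).
    by rewrite dvdn_mull // -(Lagrange_index (proper_sub prVU) sKV) dvdn_mulr.
  - exact: quotient_normal.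
  - have nKM : M \subset 'N(K) := subset_trans (normal_sub nsMG) nKG.
    rewrite -subG1 quotient_sub1 //.
    apply: contra neMK => sMK; apply/eqP/val_inj/eqP.
    by rewrite eqEsubset sKM andbT; exact: sMK.
  rewrite /= quotientYidr ?(subset_trans (normal_sub nsRG) nKG) //.
  by apply: quotient_inner_radical => //; rewrite subsetI normal_sub.
exists h.+1 => //.
exists (fun i => if i is j.+1 then if j is k.+1 then f k else K else W); split=> //.
  by case=> [|[|i]] //; rewrite doubleS; apply: nf.
case=> [|[|i]]; rewrite ?doubleS ?ltnS => lti //=.
  by rewrite f0.
by have := sf i lti; rewrite /= negbK.
Qed.

End LambdaSeries.

Lemma nonsoluble_p_lengthP (gT : finGroupType) p n (G : {group gT}) :
  nonsoluble_p_length p G <= n <-> phi_length_le (mixed_order p) n G 1.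
Proof.
rewrite /nonsoluble_p_length; case: ex_minnP => h /existsP[s ser_s] minh; split.
  move=> le_hn; apply: phi_length_leW (sub1G G) le_hn _.
  exact: lambda_series_phi_length ser_s.
case/(phi_length_lambda_series (normal1 G))=> k le_kn [f [f0 fG nf sf]].
apply: leq_trans le_kn; apply: minh; apply/existsP.
pose t := [tuple of mkseq f k.*2.+2].
have tE i : i < k.*2.+2 -> nth 1%G t i = f i by apply: nth_mkseq.
exists t; apply/and4P; split.
- by rewrite tE ?f0.
- by rewrite tE ?fG.
- by apply/forallP=> i; rewrite tE ?nf.
apply/forallP=> i; have [si fi] := sf i (ltn_ord i).
rewrite (tE i (leqW (ltn_ord i))) (tE i.+1 (ltn_ord i)).
by apply/andP; split; [exact: si | exact: fi].
Qed.

Lemma nonsoluble_p_length_product (gT : finGroupType) p (G A B : {group gT}) :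
    mutually_permutable_product G A B ->
  maxn (nonsoluble_p_length p A) (nonsoluble_p_length p B)
    = nonsoluble_p_length p G.
Proof.
move=> mpG; have mpG' := mutually_permutable_sym mpG.
have lower A1 B1 : mutually_permutable_product G A1 B1 ->
    nonsoluble_p_length p A1 <= nonsoluble_p_length p G.
  move=> mp1; apply/nonsoluble_p_lengthP.
  have /nonsoluble_p_lengthP leG := leqnn (nonsoluble_p_length p G).
  have := phi_length_le_restrict (@mixed_order_dvd p) mp1 (normal1 G) leG.
  by apply: phi_length_leS; rewrite subsetIr.
apply/eqP; rewrite eqn_leq geq_max (lower A B) // (lower B A) //=.
apply/nonsoluble_p_lengthP; set m := maxn _ _.
have upper D : nonsoluble_p_length p D <= m ->
    phi_length_le (mixed_order p) m D (D :&: 1)%G.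
  by move/nonsoluble_p_lengthP; apply: phi_length_leS; apply: sub1G.
apply: (phi_length_le_product (@mixed_order_hereditary p)
          (@mixed_order_nonsolvable p) mpG (normal1 G)).
  by apply: upper; apply: leq_maxl.
by apply: upper; apply: leq_maxr.
Qed.

Lemma generalized_fitting_height_product (gT : finGroupType) (G A B : {group gT}) :
    mutually_permutable_product G A B ->
  maxn (generalized_fitting_height A) (generalized_fitting_height B)
    <= generalized_fitting_height G
    <= (maxn (generalized_fitting_height A) (generalized_fitting_height B)).+1.
Proof.
move=> mpG; have mpG' := mutually_permutable_sym mpG.
have lower A1 B1 : mutually_permutable_product G A1 B1 ->
    generalized_fitting_height A1 <= generalized_fitting_height G.
  move=> mp1; apply/generalized_fitting_heightP.
  have /generalized_fitting_heightP leG := leqnn (generalized_fitting_height G).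
  have := phi_length_le_restrict (phi := predT) (fun _ _ _ => id) mp1 (normal1 G) leG.
  by apply: phi_length_leS; rewrite subsetIr.
rewrite geq_max (lower A B) // (lower B A) //=.
apply/generalized_fitting_heightP; set m := maxn _ _.
have upper D : generalized_fitting_height D <= m -> phi_length_le predT m D (D :&: 1)%G.
  by move/generalized_fitting_heightP; apply: phi_length_leS; apply: sub1G.
apply: (phi_length_le_product_succ mpG (normal1 G)).
  by apply: upper; apply: leq_maxl.
by apply: upper; apply: leq_maxr.
Qed.

Theorem theorem1p1 :
  forall (gT : finGroupType) (G A B : {group gT}),
    mutually_permutable_product G A B ->
    [/\ maxn (generalized_fitting_height A) (generalized_fitting_height B)
          <= generalized_fitting_height G
          <= (maxn (generalized_fitting_height A)
                (generalized_fitting_height B)).+1,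
        forall p : nat, prime p ->
          maxn (nonsoluble_p_length p A) (nonsoluble_p_length p B)
          = nonsoluble_p_length p G
      & maxn (nonsoluble_length A) (nonsoluble_length B)
        = nonsoluble_length G].
Proof.
move=> gT G A B mpG; split; first exact: generalized_fitting_height_product.
  by move=> p _; apply: nonsoluble_p_length_product.
exact: nonsoluble_p_length_product.
Qed.
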